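(* Let $U\subseteq\mathbb{R}^n$ be open and convex. For every convex function $f:U\to\mathbb{R}$ and every $\varepsilon>0$ there exists a $C^\infty$ convex function $g:U\to\mathbb{R}$ such that $f-\varepsilon\leq g\leq f$ on $U$. Moreover $g$ can be taken so as to preserve local Lipschitz constants of $f$, meaning that $\mathrm{Lip}(g|_{B})\leq \mathrm{Lip}(f|_{(1+\varepsilon)B})$ for every ball $B\subset U$. And if $f$ is strictly convex (resp. strongly convex), then $g$ can be chosen to be strictly convex (resp. strongly convex).
   Context: For a ball $B$ with center $x$ and radius $r$, $(1+\varepsilon)B$ denotes the ball with center $x$ and radius $(1+\varepsilon)r$; $f|_{(1+\varepsilon)B}$ is the restriction of $f$ to $(1+\varepsilon)B\cap U$. $\mathrm{Lip}(h|_A)$ is the Lipschitz constant of $h$ on $A$ (possibly $+\infty$). Strictly convex: $f((1-t)x+ty)<(1-t)f(x)+tf(y)$ for $x\ne y$, $0<t<1$. Strongly convex: a $C^2$ function $\varphi$ is strongly convex if its second derivative along every (nonconstant) line is strictly positive everywhere on its domain. A not necessarily smooth function $f$ is strongly convex if for every point $p$ of its domain and every $C^\infty$ strongly convex function $\varphi$ defined on a neighborhood of $p$ there is $\delta>0$ such that $f-\delta\varphi$ is convex on some neighborhood of $p$. *)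

(* Defs.v *)
From HB Require Import structures.
From mathcomp Require Import all_boot all_order all_algebra.
From mathcomp Require Import all_classical all_reals all_analysis.

Set Implicit Arguments.
Unset Strict Implicit.
Unset Printing Implicit Defensive.

Import Order.TTheory GRing.Theory Num.Theory.
Import numFieldNormedType.Exports.

Local Open Scope classical_set_scope.
Local Open Scope ring_scope.

Section Definitions.
Variables (R : realType) (n : nat).
Local Notation Rn := 'rV[R]_n.
Implicit Types (U V W A : set Rn) (f g phi h : Rn -> R) (x y v : Rn).

(* The library norm on row vectors is the sup norm; it induces the same
   topology, but balls and Lipschitz constants here are Euclidean. *)
Definition enorm x : R := Num.sqrt (\sum_(i < n) x 0 i ^+ 2).

Definition eball x (r : R) : set Rn := [set y | enorm (y - x) < r].

(* The condition 0 <= L makes the constant 0 (and not -oo) on sets with at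
   most one point; the infimum is +oo when h is not Lipschitz on A. *)
Definition Lip A h : \bar R :=
  ereal_inf [set L%:E | L in [set L : R | 0 <= L /\
    forall x y, A x -> A y -> `|h x - h y| <= L * enorm (x - y)]].

Definition partial (i : 'I_n) h : Rn -> R := 'D_(delta_mx 0 i) h.

Definition iter_partial (s : seq 'I_n) h : Rn -> R := foldr partial h s.

(* Meant for open U: functions are total, and then only the values of h on U
   matter, since the iterated derivatives at a point are determined by the
   germ of h there. *)
Definition C_infty_on U h : Prop :=
  forall (s : seq 'I_n) x, U x ->
    {for x, continuous (iter_partial s h)} /\
    forall i : 'I_n, derivable (iter_partial s h) x (delta_mx 0 i).

Definition strictly_convex_on U f : Prop :=
  forall x y (t : R), U x -> U y -> x != y -> 0 < t < 1 ->
    f ((1 - t) *: x + t *: y) < (1 - t) * f x + t * f y.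

(* For a C^2 function phi: its second derivative along the line x + t v. *)
Definition pos_second_derivative_on V phi : Prop :=
  forall x v, V x -> v != 0 -> 0 < 'D_v ('D_v phi) x.

(* Strong convexity of a not necessarily smooth function: phi ranges over
   the smooth strongly convex functions defined near p. *)
Definition strongly_convex_on U f : Prop :=
  forall p, U p ->
  forall V phi, open V -> V p ->
    C_infty_on V phi -> pos_second_derivative_on V phi ->
  exists delta : R, 0 < delta /\
  exists W, [/\ nbhs p W, W `<=` U `&` V, convex_set W &
    convex_function W (fun x => f x - delta * phi x)].

End Definitions.

(* Main.v *)
(* Letting the radius of the balls tend to 0, the Lipschitz condition forces the
   minimal subgradients of g to be nowhere longer than those of f; conversely, by
   convexity, this domination (expressed by [slope_le]) suffices on every ball.
   The functions with this property are stable under smoothed maxima [smax],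
   under convex combinations and under locally finite gluing.
   Compact sets. Let m be the smallest Lipschitz constant of a minorant of the form
   c - m|x|. The infimal convolution of f with s|x| cuts the slopes at s, and a mixture
   of such convolutions for a sequence of s decreasing to m gives a function close
   to f whose slopes are strictly smaller than those of f wherever the latter
   exceed m. The room gained is spent on smoothing: smoothed maxima of finitely
   many tangents approximate each Lipschitz level, and the levels are glued
   along a grid of slopes fine enough to stay within the gain.
   Globally, approximations on an exhaustion of U by compact sets are lowered by
   constants and glued by smoothed maxima, which preserves a prescribed germ.
   Strong convexity at a point p is obtained by starting the gluing with a tangent
   at p plus a small multiple of a strongly convex function with gradient 0 at p;
   this tangent leaves the necessary room, because a strongly convex f whose
   slope at p is m has m = 0, and then grows quadratically around p.
   Finally an infinite convex combination, with fast decreasing weights, of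
   countably many approximants is smooth and inherits strict convexity from the
   approximants close to f, and strong convexity from those strongly convex
   on some ball of rational center. *)
Require Import Defs.
From HB Require Import structures.
From mathcomp Require Import all_boot all_order all_algebra.
From mathcomp Require Import all_classical all_reals all_analysis.
From mathcomp Require Import ring lra.

Set Implicit Arguments.
Unset Strict Implicit.
Unset Printing Implicit Defensive.

Import Order.TTheory GRing.Theory Num.Theory.
Import numFieldNormedType.Exports.

Local Open Scope classical_set_scope.
Local Open Scope ring_scope.

(** * Euclidean norm *)

Section Euclidean.
Variables (R : realType) (n : nat).
Local Notation Rn := 'rV[R]_n.
Implicit Types (x y z v : Rn).

(** Convolution with a mollifier does not serve: at x it brings in the steeper slopes of nearby
    points, while the domination of slopes is required at every point, with no tolerance. A smoothed
    maximum has at x only slopes of the pieces that come within tolerance of the maximum, so the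
    problem is to keep steep pieces out of play where f is flat. Infimal convolutions do the
    sorting: the one with s|x| coincides with f wherever f has slope at most s. If the flatter
    levels are lowered by less than the steeper ones, a level lies strictly above all steeper ones
    wherever it is exact. The slopes obtained are those of f rounded up to a grid, and the strict
    contraction of slopes pays for the rounding. At slope exactly m nothing can be gained, since a
    minorant of f cannot have a slope below m; there the infimal convolution with m|x| is used if it
    is finite, and otherwise f has no point of slope m. *)

Definition dot x y : R := \sum_(i < n) x 0 i * y 0 i.

Lemma dotC x y : dot x y = dot y x.
Proof. by apply: eq_bigr => i _; rewrite mulrC. Qed.

Lemma dotDr x y z : dot x (y + z) = dot x y + dot x z.
Proof. by rewrite -big_split; apply: eq_bigr => i _; rewrite !mxE mulrDr. Qed.

Lemma dotZr x y (a : R) : dot x (a *: y) = a * dot x y.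
Proof. by rewrite mulr_sumr; apply: eq_bigr => i _; rewrite !mxE mulrCA. Qed.

Lemma dotNr x y : dot x (- y) = - dot x y.
Proof. by rewrite -scaleN1r dotZr mulN1r. Qed.

Lemma dotBr x y z : dot x (y - z) = dot x y - dot x z.
Proof. by rewrite dotDr dotNr. Qed.

Lemma dot0r x : dot x 0 = 0.
Proof. by rewrite -(scale0r 0) dotZr mul0r. Qed.

Lemma dotDl x y z : dot (x + y) z = dot x z + dot y z.
Proof. by rewrite dotC dotDr !(dotC z). Qed.

Lemma dotZl x y (a : R) : dot (a *: x) y = a * dot x y.
Proof. by rewrite dotC dotZr dotC. Qed.

Lemma dot_ge0 x : 0 <= dot x x.
Proof. by apply: sumr_ge0 => i _; rewrite -expr2 sqr_ge0. Qed.

Lemma enormE x : enorm x = Num.sqrt (dot x x).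
Proof. by congr Num.sqrt; apply: eq_bigr => i _; rewrite expr2. Qed.

Lemma enorm_ge0 x : 0 <= enorm x.
Proof. exact: sqrtr_ge0. Qed.

Lemma enorm_sqr x : enorm x ^+ 2 = dot x x.
Proof. by rewrite enormE sqr_sqrtr // dot_ge0. Qed.

Lemma enormZ (a : R) x : enorm (a *: x) = `|a| * enorm x.
Proof.
rewrite !enormE dotZr dotZl mulrA -expr2 sqrtrM ?sqr_ge0 //.
by rewrite sqrtr_sqr.
Qed.

Lemma enorm0 : enorm (0 : Rn) = 0.
Proof. by rewrite -(scale0r 0) enormZ normr0 mul0r. Qed.

Lemma enormN x : enorm (- x) = enorm x.
Proof. by rewrite -scaleN1r enormZ normrN1 mul1r. Qed.

Lemma enormB x y : enorm (x - y) = enorm (y - x).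
Proof. by rewrite -enormN opprB. Qed.

Lemma coord_le_enorm x i : `|x 0 i| <= enorm x.
Proof.
rewrite -sqrtr_sqr; apply: ler_wsqrtr.
by rewrite (bigD1 i) //= lerDl sumr_ge0 // => j _; exact: sqr_ge0.
Qed.

Lemma enorm_eq0 x : (enorm x == 0) = (x == 0).
Proof.
apply/eqP/eqP => [x0|->]; last exact: enorm0.
apply/rowP => i; rewrite mxE; apply/eqP; rewrite -normr_le0.
by rewrite -x0 coord_le_enorm.
Qed.

Lemma dot_le_enorm x y : dot x y <= enorm x * enorm y.
Proof.
have [x0|xn0] := eqVneq (enorm x) 0.
  move/eqP: (x0); rewrite enorm_eq0 => /eqP ->.
  by rewrite enorm0 mul0r dotC dot0r.
have [y0|yn0] := eqVneq (enorm y) 0.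
  move/eqP: (y0); rewrite enorm_eq0 => /eqP ->.
  by rewrite enorm0 mulr0 dot0r.
set a := enorm x in xn0 *; set b := enorm y in yn0 *.
have ab : 0 < a * b by rewrite mulr_gt0 // lt_def ?xn0 ?yn0 enorm_ge0.
have := dot_ge0 (b *: x - a *: y).
rewrite dotBr !(dotC (_ - _)) !dotBr !dotZr !(dotC (_ *: _)) !dotZr.
rewrite (dotC y x) -!enorm_sqr -/a -/b => H.
rewrite -subr_ge0 -(pmulr_rge0 _ ab).
have : 0 <= 2 * (a * b * (a * b - dot x y)) by nra.
lra.
Qed.

Lemma enormD x y : enorm (x + y) <= enorm x + enorm y.
Proof.
rewrite -(@ler_pXn2r _ 2) ?nnegrE ?addr_ge0 ?enorm_ge0 //.
rewrite sqrrD !enorm_sqr dotDr !dotDl (dotC y x).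
have := dot_le_enorm x y; lra.
Qed.

Lemma normr_le_enorm x : `|x| <= enorm x.
Proof.
rewrite /Num.Def.normr /= mx_normrE.
apply/bigmax_leP; split; first exact: enorm_ge0.
by move=> [i j] _ /=; rewrite (ord1 i); exact: coord_le_enorm.
Qed.

Lemma coord_le_normr x i : `|x 0 i| <= `|x|.
Proof.
rewrite [leRHS]/Num.Def.normr /= mx_normrE.
by apply/bigmax_geP; right => /=; exists (0, i).
Qed.

Lemma enorm_le_normr x : enorm x <= n%:R * `|x|.
Proof.
rewrite -(@ler_pXn2r _ 2) ?nnegrE ?enorm_ge0 ?mulr_ge0 //.
rewrite enorm_sqr exprMn.
apply: (@le_trans _ _ (\sum_(i < n) `|x| ^+ 2)).
  apply: ler_sum => i _; rewrite -expr2 -(ger0_norm (sqr_ge0 _)) normrX.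
  by rewrite ler_pXn2r ?nnegrE // coord_le_normr.
rewrite sumr_const card_ord -[leLHS]mulr_natl ler_wpM2r ?sqr_ge0 //.
by rewrite -natrX ler_nat; case: (n) => // m; rewrite expnS leq_pmulr.
Qed.

Lemma nbhs_enormP x (A : set Rn) :
  nbhs x A <-> exists2 r, 0 < r & forall y, enorm (y - x) < r -> A y.
Proof.
split=> [/nbhs_ballP [r /= r0 rA]|[r r0 rA]].
  exists r => // y yx; apply: rA; rewrite -ball_normE /=.
  by rewrite distrC (le_lt_trans (normr_le_enorm _)).
(* The Euclidean norm is at most n times the sup norm; n+1 instead of n keeps the radius positive in
   dimension 0. *)
apply/nbhs_ballP; exists (r / n.+1%:R) => /=; first by rewrite divr_gt0.
move=> y; rewrite -ball_normE /= ltr_pdivlMr // distrC => yx; apply: rA.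
apply: le_lt_trans (enorm_le_normr _) (le_lt_trans _ yx).
by rewrite mulrC ler_wpM2l // ler_nat.
Qed.

Lemma near_enorm x r : 0 < r -> \forall y \near x, enorm (y - x) < r.
Proof. by move=> r0; apply/nbhs_enormP; exists r. Qed.

Lemma open_enorm (U : set Rn) x : open U -> U x ->
  exists2 r, 0 < r & forall y, enorm (y - x) < r -> U y.
Proof. by move=> oU Ux; apply/nbhs_enormP; exact: open_nbhs_nbhs. Qed.

Lemma convex_set_comb (U : set Rn) : convex_set U ->
  forall x y (t : R), U x -> U y -> 0 <= t <= 1 -> U ((1 - t) *: x + t *: y).
Proof.
move=> cU x y t Ux Uy t01.
have t01' : t \in `[0, 1]%R by rewrite in_itv.
pose l : {i01 R} := Itv01 (andP t01).1 (andP t01).2.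
have := cU y x l; rewrite !inE => /(_ Uy Ux).
by rewrite /conv /= addrC.
Qed.

Lemma convex_set_combP (U : set Rn) :
  (forall x y (t : R), U x -> U y -> 0 <= t <= 1 -> U ((1 - t) *: x + t *: y)) ->
  convex_set U.
Proof.
move=> H x y l; rewrite !inE => Ux Uy.
have l01 : 0 <= l%:num <= 1 by rewrite ge0 le1.
by have := H y x _ Uy Ux l01; rewrite addrC.
Qed.

Lemma enorm_comb_lt p (r : R) x y t : enorm (x - p) < r -> enorm (y - p) < r ->
  0 <= t <= 1 -> enorm ((1 - t) *: x + t *: y - p) < r.
Proof.
move=> xr yr /andP[t0 t1].
have -> : (1 - t) *: x + t *: y - p = (1 - t) *: (x - p) + t *: (y - p).
  by apply/rowP => i; rewrite !mxE; ring.
apply: le_lt_trans (enormD _ _) _; rewrite !enormZ !ger0_norm //; last by lra.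
have [->|tn0] := eqVneq t 0; first by rewrite subr0 mul1r mul0r addr0.
have {}t0 : 0 < t by rewrite lt_def tn0.
have t1' : 0 <= 1 - t by lra.
have := ler_wpM2l t1' (ltW xr); have : t * enorm (y - p) < t * r by rewrite ltr_pM2l.
lra.
Qed.

End Euclidean.

(** * Convexity and descending slopes *)

Section Convexity.
Variables (R : realType) (n : nat).
Local Notation Rn := 'rV[R]_n.
Implicit Types (x y z v : Rn) (U : set Rn) (f h : Rn -> R).

(** The defect of convexity is linear in [h]: bounds on it pass to mixtures, and strict and strong
    convexity become lower bounds on it. *)
Definition gap h x y (t : R) : R :=
  (1 - t) * h x + t * h y - h ((1 - t) *: x + t *: y).

Definition cvx U h := forall x y (t : R), U x -> U y -> 0 <= t <= 1 ->
  0 <= gap h x y t.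

Lemma convex_functionP U h : convex_function U h <-> cvx U h.
Proof.
split=> [ch x y t Ux Uy t01|ch t x y].
  pose l : {i01 R} := Itv01 (andP t01).1 (andP t01).2.
  have := ch l y x; rewrite !inE => /(_ Uy Ux).
  rewrite /conv /= => H; rewrite subr_ge0 addrC.
  by rewrite (addrC (_ * h x)).
rewrite !inE => Ux Uy.
have l01 : 0 <= t%:num <= 1 by rewrite ge0 le1.
have := ch y x t%:num Uy Ux l01; rewrite subr_ge0 addrC.
by rewrite (addrC (_ * h y)).
Qed.

Lemma cvx_le U h x y (t : R) : cvx U h -> U x -> U y -> 0 <= t <= 1 ->
  h ((1 - t) *: x + t *: y) <= (1 - t) * h x + t * h y.
Proof. by move=> ch Ux Uy t01; rewrite -subr_ge0; exact: ch. Qed.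

Lemma comb_sub x y (t : R) : (1 - t) *: x + t *: y - x = t *: (y - x).
Proof. by apply/rowP => i; rewrite !mxE; ring. Qed.

Lemma combE x y (t : R) : (1 - t) *: x + t *: y = x + t *: (y - x).
Proof. by apply/rowP => i; rewrite !mxE; ring. Qed.

(* The minimal norm of a subgradient of a convex function h at x is the least
   nonnegative L such that [slope_le U h x L]. *)
Definition slope_le U h x (L : R) :=
  forall y, U y -> h x - h y <= L * enorm (x - y).

Lemma slope_le_trans U h x (L L' : R) : L <= L' ->
  slope_le U h x L -> slope_le U h x L'.
Proof.
move=> LL' hL y /hL /le_trans; apply.
by rewrite ler_wpM2r // enorm_ge0.
Qed.

(** By convexity the rate of descent along a segment issued from [x] is largest near [x], so [y] may
    be replaced by a point of the segment close to [x]. Slopes are thus local, which links them to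
    Lipschitz constants on balls. *)
Lemma slope_le_loc U h x (L r : R) : convex_set U -> cvx U h -> U x -> 0 < r ->
  (forall y, U y -> enorm (y - x) < r -> h x - h y <= L * enorm (x - y)) ->
  slope_le U h x L.
Proof.
move=> cU ch Ux r0 hL y Uy.
have [N0|Nn0] := eqVneq (enorm (y - x)) 0.
  by apply: hL => //; rewrite N0.
have N0 : 0 < enorm (y - x) by rewrite lt_def Nn0 enorm_ge0.
pose t := Num.min 1 (r / 2 / enorm (y - x)).
have t0 : 0 < t by rewrite lt_min ltr01 /= !divr_gt0.
have t1 : t <= 1 by rewrite ge_min lexx.
have tr : t * enorm (y - x) < r.
  apply: (@le_lt_trans _ _ (r / 2)); last by lra.
  by rewrite -ler_pdivlMr // ge_min lexx orbT.
have t01 : 0 <= t <= 1 by rewrite ltW.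
have Uz := convex_set_comb cU Ux Uy t01.
have := cvx_le ch Ux Uy t01.
have := hL _ Uz; rewrite (enormB x) comb_sub enormZ gtr0_norm //.
move=> /(_ tr); rewrite (enormB x y).
set a := h _; set b := h _; set c := h _; set N := enorm _ => H1 H2.
rewrite -(ler_pM2l t0); nra.
Qed.

(** Finite-dimensional Hahn-Banach: the gradient is built one coordinate at a time, [k] being the
    number of coordinates in which the competitor [y] may differ from [z]. *)
Lemma subgradient_exists U h z : open U -> convex_set U -> cvx U h -> U z ->
  exists xi, forall y, U y -> h z + dot xi (y - z) <= h y.
Proof.
move=> oU cU ch Uz.
have [r r0 rU] := open_enorm oU Uz.
suff H k : exists xi, forall y, U y ->
    (forall i : 'I_n, (k <= i)%N -> y 0 i = z 0 i) ->
    h z + dot xi (y - z) <= h y.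
  have [xi Hxi] := H n; exists xi => y Uy; apply: Hxi => // i.
  by rewrite leqNgt ltn_ord.
elim: k => [|k [xi IH]].
  exists 0 => y Uy yz; suff -> : y = z by rewrite subrr dot0r addr0.
  by apply/rowP => i; exact: yz.
have [kn|nk] := ltnP k n; last first.
  exists xi => y Uy yz; apply: IH => // i ki.
  by move: (ltn_ord i); rewrite ltnNge (leq_trans nk ki).
pose k' := Ordinal kn; pose e : Rn := delta_mx 0 k'.
have dot_e y : dot e y = y 0 k'.
  rewrite /dot (bigD1 k') //= big1 ?addr0 ?mxE ?eqxx ?mul1r // => i ik.
  by rewrite mxE eqxx /= (negbTE ik) mul0r.
pose xi0 := xi - xi 0 k' *: e.
pose rho y := h y - h z - dot xi0 (y - z).
pose S y := U y /\ (forall i : 'I_n, (k < i)%N -> y 0 i = z 0 i).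
have rho_conv y y' t : U y -> U y' -> 0 <= t <= 1 ->
    rho ((1 - t) *: y + t *: y') <= (1 - t) * rho y + t * rho y'.
  move=> Uy Uy' t01; have := cvx_le ch Uy Uy' t01; rewrite /rho.
  rewrite !dotBr dotDr !dotZr.
  set a := h _; set b := h _; set c := h _; set d := h _ => H.
  lra.
have rho_ge0 y : S y -> y 0 k' = z 0 k' -> 0 <= rho y.
  move=> [Uy Sy] yk; have : h z + dot xi (y - z) <= h y.
    apply: IH => // i; rewrite leq_eqVlt => /predU1P[ki|]; last exact: Sy.
    by rewrite (_ : i = k') //; apply: val_inj.
  have -> : dot xi (y - z) = dot xi0 (y - z).
    rewrite !(dotC _ (y - z)) /xi0 (dotBr (y - z) xi) dotZr (dotC _ e) dot_e.
    by rewrite !mxE yk subrr mulr0 subr0.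
  by rewrite /rho; lra.
(* The coefficient of the new coordinate must lie above the slopes of [rho] on the left of [z] (the
   set [A]) and below those on the right; [key] says that the former never exceed the latter, so
   [sup A] fits. *)
pose A := [set - rho y / (z 0 k' - y 0 k') | y in [set y | S y /\ y 0 k' < z 0 k']].
have key y y' : S y -> S y' -> y 0 k' < z 0 k' -> z 0 k' < y' 0 k' ->
    - rho y / (z 0 k' - y 0 k') <= rho y' / (y' 0 k' - z 0 k').
  move=> [Uy Sy] [Uy' Sy'] yz zy'.
  set p := z 0 k' - y 0 k'; set q := y' 0 k' - z 0 k'.
  have p0 : 0 < p by rewrite subr_gt0.
  have q0 : 0 < q by rewrite subr_gt0.
  have pq0 : 0 < p + q by rewrite addr_gt0.
  pose t := p / (p + q).
  have t01 : 0 <= t <= 1.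
    rewrite /t; apply/andP; split; first by rewrite divr_ge0 ?ltW.
    by rewrite ler_pdivrMr // mul1r lerDl ltW.
  have tE : t * (p + q) = p by rewrite /t divfK // gt_eqF.
  have w_ge0 : 0 <= rho ((1 - t) *: y + t *: y').
    apply: rho_ge0; last by rewrite !mxE; move: tE; rewrite /p /q; lra.
    split; first exact: convex_set_comb.
    by move=> i ki; rewrite !mxE Sy // Sy' //; ring.
  rewrite ler_pdivlMr // mulrAC ler_pdivrMr //.
  have := le_trans w_ge0 (rho_conv _ _ _ Uy Uy' t01).
  move=> /(ler_wpM2l (ltW pq0)); rewrite mulr0.
  have -> : (p + q) * ((1 - t) * rho y + t * rho y') =
    (p + q - t * (p + q)) * rho y + t * (p + q) * rho y' by ring.
  rewrite tE; nra.
have Sd d : `|d| < r -> S (z + d *: e).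
  move=> dr; split.
    apply: rU; rewrite addrC addKr enormZ.
    have -> : enorm e = 1.
      by rewrite enormE dot_e mxE !eqxx sqrtr1.
    by rewrite mulr1.
  move=> i ki; rewrite !mxE eqxx /= (_ : i == k' = false) ?mulr0 ?addr0 //.
  by apply/negbTE; rewrite -val_eqE /= gtn_eqF.
have kd d : (z + d *: e) 0 k' = z 0 k' + d by rewrite !mxE !eqxx mulr1.
have r2 : `|r / 2| < r by rewrite gtr0_norm; lra.
have Ann : A !=set0.
  exists (- rho (z + (- (r / 2)) *: e) / (z 0 k' - (z + (- (r / 2)) *: e) 0 k')).
  exists (z + (- (r / 2)) *: e) => //; split.
    by apply: Sd; rewrite normrN.
  by rewrite kd; lra.
have Aub y' : S y' -> z 0 k' < y' 0 k' ->
    ubound A (rho y' / (y' 0 k' - z 0 k')).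
  by move=> Sy' zy' _ [y [Sy yz] <-]; exact: key.
have Aubd : has_ubound A.
  exists (rho (z + (r / 2) *: e) / ((z + (r / 2) *: e) 0 k' - z 0 k')).
  by apply: Aub; [exact: Sd|rewrite kd; lra].
exists (xi0 + sup A *: e) => y Uy Sy.
suff : sup A * (y 0 k' - z 0 k') <= rho y.
  by rewrite /rho dotDl dotZl dot_e !mxE; set a := dot _ _; lra.
have [yz|zy|] := ltgtP (y 0 k') (z 0 k'); last 1 first.
- by move=> yz; rewrite yz subrr mulr0; apply: rho_ge0.
- have p0 : 0 < z 0 k' - y 0 k' by rewrite subr_gt0.
  have : - rho y / (z 0 k' - y 0 k') <= sup A.
    by apply: ub_le_sup => //; exists y.
  by rewrite ler_pdivrMr // mulrBr => H; rewrite mulrBr; lra.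
- have p0 : 0 < y 0 k' - z 0 k' by rewrite subr_gt0.
  rewrite -ler_pdivlMr //.
  by apply: ge_sup => //; apply: Aub.
Qed.

End Convexity.

(** * Infimal convolution with a multiple of the norm *)

Section InfConvolution.
Variables (R : realType) (n : nat) (U : set 'rV[R]_n).
Hypotheses (oU : open U) (cU : convex_set U).
Local Notation Rn := 'rV[R]_n.
Implicit Types (x y z v : Rn) (f h : Rn -> R) (s L c : R).

Definition cone_minorized f s := exists c, forall z, U z -> c <= f z + s * enorm z.

(** [inf] is a true infimum as soon as [U] is inhabited and [cone_minorized f s] holds. *)
Definition infconv f s x : R := inf [set f z + s * enorm (x - z) | z in U].

Lemma cone_minorizedW f s s' : s <= s' -> cone_minorized f s -> cone_minorized f s'.
Proof.
move=> ss' [c Hc]; exists c => z Uz; apply: le_trans (Hc _ Uz) _.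
by rewrite lerD2l ler_wpM2r // enorm_ge0.
Qed.

Lemma slope_le_cone_minorized f x s : 0 <= s -> U x -> slope_le U f x s -> cone_minorized f s.
Proof.
move=> s0 Ux Hs; exists (f x - s * enorm x) => z Uz.
have := Hs z Uz.
have : s * enorm (x - z) <= s * (enorm x + enorm z).
  by rewrite ler_wpM2l // -(enormN z) enormD.
lra.
Qed.

Section Fixed.
Variables (f : Rn -> R) (s : R).
Hypotheses (s0 : 0 <= s) (fs : cone_minorized f s).

Lemma infconv_has_lbound x : has_lbound [set f z + s * enorm (x - z) | z in U].
Proof.
have [c Hc] := fs; exists (c - s * enorm x) => _ [z Uz <-].
have := Hc z Uz.
have : s * enorm z <= s * (enorm (x - z) + enorm x).
  rewrite ler_wpM2l // enormB; apply: le_trans (enormD _ _).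
  by rewrite subrK.
lra.
Qed.

Lemma infconv_le x z : U z -> infconv f s x <= f z + s * enorm (x - z).
Proof. by move=> Uz; apply: ge_inf; [exact: infconv_has_lbound|exists z]. Qed.

Lemma infconv_le_fun x : U x -> infconv f s x <= f x.
Proof. by move=> /(@infconv_le x); rewrite subrr enorm0 mulr0 addr0. Qed.

Lemma infconv_ge x0 x c : U x0 ->
  (forall z, U z -> c <= f z + s * enorm (x - z)) -> c <= infconv f s x.
Proof.
move=> Ux0 H; apply: lb_le_inf; first by exists (f x0 + s * enorm (x - x0)), x0.
by move=> _ [z Uz <-]; exact: H.
Qed.

Lemma infconv_lt x0 x c : U x0 -> infconv f s x < c ->
  exists2 z, U z & f z + s * enorm (x - z) < c.
Proof.
move=> Ux0 Hc; apply: contrapT => H; suff : c <= infconv f s x by rewrite leNgt Hc.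
apply: (infconv_ge Ux0) => z Uz; rewrite leNgt; apply/negP => zc.
by apply: H; exists z.
Qed.

Lemma infconv_slope_ge x : U x -> slope_le U (infconv f s) x s.
Proof.
move=> Ux y Uy; rewrite lerBlDl -lerBlDr; apply: (infconv_ge Ux) => z Uz.
have := infconv_le x Uz.
have : s * enorm (x - z) <= s * (enorm (x - y) + enorm (y - z)).
  rewrite ler_wpM2l //; apply: le_trans (enormD _ _).
  by rewrite addrA subrK.
lra.
Qed.

Lemma infconv_eq x : U x -> slope_le U f x s -> infconv f s x = f x.
Proof.
move=> Ux Hs; apply/eqP; rewrite eq_le infconv_le_fun //=.
by apply: (infconv_ge Ux) => z Uz; have := Hs z Uz; lra.
Qed.

(** If s <= L, the convolution is s-Lipschitz anyway. If L < s, it agrees with [f] at [x], and the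
    cone of slope L that supports [f] there also supports the convolution. *)
Lemma infconv_slope x L : 0 <= L -> U x -> slope_le U f x L ->
  slope_le U (infconv f s) x L.
Proof.
move=> L0 Ux HL; have [sL|Ls] := leP s L.
  exact: slope_le_trans sL (infconv_slope_ge Ux).
move=> y Uy; rewrite infconv_eq //; last exact: slope_le_trans (ltW Ls) HL.
rewrite lerBlDl -lerBlDr; apply: (infconv_ge Ux) => z Uz.
have := HL z Uz.
have : L * enorm (x - z) <= L * (enorm (x - y) + enorm (y - z)).
  rewrite ler_wpM2l //; apply: le_trans (enormD _ _).
  by rewrite addrA subrK.
have : L * enorm (y - z) <= s * enorm (y - z).
  by rewrite ler_wpM2r ?enorm_ge0 // ltW.
lra.
Qed.

Lemma infconv_cvx : cvx U f -> cvx U (infconv f s).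
Proof.
move=> cf x y t Ux Uy t01; have /andP[t0 t1] := t01.
rewrite subr_ge0; apply/ler_addgt0Pr => e e0.
have [z Uz Hz] : exists2 z, U z & f z + s * enorm (x - z) < infconv f s x + e.
  by apply: (infconv_lt Ux); lra.
have [w Uw Hw] : exists2 w, U w & f w + s * enorm (y - w) < infconv f s y + e.
  by apply: (infconv_lt Ux); lra.
apply: le_trans (infconv_le _ (convex_set_comb cU Uz Uw t01)) _.
have := cvx_le cf Uz Uw t01.
have : enorm ((1 - t) *: x + t *: y - ((1 - t) *: z + t *: w)) <=
   (1 - t) * enorm (x - z) + t * enorm (y - w).
  have -> : (1 - t) *: x + t *: y - ((1 - t) *: z + t *: w) =
      (1 - t) *: (x - z) + t *: (y - w) by apply/rowP => i; rewrite !mxE; ring.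
  apply: le_trans (enormD _ _) _; rewrite !enormZ !ger0_norm //; lra.
set N := enorm _; set A := f _ => NH AH.
have := ler_wpM2l s0 NH => H1.
have H2 : (1 - t) * (f z + s * enorm (x - z)) <= (1 - t) * (infconv f s x + e).
  by apply: ler_wpM2l; [lra|exact: ltW].
have H3 : t * (f w + s * enorm (y - w)) <= t * (infconv f s y + e).
  by apply: ler_wpM2l => //; exact: ltW.
lra.
Qed.

End Fixed.

Lemma infconv_mono f s s' x : U x -> 0 <= s -> s <= s' -> cone_minorized f s ->
  infconv f s x <= infconv f s' x.
Proof.
move=> Ux s0 ss' fs; apply: (infconv_ge Ux) => z Uz.
apply: le_trans (infconv_le s0 fs x Uz) _.
by rewrite lerD2l ler_wpM2r // enorm_ge0.
Qed.

(** Take a subgradient at [z] of the infimal convolution with slope [s]: this function is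
    s-Lipschitz, which bounds the gradient, and it lies below [f] with equality at [z], so its
    tangent supports [f]. *)
Lemma support_slope f z s : 0 <= s -> cvx U f -> U z -> slope_le U f z s ->
  exists2 xi, enorm xi <= s & forall y, U y -> f z + dot xi (y - z) <= f y.
Proof.
move=> s0 cf Uz fz; have fs := slope_le_cone_minorized s0 Uz fz.
have [xi Hxi] := subgradient_exists oU cU (infconv_cvx s0 fs cf) Uz.
have fzE := infconv_eq s0 fs Uz fz.
exists xi; last first.
  move=> y Uy; rewrite -fzE.
  exact: le_trans (Hxi _ Uy) (infconv_le_fun s0 fs Uy).
have [->|xi0] := eqVneq (enorm xi) 0; first by [].
have {}xi0 : 0 < enorm xi by rewrite lt_def xi0 enorm_ge0.
have [r r0 rU] := open_enorm oU Uz.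
pose t := r / 2 / enorm xi; have t0 : 0 < t by rewrite !divr_gt0.
have zE : z + t *: xi - z = t *: xi by rewrite addrC addKr.
have Uy : U (z + t *: xi).
  apply: rU; rewrite zE enormZ gtr0_norm // /t divfK ?gt_eqF //; lra.
have := Hxi _ Uy; have := infconv_slope_ge s0 fs Uy Uz.
rewrite zE enormZ dotZr -enorm_sqr gtr0_norm // => H1 H2.
have H : t * enorm xi * enorm xi <= t * enorm xi * s by nra.
by move: H; rewrite ler_pM2l // mulr_gt0.
Qed.

End InfConvolution.

(** * A smooth maximum *)

(** A quadratic remainder is what explicit estimates deliver: at the junction point of [flat], for
    polynomials, and for sums of series. *)
Lemma is_derive_quadratic (R : realType) (V : normedModType R) (f : V -> R)
    (x v : V) (d C r : R) : 0 < r ->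
  (forall t, `|t| < r -> `|f (t *: v + x) - f x - t * d| <= C * t ^+ 2) ->
  is_derive x v f d.
Proof.
move=> r0 Hf.
have C0 : 0 <= C.
  have := Hf (r / 2); rewrite gtr0_norm ?divr_gt0 // => /(_ ltac:(lra)) H.
  have : 0 <= C * (r / 2) ^+ 2 by apply: le_trans H; exact: normr_ge0.
  by rewrite pmulr_lge0 // exprn_gt0 // divr_gt0.
have cv : h^-1 *: (f (h *: v + x) - f x) @[h --> 0^'] --> d.
  apply/cvgrPdist_le => e e0.
  near=> h.
  have hn0 : h != 0 by near: h; exact: nbhs_dnbhs_neq.
  have hr : `|h| < r.
    by near: h; apply: dnbhs0_lt.
  have he : `|h| <= e / (C + 1).
    by near: h; apply: dnbhs0_le; rewrite divr_gt0 // ltr_wpDl.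
  have -> : d - h^-1 *: (f (h *: v + x) - f x) =
      - (h^-1 * (f (h *: v + x) - f x - h * d)).
    by rewrite /GRing.scale /=; field.
  rewrite normrN normrM normfV ler_pdivrMl ?normr_gt0 //.
  apply: le_trans (Hf _ hr) _.
  rewrite -(real_normK (num_real h)) expr2 mulrCA ler_wpM2l //.
  rewrite ler_pdivlMr ?ltr_wpDl // in he.
  by apply: le_trans he; rewrite mulrDr mulr1 mulrC lerDl.
by split; [apply/cvg_ex; exists d | exact: cvg_lim].
Unshelve. all: by end_near. Qed.

(** * Smooth functions of one variable and a smooth step *)

Section Smooth1.
Variable R : realType.
Implicit Types (f g h : R -> R) (k : nat) (x t : R).

Fixpoint differentiable_upto k h : Prop :=
  if k is k'.+1 then (forall x, derivable h x 1) /\ differentiable_upto k' (derive1 h)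
  else True.

Definition smooth1 h := forall k, differentiable_upto k h.

Lemma differentiable_uptoP k h h' : (forall x, is_derive x 1 h (h' x)) ->
  differentiable_upto k h' -> differentiable_upto k.+1 h.
Proof.
move=> dh Hh'; split=> [x|]; first by have [] := dh x.
suff -> : (derive1 h) = h' by [].
by apply/funext => x; rewrite derive1E; have [_] := dh x.
Qed.

Lemma differentiable_upto_derive k h : differentiable_upto k.+1 h ->
  forall x, is_derive x 1 h ((derive1 h) x).
Proof. by move=> [dh _] x; rewrite derive1E; exact: derivableP. Qed.

Lemma differentiable_uptoW k h : differentiable_upto k.+1 h -> differentiable_upto k h.
Proof. by elim: k h => [//|k IH] h [dh Hh]; split => //; exact: IH. Qed.

Lemma differentiable_upto_cst k (c : R) : differentiable_upto k (fun=> c).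
Proof.
elim: k c => [//|k IH] c; exact: (differentiable_uptoP _ (IH 0)).
Qed.

Lemma differentiable_uptoD k f g : differentiable_upto k f -> differentiable_upto k g ->
  differentiable_upto k (fun x => f x + g x).
Proof.
elim: k f g => [//|k IH] f g Hf Hg.
apply: (differentiable_uptoP _ (IH _ _ Hf.2 Hg.2)) => x.
have df := differentiable_upto_derive Hf x; have dg := differentiable_upto_derive Hg x.
exact: is_deriveD.
Qed.

Lemma differentiable_uptoM k f g : differentiable_upto k f -> differentiable_upto k g ->
  differentiable_upto k (fun x => f x * g x).
Proof.
elim: k f g => [//|k IH] f g Hf Hg.
have := differentiable_uptoD (IH _ _ (differentiable_uptoW Hf) Hg.2)
  (IH _ _ (differentiable_uptoW Hg) Hf.2).
apply: differentiable_uptoP => x.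
have df := differentiable_upto_derive Hf x; have dg := differentiable_upto_derive Hg x.
exact: is_deriveM.
Qed.

Lemma differentiable_upto_id k : differentiable_upto k (fun x => x).
Proof.
case: k => [//|k]; apply: (@differentiable_uptoP _ _ (fun=> 1)).
exact: differentiable_upto_cst.
Qed.

Lemma differentiable_uptoV k f : (forall x, f x != 0) -> differentiable_upto k f ->
  differentiable_upto k (fun x => (f x)^-1).
Proof.
move=> f0; elim: k => [//|k IH] Hf; have Hv := IH (differentiable_uptoW Hf).
have := differentiable_uptoM (differentiable_upto_cst k (-1))
  (differentiable_uptoM (differentiable_uptoM Hv Hv) Hf.2).
apply: differentiable_uptoP => x.
have := differentiable_upto_derive Hf x => dfx.
apply: (is_derive_eq (is_deriveV (f0 x) dfx)).
by rewrite /GRing.scale /=; field.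
Qed.

Lemma differentiable_upto_comp k f g : differentiable_upto k f -> differentiable_upto k g ->
  differentiable_upto k (f \o g).
Proof.
elim: k f g => [//|k IH] f g Hf Hg.
have := differentiable_uptoM (IH _ _ Hf.2 (differentiable_uptoW Hg)) Hg.2.
apply: differentiable_uptoP => x.
have := differentiable_upto_derive Hf (g x) => dfx.
have := differentiable_upto_derive Hg x => dgx.
by apply: is_derive_eq => //; rewrite mulrC.
Qed.

(** These functions span the derivatives of exp(-1/t) extended by 0: the derivative of [flat j] is
    [flat j.+2] minus j times [flat j.+1]. *)
Definition flat (j : nat) t := if t <= 0 then 0 else t ^- j * expR (- t^-1).

(** The term of degree j+2 of the exponential series at 1/t beats the factor t^-j with two powers of
    t to spare, which is what differentiability at 0 with derivative 0 takes. *)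
Lemma flat_le j t : `|flat j t| <= (j.+2)`!%:R * t ^+ 2.
Proof.
rewrite /flat; case: ifPn => [_|]; first by rewrite normr0 mulr_ge0 ?sqr_ge0.
rewrite -ltNge => t0; rewrite ger0_norm; last first.
  by rewrite mulr_ge0 ?expR_ge0 // invr_ge0 exprn_ge0 // ltW.
rewrite expRN.
have t1 : 0 <= t^-1 by rewrite invr_ge0 ltW.
have := expR_ge1Dxn j.+1 t1.
set F := (_`!%:R); have F0 : 0 < F by rewrite ltr0n fact_gt0.
move=> H; have {}H : t^-1 ^+ j.+2 / F <= expR t^-1 by lra.
rewrite ler_pdivrMl ?exprn_gt0 // -[leLHS]mul1r ler_pdivrMr ?expR_gt0 //.
have T : t ^+ j * (F * t ^+ 2) * (t^-1 ^+ j.+2 / F) = 1.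
  rewrite exprVn -(addn2 j) exprD; field.
  by rewrite !gt_eqF //= exprn_gt0.
rewrite -T ler_wpM2l // mulr_ge0 ?exprn_ge0 ?ltW // mulr_gt0 // exprn_gt0 //.
Qed.

Lemma is_derive_flat j x : is_derive x 1 (flat j) (flat j.+2 x - j%:R * flat j.+1 x).
Proof.
have [x0|x0|->] := ltgtP x 0.
- have -> : flat j.+2 x - j%:R * flat j.+1 x = 0.
    by rewrite /flat ltW // mulr0 subr0.
  have D0 : is_derive x 1 (cst (0 : R)) 0 by exact: is_derive_cst.
  apply: near_eq_is_derive D0; near=> y; rewrite /flat ifT // ltW //.
  by near: y; exact: lt_nbhsl.
- have xn0 : x != 0 by rewrite gt_eqF.
  have D : is_derive x 1 (fun y => (y ^+ j)^-1 * expR (- y^-1))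
      (flat j.+2 x - j%:R * flat j.+1 x).
    have dV : is_derive x 1 (fun y => - y^-1) (x ^- 2).
      apply: (is_derive_eq (is_deriveN (is_deriveV xn0 (is_derive_id x 1)))).
      by rewrite scaleNr opprK /GRing.scale /= mulr1.
    have dE := @is_derive1_comp _ expR _ x _ _ (is_derive_expR _) dV.
    have xj0 : x ^+ j != 0 by rewrite expf_neq0.
    have dXj : is_derive x 1 (fun y : R => y ^+ j) (j%:R * x ^+ j.-1 *: 1).
      by apply: DeriveDef; [exact: exprn_derivable|exact: exp_derive].
    have dX := @is_deriveV _ (fun y : R => y ^+ j) x _ _ xj0 dXj.
    apply: (is_derive_eq (is_deriveM dX dE)).
    rewrite /flat leNgt x0 /= /GRing.scale /=; case: j xj0 {dX dXj} => [|j] xj0.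
      by rewrite expr0 expr1; field.
    by rewrite /= !exprS; field; rewrite xn0 expf_neq0.
  apply: near_eq_is_derive D.
  near=> y; rewrite /flat ifF //; apply/negbTE; rewrite -ltNge.
  by near: y; exact: lt_nbhsr.
- rewrite {2 3}/flat lexx mulr0 subr0.
  apply: (@is_derive_quadratic _ _ _ _ _ _ (j.+2)`!%:R 1) => // t _.
  rewrite {2}/flat lexx mulr0 !subr0 addr0.
  by rewrite /GRing.scale /= mulr1 flat_le.
Unshelve. all: by end_near. Qed.

Lemma differentiable_upto_flat k j : differentiable_upto k (flat j).
Proof.
elim: k j => [//|k IH] j.
have := differentiable_uptoD (IH j.+2)
  (differentiable_uptoM (differentiable_upto_cst k (- j%:R)) (IH j.+1)).
apply: differentiable_uptoP => x.
by have := is_derive_flat j x; rewrite mulNr.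
Qed.

Definition step t := flat 0 t / (flat 0 t + flat 0 (1 - t)).

Lemma flat0_ge0 t : 0 <= flat 0 t.
Proof. by rewrite /flat; case: ifP => // _; rewrite invr1 mul1r expR_ge0. Qed.

Lemma flat0E t : 0 < t -> flat 0 t = expR (- t^-1).
Proof. by move=> t0; rewrite /flat leNgt t0 /= invr1 mul1r. Qed.

Lemma flat0_gt0 t : 0 < t -> 0 < flat 0 t.
Proof. by move=> t0; rewrite flat0E // expR_gt0. Qed.

Lemma step_den_gt0 t : 0 < flat 0 t + flat 0 (1 - t).
Proof.
have [t0|t0] := ltP 0 t; first by rewrite ltr_wpDr ?flat0_ge0 ?flat0_gt0.
by rewrite ltr_wpDl ?flat0_ge0 // flat0_gt0 //; lra.
Qed.

Lemma flat0_mono s t : s <= t -> flat 0 s <= flat 0 t.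
Proof.
move=> st; have [s0|s0] := leP s 0; first by rewrite {1}/flat s0 flat0_ge0.
have t0 := lt_le_trans s0 st.
rewrite !flat0E // ler_expR lerN2.
by rewrite lef_pV2 ?posrE.
Qed.

Lemma step_mono s t : s <= t -> step s <= step t.
Proof.
move=> st; rewrite /step ler_pdivrMr ?step_den_gt0 // mulrAC.
rewrite ler_pdivlMr ?step_den_gt0 //.
have := flat0_mono st; have : flat 0 (1 - t) <= flat 0 (1 - s).
  by apply: flat0_mono; lra.
have := flat0_ge0 s; have := flat0_ge0 (1 - t).
set a := flat 0 s; set b := flat 0 t; set c := flat 0 _; set d := flat 0 _.
move=> c0 a0 cd ab; rewrite !mulrDr (mulrC b a) lerD2l.
by rewrite ler_pM.
Qed.

Lemma step_eq0 t : t <= 0 -> step t = 0.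
Proof. by move=> t0; rewrite /step {1}/flat t0 mul0r. Qed.

Lemma step_eq1 t : 1 <= t -> step t = 1.
Proof.
move=> t1; rewrite /step {3}/flat ifT ?subr_le0 // addr0 divff //.
by rewrite gt_eqF // flat0_gt0 // (lt_le_trans _ t1).
Qed.

Lemma step_ge0 t : 0 <= step t.
Proof. by rewrite divr_ge0 ?flat0_ge0 // ltW // step_den_gt0. Qed.

Lemma step_le1 t : step t <= 1.
Proof.
by rewrite ler_pdivrMr ?step_den_gt0 // mul1r lerDl flat0_ge0.
Qed.

Lemma differentiable_upto_step k : differentiable_upto k step.
Proof.
apply: differentiable_uptoM; first exact: differentiable_upto_flat.
apply: differentiable_uptoV; first by move=> x; rewrite gt_eqF // step_den_gt0.
apply: differentiable_uptoD; first exact: differentiable_upto_flat.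
apply: (differentiable_upto_comp (f := flat 0) (g := fun x => 1 - x)).
  exact: differentiable_upto_flat.
apply: differentiable_uptoD; first exact: differentiable_upto_cst.
have -> : -%R = (fun x : R => -1 * x) by apply/funext => x; rewrite mulN1r.
by apply: differentiable_uptoM; [exact: differentiable_upto_cst|exact: differentiable_upto_id].
Qed.

End Smooth1.

(** * The convex primitive of the step and the smoothed maximum *)

Section Softplus.
Variable R : realType.
Implicit Types (s t u v : R).

(** The base point -1 lies strictly inside the zero set of [step], so that every t >= 0 is interior
    to the range where the fundamental theorem of calculus is applied. The result vanishes for t <=
    0 and has slope 1 for t >= 1. *)
Definition softplus t : R :=
  \int[@lebesgue_measure R]_(x in `[(-1)%R, t]%classic) step x.

Lemma step_continuous : continuous (@step R).
Proof.
move=> x; apply: differentiable_continuous.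
by apply/derivable1_diffP; have [] := differentiable_upto_step R 1.
Qed.

Lemma softplus_eq0 t : t <= 0 -> softplus t = 0.
Proof.
move=> t0; rewrite /softplus (@eq_Rintegral _ _ _ _ _ (cst 0)).
  by rewrite Rintegral_cst //= mul0r.
move=> x; rewrite inE /= in_itv /= => /andP[_ xt].
by rewrite step_eq0 // (le_trans xt).
Qed.

Lemma is_derive_softplus t : is_derive t 1 softplus (step t).
Proof.
have [t0|t0] := ltP t 0.
  rewrite step_eq0 ?ltW //.
  have D0 : is_derive t 1 (cst (0 : R)) 0 by exact: is_derive_cst.
  apply: near_eq_is_derive D0; near=> y; rewrite softplus_eq0 // ltW //.
  by near: y; exact: lt_nbhsl.
have [] : derivable softplus t 1 /\ derive1 softplus t = step t.
  apply: (@continuous_FTC1_closed R (@step R) (-1) t (t + 1)).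
  - by lra.
  - apply: continuous_compact_integrable; first exact: segment_compact.
    by apply: continuous_subspaceT; exact: step_continuous.
  - by lra.
  - exact: step_continuous.
by rewrite derive1E; exact: DeriveDef.
Unshelve. all: by end_near. Qed.

Lemma smooth1_softplus : smooth1 softplus.
Proof.
case=> [//|k]; apply: (differentiable_uptoP is_derive_softplus).
exact: differentiable_upto_step.
Qed.

Lemma softplus_MVT s t : exists2 c, Num.min s t <= c <= Num.max s t &
  softplus t - softplus s = step c * (t - s).
Proof.
have cont : continuous softplus.
  move=> x; apply: differentiable_continuous; apply/derivable1_diffP.
  by have [] := is_derive_softplus x.
wlog st : s t / s <= t => [H|].
  case: (boolP (s <= t)) => [/H //|]; rewrite -ltNge => /ltW /H [c].
  by rewrite minC maxC => cst E; exists c => //; lra.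
have [] := @MVT_segment R softplus (@step R) s t st.
- by move=> x _; exact: is_derive_softplus.
- by apply: continuous_subspaceT.
- move=> c; rewrite in_itv /= => cst E; exists c => //.
  by rewrite (min_idPl st) (max_idPr st).
Qed.

Lemma softplus_ge0 t : 0 <= softplus t.
Proof.
have [t0|t0] := leP t 0; first by rewrite softplus_eq0.
have [c _] := softplus_MVT 0 t; rewrite (softplus_eq0 (lexx 0)) !subr0 => ->.
by rewrite mulr_ge0 ?step_ge0 // ltW.
Qed.

Lemma softplus_mono s t : s <= t -> softplus s <= softplus t.
Proof.
move=> st; have [c _ E] := softplus_MVT s t.
by rewrite -subr_ge0 E mulr_ge0 ?step_ge0 // subr_ge0.
Qed.

Lemma softplus_lip s t : s <= t -> softplus t - softplus s <= t - s.
Proof.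
move=> st; have [c _ ->] := softplus_MVT s t.
by rewrite ler_piMl ?step_le1 // subr_ge0.
Qed.

Lemma softplus_tangent s t : softplus s + step s * (t - s) <= softplus t.
Proof.
have [c cst E] := softplus_MVT s t.
rewrite -lerBrDl E -subr_ge0 -mulrBl.
have [st|/ltW ts] := leP s t.
  move: cst; rewrite (min_idPl st) (max_idPr st) => /andP[sc _].
  by rewrite mulr_ge0 ?subr_ge0 ?step_mono.
move: cst; rewrite (min_idPr ts) (max_idPl ts) => /andP[_ cs].
by rewrite mulr_le0 ?subr_le0 ?step_mono.
Qed.

Lemma softplus_convex s t u : 0 <= u <= 1 ->
  softplus ((1 - u) * s + u * t) <= (1 - u) * softplus s + u * softplus t.
Proof.
move=> /andP[u0 u1]; set w := _ + _.
have := softplus_tangent w s; have := softplus_tangent w t => H1 H2.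
have := ler_wpM2l u0 H1; have u1' : 0 <= 1 - u by lra.
have := ler_wpM2l u1' H2.
have : (1 - u) * (s - w) + u * (t - w) = 0 by rewrite /w; ring.
set p := step w; set a := softplus w; set b := softplus s; set c := softplus t.
move=> E G1 G2.
have : p * ((1 - u) * (s - w) + u * (t - w)) = 0 by rewrite E mulr0.
lra.
Qed.

Lemma softplus_affine t : 1 <= t -> softplus t = t - (1 - softplus 1).
Proof.
move=> t1; have [c] := softplus_MVT 1 t.
rewrite (min_idPl t1) (max_idPr t1) => /andP[c1 _].
by rewrite step_eq1 // mul1r; lra.
Qed.

Lemma softplus_ge t : t - (1 - softplus 1) <= softplus t.
Proof. by have := softplus_tangent 1 t; rewrite step_eq1 // mul1r; lra. Qed.

(* A smooth version of max(u, v), exact when v <= u, and equal to v up to an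
   additive constant in [0, d] when u + d <= v. *)
Definition smax d u v : R := u + d * softplus ((v - u) / d).

Section Smax.
Variable d : R.
Hypothesis d0 : 0 < d.

Let dn0 : d != 0. Proof. by rewrite gt_eqF. Qed.

Lemma smax_gel u v : u <= smax d u v.
Proof. by rewrite lerDl mulr_ge0 ?softplus_ge0 // ltW. Qed.

Lemma smax_eql u v : v <= u -> smax d u v = u.
Proof.
move=> vu; rewrite /smax softplus_eq0 ?mulr0 ?addr0 //.
by rewrite ler_pdivrMr // mul0r subr_le0.
Qed.

Definition smax_drop : R := d * (1 - softplus 1).

Lemma smax_drop_le : smax_drop <= d.
Proof. by rewrite ler_piMr ?(ltW d0) // gerBl softplus_ge0. Qed.

Lemma smax_ger u v : v - smax_drop <= smax d u v.
Proof.
have := ler_wpM2l (ltW d0) (softplus_ge ((v - u) / d)).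
have E : d * ((v - u) / d) = v - u by rewrite mulrC divfK.
by rewrite mulrBr E -/smax_drop /smax; lra.
Qed.

Lemma smax_eqr u v : u + d <= v -> smax d u v = v - smax_drop.
Proof.
move=> uv; rewrite /smax softplus_affine; last by rewrite ler_pdivlMr //; lra.
by rewrite mulrBr mulrC divfK // /smax_drop; lra.
Qed.

Lemma smax_ler u v : u <= v -> smax d u v <= v.
Proof.
move=> uv; have vu : 0 <= (v - u) / d by rewrite divr_ge0 ?(ltW d0) // subr_ge0.
have := ler_wpM2l (ltW d0) (softplus_lip vu).
rewrite (softplus_eq0 (lexx 0)) !subr0 /smax => H.
have E : d * ((v - u) / d) = v - u by rewrite mulrC divfK.
by move: H; rewrite E; lra.
Qed.

(** The partial derivatives, 1 - step and step, are nonnegative. Together with [smax_shift] this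
    bounds the slope of a smoothed maximum by a common bound for both arguments. *)
Lemma smax_mono u v u' v' : u <= u' -> v <= v' -> smax d u v <= smax d u' v'.
Proof.
move=> uu' vv'; apply: (@le_trans _ _ (smax d u v')).
  rewrite lerD2l ler_wpM2l ?(ltW d0) // softplus_mono // ler_wpM2r ?lerB //.
  by rewrite invr_ge0 (ltW d0).
have st : (v' - u') / d <= (v' - u) / d.
  by rewrite ler_wpM2r ?lerB // invr_ge0 (ltW d0).
have := ler_wpM2l (ltW d0) (softplus_lip st).
have E w : d * ((v' - w) / d) = v' - w by rewrite mulrC divfK.
rewrite mulrBr mulrBr !E /smax; lra.
Qed.

Lemma smax_shift u v c : smax d (u + c) (v + c) = smax d u v + c.
Proof. by rewrite /smax opprD addrACA subrr addr0 addrAC. Qed.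

Lemma smax_convex u v u' v' t : 0 <= t <= 1 ->
  smax d ((1 - t) * u + t * u') ((1 - t) * v + t * v') <=
  (1 - t) * smax d u v + t * smax d u' v'.
Proof.
move=> t01; have := softplus_convex ((v - u) / d) ((v' - u') / d) t01.
have -> : (1 - t) * ((v - u) / d) + t * ((v' - u') / d) =
  ((1 - t) * v + t * v' - ((1 - t) * u + t * u')) / d by field.
move=> /(ler_wpM2l (ltW d0)); rewrite /smax; lra.
Qed.

End Smax.
End Softplus.

(** * Calculus of smooth functions *)

Lemma is_derive_cvgP (R : realType) (V : normedModType R) (f : V -> R) (x v : V) (d : R) :
  is_derive x v f d <->
  h^-1 * (f (x + h *: v) - f x) @[h --> 0^'] --> d.
Proof.
have E : (fun h : R => h^-1 *: ((f \o shift x) (h *: v) - f x)) =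
         (fun h : R => h^-1 * (f (x + h *: v) - f x)).
  by apply/funext => h /=; rewrite (addrC x).
rewrite -E; split=> [[df <-]|H]; first exact: df.
by split; [apply/cvg_ex; exists d | exact: cvg_lim].
Qed.

Lemma is_derive_line (R : realType) (V : normedModType R) (f : V -> R) (x v : V) (t d : R) :
  is_derive (x + t *: v) v f d <-> is_derive t 1 (fun u : R => f (x + u *: v)) d.
Proof.
apply: iff_trans (is_derive_cvgP _ _ _ _) (iff_trans _ (iff_sym (is_derive_cvgP _ _ _ _))).
suff -> : (fun h : R => h^-1 * (f (x + t *: v + h *: v) - f (x + t *: v))) =
          (fun h : R => h^-1 * (f (x + (t + h *: 1) *: v) - f (x + t *: v))) by [].
apply/funext => h; have -> : h *: (1 : R) = h by exact: mulr1.
by rewrite scalerDl addrA.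
Qed.

Section SmoothCalculus.
Variables (R : realType) (n : nat) (U : set 'rV[R]_n).
Hypothesis oU : open U.
Local Notation Rn := 'rV[R]_n.
Implicit Types (x y z v : Rn) (f g h : Rn -> R) (k : nat) (s : seq 'I_n).

(** [C_infty_on] adds derivatives on the outside of a list; this recursion peels off the innermost
    one, the form in which the product and chain rules go through by induction. *)
Fixpoint Ck k h : Prop :=
  (forall x, U x -> {for x, continuous h}) /\
  (if k is k'.+1 then
    (forall x i, U x -> derivable h x (delta_mx 0 i)) /\
    (forall i, Ck k' (partial i h))
  else True).

Lemma iter_partial_rcons s i h :
  iter_partial (rcons s i) h = iter_partial s (partial i h).
Proof. by rewrite /iter_partial foldr_rcons. Qed.

Lemma C_inftyP h : C_infty_on U h <-> forall k, Ck k h.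
Proof.
split=> [Hh k|Hh s x Ux].
  elim: k h Hh => [|k IH] h Hh; split.
  - by move=> x Ux; have [] := Hh [::] x Ux.
  - by [].
  - by move=> x Ux; have [] := Hh [::] x Ux.
  - split=> [x i Ux|i]; first by have [_] := Hh [::] x Ux; apply.
    apply: IH => s x Ux; rewrite -iter_partial_rcons; exact: Hh.
elim/last_ind: s h Hh => [|s i IH] h Hh.
  have [h0 [h1 _]] := Hh 1%N; split; first exact: h0.
  by move=> i; exact: h1.
by rewrite iter_partial_rcons; apply: IH => k; have [_ [_]] := Hh k.+1; apply.
Qed.

Lemma Ck_continuous k h x : Ck k h -> U x -> {for x, continuous h}.
Proof. by case: k => [|k] [h0 _]; exact: h0. Qed.

Lemma CkW k h : Ck k.+1 h -> Ck k h.
Proof.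
elim: k h => [|k IH] h [h0 [h1 h2]]; split => //; split => // i; apply: IH.
by have := h2 i.
Qed.

Lemma near_open x : U x -> \forall y \near x, U y.
Proof. by move=> Ux; exact: open_nbhs_nbhs. Qed.

Lemma near_eq_continuous f g x : (\forall y \near x, f y = g y) ->
  {for x, continuous f} -> {for x, continuous g}.
Proof.
move=> fg cf; have fgx : f x = g x by exact: nbhs_singleton fg.
rewrite /prop_for /continuous_at -fgx.
have fg' : {near nbhs x, f =1 g} by [].
exact: cvg_trans (near_eq_cvg fg') cf.
Qed.

Lemma near_eq_partial f g x i : (\forall y \near x, f y = g y) ->
  \forall y \near x, partial i f y = partial i g y.
Proof.
by move/near_join; apply: filterS => y; exact: near_eq_derive.
Qed.

Lemma near_eq_iter_partial f g x s : (\forall y \near x, f y = g y) ->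
  \forall y \near x, iter_partial s f y = iter_partial s g y.
Proof.
by move=> fg; elim: s => [//|i s IH] /=; exact: near_eq_partial.
Qed.

Lemma C_infty_near h :
  (forall x, U x -> exists2 g, C_infty_on U g & \forall y \near x, g y = h y) ->
  C_infty_on U h.
Proof.
move=> H s x Ux; have [g Cg gh] := H x Ux.
have gh' := near_eq_iter_partial s gh; have [Cs Ds] := Cg s x Ux.
split; first exact: near_eq_continuous gh' Cs.
by move=> i; exact: near_eq_derivable gh' (Ds i).
Qed.

Lemma Ck_ext k f g : (forall x, U x -> f x = g x) -> Ck k f -> Ck k g.
Proof.
elim: k f g => [|k IH] f g fg [f0 f1].
  split=> // x Ux; apply: near_eq_continuous (f0 x Ux).
  by apply: filterS (near_open Ux).
have nfg x : U x -> \forall y \near x, f y = g y.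
  by move=> Ux; apply: filterS (near_open Ux).
split=> [x Ux|]; first exact: near_eq_continuous (nfg x Ux) (f0 x Ux).
split=> [x i Ux|i]; first exact: near_eq_derivable (nfg x Ux) (f1.1 x i Ux).
apply: IH (f1.2 i) => x Ux; exact: nbhs_singleton (near_eq_partial i (nfg x Ux)).
Qed.

Lemma CkP k h (h' : 'I_n -> Rn -> R) : (forall x, U x -> {for x, continuous h}) ->
  (forall x i, U x -> is_derive x (delta_mx 0 i) h (h' i x)) ->
  (forall i, Ck k (h' i)) -> Ck k.+1 h.
Proof.
move=> h0 dh Ch'; split=> //; split=> [x i Ux|i]; first by have [] := dh x i Ux.
apply: Ck_ext (Ch' i) => x Ux.
by have [_ <-] := dh x i Ux.
Qed.

Lemma Ck_is_derive k h x i : Ck k.+1 h -> U x ->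
  is_derive x (delta_mx 0 i) h (partial i h x).
Proof. by move=> [_ [dh _]] Ux; apply: derivableP; exact: dh. Qed.

Lemma Ck_partial k h i : Ck k.+1 h -> Ck k (partial i h).
Proof. by move=> [_ [_]]; apply. Qed.

Lemma Ck_cst k (c : R) : Ck k (fun=> c).
Proof.
elim: k c => [|k IH] c; first by split=> // x _; exact: cst_continuous.
apply: (@CkP _ _ (fun _ _ => 0)) => // x _; exact: cst_continuous.
Qed.

Lemma CkD k f g : Ck k f -> Ck k g -> Ck k (fun x => f x + g x).
Proof.
elim: k f g => [|k IH] f g Cf Cg.
  split=> // x Ux; apply: continuousD; [exact: Ck_continuous Cf Ux|exact: Ck_continuous Cg Ux].
apply: (@CkP _ _ (fun i x => partial i f x + partial i g x)) => [x Ux|x i Ux|i].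
- by apply: continuousD; [exact: Ck_continuous Cf Ux|exact: Ck_continuous Cg Ux].
- have df := Ck_is_derive i Cf Ux; have dg := Ck_is_derive i Cg Ux.
  exact: is_deriveD.
- by apply: IH; exact: Ck_partial.
Qed.

Lemma CkM k f g : Ck k f -> Ck k g -> Ck k (fun x => f x * g x).
Proof.
elim: k f g => [|k IH] f g Cf Cg.
  split=> // x Ux; apply: continuousM; [exact: Ck_continuous Cf Ux|exact: Ck_continuous Cg Ux].
apply: (@CkP _ _ (fun i x => f x * partial i g x + g x * partial i f x)) => [x Ux|x i Ux|i].
- by apply: continuousM; [exact: Ck_continuous Cf Ux|exact: Ck_continuous Cg Ux].
- have df := Ck_is_derive i Cf Ux; have dg := Ck_is_derive i Cg Ux.
  exact: is_deriveM.
- by apply: CkD; apply: IH; solve [exact: CkW | exact: Ck_partial].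
Qed.

Lemma CkZ k (c : R) f : Ck k f -> Ck k (fun x => c * f x).
Proof. by move=> Cf; apply: CkM => //; exact: Ck_cst. Qed.

Lemma is_derive_comp1 (psi : R -> R) h x v (a b : R) : is_derive (h x) 1 psi a ->
  is_derive x v h b -> is_derive x v (psi \o h) (a * b).
Proof.
move=> dpsi dh; have E : x + 0 *: v = x by rewrite scale0r addr0.
have := is_derive_line h x v 0 b; rewrite E => -[/(_ dh) dh' _].
have := is_derive_line (psi \o h) x v 0 (a * b); rewrite E => -[_]; apply.
have dpsi' : is_derive ((fun u : R => h (x + u *: v)) 0) 1 psi a.
  by rewrite /= E.
exact: is_derive1_comp dpsi' dh'.
Qed.

Lemma Ck_comp k (psi : R -> R) h : smooth1 psi -> Ck k h -> Ck k (psi \o h).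
Proof.
move=> Spsi; have cpsi phi : smooth1 phi -> continuous phi.
  move=> Sphi x; apply: differentiable_continuous; apply/derivable1_diffP.
  by have [] := Sphi 1%N.
elim: k psi h Spsi => [|k IH] psi h Spsi Ch.
  split=> // x Ux; apply: continuous_comp; first exact: Ck_continuous Ch Ux.
  exact: cpsi.
apply: (@CkP _ _ (fun i x => (derive1 psi \o h) x * partial i h x)) => [x Ux|x i Ux|i].
- by apply: continuous_comp; [exact: Ck_continuous Ch Ux|exact: cpsi].
- apply: is_derive_comp1; last exact: Ck_is_derive Ch Ux.
  exact: (@differentiable_upto_derive _ 0 _ (Spsi 1%N)).
- apply: CkM; last exact: Ck_partial.
  by apply: IH; [move=> j; have [] := Spsi j.+1|exact: CkW].
Qed.

Lemma is_derive_coord x v j : is_derive x v (fun y => y 0 j) (v 0 j).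
Proof.
apply: (@is_derive_quadratic _ _ _ _ _ _ 0 1) => // t _.
by rewrite !mxE addrK subrr normr0 mul0r.
Qed.

Lemma continuous_coord j : continuous (fun x : Rn => x 0 j).
Proof. by move=> x; exact: coord_continuous. Qed.

Lemma Ck_coord k j : Ck k (fun x => x 0 j).
Proof.
case: k => [|k]; first by split=> // x _; exact: continuous_coord.
apply: (@CkP _ _ (fun i _ => (delta_mx 0 i : Rn) 0 j)) => [x _|x i _|i].
- exact: continuous_coord.
- exact: is_derive_coord.
- exact: Ck_cst.
Qed.

Lemma Ck_sum k m (h : 'I_m -> Rn -> R) : (forall j, Ck k (h j)) ->
  Ck k (fun x => \sum_(j < m) h j x).
Proof.
elim: m h => [|m IH] h Ch.
  by apply: Ck_ext (Ck_cst k 0) => x _; rewrite big_ord0.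
apply: Ck_ext (CkD (IH (fun j => h (widen_ord (leqnSn m) j)) _) (Ch ord_max)).
  by move=> x _; rewrite big_ord_recr.
by move=> j; exact: Ch.
Qed.

Lemma C_inftyD f g : C_infty_on U f -> C_infty_on U g ->
  C_infty_on U (fun x => f x + g x).
Proof. by move=> /C_inftyP Cf /C_inftyP Cg; apply/C_inftyP => k; exact: CkD. Qed.

Lemma C_inftyZ (c : R) f : C_infty_on U f -> C_infty_on U (fun x => c * f x).
Proof. by move=> /C_inftyP Cf; apply/C_inftyP => k; exact: CkZ. Qed.

Lemma C_infty_cst (c : R) : C_infty_on U (fun=> c).
Proof. by apply/C_inftyP => k; exact: Ck_cst. Qed.

Lemma C_infty_affine (c : R) xi z : C_infty_on U (fun x => c + dot xi (x - z)).
Proof.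
apply/C_inftyP => k; apply: CkD; first exact: Ck_cst.
apply: (@Ck_ext _ (fun x => dot xi x + - dot xi z)) => [x _|].
  by rewrite dotBr.
apply: CkD; last exact: Ck_cst.
by apply: Ck_sum => j; apply: CkZ; exact: Ck_coord.
Qed.

Lemma C_infty_smax (d : R) f g : C_infty_on U f -> C_infty_on U g ->
  C_infty_on U (fun x => smax d (f x) (g x)).
Proof.
move=> Cf Cg; apply: (C_inftyD Cf).
apply: (@C_inftyZ d (fun x => softplus ((g x - f x) / d))).
move/C_inftyP: Cf => Cf; move/C_inftyP: Cg => Cg; apply/C_inftyP => k.
apply: (Ck_comp (h := fun x => (g x - f x) / d)) (smooth1_softplus R) _.
apply: (@Ck_ext _ (fun x => d^-1 * (g x + (-1) * f x))) => [x _|].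
  by rewrite mulN1r mulrC.
by apply: CkZ; apply: CkD => //; exact: CkZ.
Qed.

End SmoothCalculus.

(** * Locally finite gluing *)

Section Gluing.
Variables (R : realType) (n : nat) (U : set 'rV[R]_n).
Hypotheses (oU : open U) (cU : convex_set U).
Local Notation Rn := 'rV[R]_n.
Implicit Types (x y z : Rn) (u v f g h : Rn -> R) (L : R).

Section SmaxFun.
Variable d : R.
Hypothesis d0 : 0 < d.

Lemma slope_le_smax u v x L : slope_le U u x L -> slope_le U v x L ->
  slope_le U (fun y => smax d (u y) (v y)) x L.
Proof.
move=> Hu Hv y Uy; rewrite lerBlDr addrC -smax_shift.
by apply: smax_mono => //; have := Hu y Uy; have := Hv y Uy; lra.
Qed.

Lemma slope_le_smaxl u v x L : v x <= u x -> slope_le U u x L ->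
  slope_le U (fun y => smax d (u y) (v y)) x L.
Proof.
move=> vu Hu y Uy; rewrite smax_eql //.
by have := Hu y Uy; have := smax_gel d0 (u y) (v y); lra.
Qed.

Lemma slope_le_smaxr u v x L : u x + d <= v x -> slope_le U v x L ->
  slope_le U (fun y => smax d (u y) (v y)) x L.
Proof.
move=> vu Hu y Uy; rewrite smax_eqr //.
by have := Hu y Uy; have := smax_ger d0 (u y) (v y); lra.
Qed.

Lemma cvx_smax u v : cvx U u -> cvx U v -> cvx U (fun y => smax d (u y) (v y)).
Proof.
move=> cu cv x y t Ux Uy t01; rewrite subr_ge0.
apply: le_trans (smax_convex d0 _ _ _ _ t01).
by apply: (smax_mono d0); [exact: (cvx_le cu)|exact: (cvx_le cv)].
Qed.

End SmaxFun.

Variables (b : nat -> Rn -> R) (tau : nat -> R).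
Hypotheses (Cb : forall i, C_infty_on U (b i)) (cvxb : forall i, cvx U (b i)).
Hypothesis tau0 : forall i, 0 < tau i.
(** Near [x] the pieces of index at least N lie below an earlier piece lowered by its tolerance,
    hence below the N-th smoothed maximum, which they leave unchanged. *)
Hypothesis locfin : forall x, U x -> exists N j : nat,
  (j < N)%N /\ \forall y \near x, forall i, (N <= i)%N -> b i y <= b j y - tau j.

(** Because of the halving, the tolerances of all later maxima add up to at most [glue_tol i]: the
    errors accumulated after piece i stay within [tau i]. *)
Fixpoint glue_tol i : R :=
  if i is i'.+1 then Num.min (glue_tol i' / 2) (tau i'.+1) else tau 0.

Fixpoint glue_seq r y : R :=
  if r is r'.+1 then smax (glue_tol r) (glue_seq r' y) (b r y) else b 0%N y.

Let tol := glue_tol.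
Let G := glue_seq.

Let GS r y : G r.+1 y = smax (tol r.+1) (G r y) (b r.+1 y). Proof. by []. Qed.

Let tol_gt0 i : 0 < tol i.
Proof.
rewrite /tol; elim: i => [|i IH] /=; first exact: tau0.
by rewrite lt_min tau0 divr_gt0.
Qed.

Let tol_le i : tol i <= tau i.
Proof. by case: i => [|i]; rewrite /tol //= ge_min lexx orbT. Qed.

Let tol_half i : tol i.+1 + tol i.+1 <= tol i.
Proof.
have : tol i.+1 <= tol i / 2 by rewrite /tol /= ge_min lexx.
lra.
Qed.

Let G_mono r r' y : (r <= r')%N -> G r y <= G r' y.
Proof.
move=> /subnK <-; elim: (_ - _)%N => [//|k IH] /=.
by apply: le_trans IH _; exact: (smax_gel (tol_gt0 (k + r).+1)).
Qed.

Let G_ge i r y : (i <= r)%N -> b i y - tol i <= G r y.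
Proof.
move=> ir; apply: le_trans (G_mono y ir); case: i {ir} => [|i] /=.
  by rewrite gerBl ltW.
apply: le_trans (smax_ger (tol_gt0 i.+1) _ _).
by rewrite lerB // smax_drop_le.
Qed.

Let G_le r y : exists2 i, (i <= r)%N & G r y <= b i y.
Proof.
elim: r => [|r [i ir Hi]]; first by exists 0%N.
have [bG|/ltW Gb] := leP (b r.+1 y) (G r y).
  exists i; first exact: leqW.
  by rewrite GS smax_eql.
by exists r.+1 => //; rewrite GS; exact: (smax_ler (tol_gt0 r.+1)).
Qed.

(** Only pieces close to the maximum count, and the closeness allowed to piece i, tol i - tol r,
    grows with r. When both arguments of a smoothed maximum are in play, the new value exceeds the
    old one by less than tol r.+1, and tol r - tol r.+1 covers this. *)
Let G_slope r x L : (forall i, (i <= r)%N -> G r x <= b i x + (tol i - tol r) ->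
  slope_le U (b i) x L) -> slope_le U (G r) x L.
Proof.
elim: r => [|r IH] H.
  by apply: H => //; rewrite subrr addr0.
have T := tol_half r; have T0 := tol_gt0 r.+1.
have [bG|Gb] := leP (b r.+1 x) (G r x).
  apply: slope_le_smaxl => //; apply: IH => i ir Hi; apply: H; first exact: leqW.
  by rewrite GS smax_eql //; lra.
have [Gb'|bG] := leP (G r x + tol r.+1) (b r.+1 x).
  apply: slope_le_smaxr => //; apply: H => //.
  by rewrite subrr addr0; exact/smax_ler/ltW.
have Gle := smax_ler T0 (ltW Gb).
apply: slope_le_smax => //; last first.
  by apply: H => //; rewrite subrr addr0.
apply: IH => i ir Hi; apply: H; first exact: leqW.
by apply: le_trans Gle _; lra.
Qed.

Let G_smooth r : C_infty_on U (G r).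
Proof.
elim: r => [|r IH]; first exact: Cb.
exact: (C_infty_smax oU (tol r.+1) IH (Cb r.+1)).
Qed.

Let G_cvx r : cvx U (G r).
Proof. by elim: r => [|r IH]; [exact: cvxb|exact: cvx_smax]. Qed.

Let G_stable x : U x -> exists N, \forall y \near x, forall r, (N <= r)%N -> G r y = G N y.
Proof.
move=> Ux; have [N [j [jN H]]] := locfin Ux; exists N.
apply: filterS H => y Hy r /subnK <-; elim: (_ - _)%N => [//|k IH].
rewrite addSn -[RHS]IH GS (smax_eql (tol_gt0 _)) //.
apply: le_trans (Hy _ _) _; first by rewrite -addSn leq_addl.
apply: (@le_trans _ _ (b j y - tol j)); first by rewrite lerB.
by apply: G_ge; rewrite (leq_trans (ltnW jN)) // leq_addl.
Qed.

(** Near each point the sequence of maxima is eventually constant, so smoothness is inherited from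
    germs. Where [b 0] dominates, every smoothed maximum is exact and the germ of [b 0] survives. *)
Lemma smooth_glue : exists g,
  [/\ C_infty_on U g, cvx U g,
      forall i x, U x -> b i x - tau i <= g x &
      forall x, U x -> exists i, g x <= b i x] /\
  (forall x L, U x -> (forall i, g x <= b i x + tau i -> slope_le U (b i) x L) ->
     slope_le U g x L) /\
  (forall x, U x -> (forall i, b i x <= b 0%N x) -> g x = b 0%N x).
Proof.
have Hst x : exists N, U x -> \forall y \near x, forall r, (N <= r)%N -> G r y = G N y.
  have [Ux|nUx] := pselect (U x); last by exists 0%N.
  by have [N HN] := G_stable Ux; exists N.
have [st stP] := choice Hst.
have stE x r : U x -> (st x <= r)%N -> G r x = G (st x) x.
  by move=> Ux; have := nbhs_singleton (stP x Ux); apply.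
pose g x := G (st x) x.
have gE x r : U x -> (st x <= r)%N -> g x = G r x by move=> Ux /stE ->.
exists g; split; first split.
- apply: C_infty_near => // x Ux; exists (G (st x)) => //.
  have Uy := near_open oU Ux; apply: filterS2 (stP x Ux) Uy => y Hy Uy.
  pose r := maxn (st x) (st y).
  by rewrite (gE _ r) // ?leq_maxr // Hy // leq_maxl.
- move=> x y t Ux Uy t01; have Uz := convex_set_comb cU Ux Uy t01.
  pose r := maxn (st x) (maxn (st y) (st ((1 - t) *: x + t *: y))).
  rewrite /gap !(gE _ r) // ?leq_max ?leqnn ?orbT //; exact: G_cvx.
- move=> i x Ux; pose r := maxn i (st x).
  rewrite (gE _ r) // ?leq_maxr //; apply: (@le_trans _ _ (b i x - tol i)).
    by rewrite lerB.
  by apply: G_ge; rewrite leq_maxl.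
- by move=> x Ux; have [i _ Hi] := G_le (st x) x; exists i.
- split=> [x L Ux H|x Ux H].
    move=> y Uy; pose r := maxn (st x) (st y).
    rewrite (gE x r) // ?leq_maxl // (gE y r) // ?leq_maxr //.
    apply: G_slope Uy => i ir Hi; apply: H.
    rewrite (gE x r) // ?leq_maxl //; apply: le_trans Hi _.
    by rewrite lerD2l; have := tol_le i; have := tol_gt0 r; lra.
  rewrite /g; elim: (st x) => [//|r IH].
  by rewrite GS smax_eql // IH.
Qed.

End Gluing.

(** * Compact exhaustion and passage from compact sets to the whole domain *)

Section Exhaustion.
Variables (R : realType) (n : nat) (U : set 'rV[R]_n).
Hypotheses (oU : open U) (cU : convex_set U).
Local Notation Rn := 'rV[R]_n.
Implicit Types (x y z : Rn) (f g h F : Rn -> R) (K : set Rn) (Q : Rn -> R -> Prop).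

Lemma compact_set_ind K (P : set Rn -> Prop) : compact K -> P set0 ->
  (forall A B, P A -> P B -> P (A `|` B)) ->
  (forall A B, A `<=` B -> P B -> P A) ->
  (forall x, K x -> exists2 W, nbhs x W & P W) -> P K.
Proof.
move=> /compact_near_coveringP cK P0 PU PS Ploc.
(* The filter of families of sets that contain all supersets of some A with P A. The near-covering
   form of compactness says that K is eventually included in its sets, i.e. K lies in some A with P
   A. *)
pose F : set_system (set Rn) := [set E | exists2 A, P A & forall B, A `<=` B -> E B].
have FF : Filter F.
  split.
  - by exists set0.
  - move=> E1 E2 [A1 PA1 H1] [A2 PA2 H2]; exists (A1 `|` A2); first exact: PU.
    move=> B AB; split; [apply: H1|apply: H2] => x Ax; apply: AB.
      by left.
    by right.
  - by move=> E1 E2 E12 [A PA HA]; exists A => // B /HA /E12.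
have [x Kx|A PA HA] := cK _ F (fun i x => i x) FF.
  have [W Wx PW] := Ploc x Kx.
  exists (W, [set B | W `<=` B]); last by move=> [y B] [/= Wy WB]; exact: WB.
  by split => //=; exists W.
exact: PS (HA A (subset_refl _)) PA.
Qed.

Definition exhaust (r : nat) : set Rn :=
  [set x | enorm x <= r%:R /\ forall y, enorm (y - x) < r.+1%:R^-1 -> U y].

Lemma compact_exhaust r : compact (exhaust r).
Proof.
apply: bounded_closed_compact.
  exists r%:R; split; first exact: num_real.
  move=> M rM x [xr _]; apply: le_trans (normr_le_enorm _) _.
  exact: le_trans xr (ltW rM).
apply/closure_id; rewrite eqEsubset; split; first exact: subset_closure.
move=> x Hx; split.
  apply/ler_addgt0Pr => e e0.
  have [x' [[x'r _] /= x'x]] := Hx _ (near_enorm x e0).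
  have := enormD (x - x') x'; rewrite subrK enormB; lra.
move=> y yx; set rho := _^-1 in yx *.
have e0 : 0 < rho - enorm (y - x) by lra.
have [x' [[_ HU] /= x'x]] := Hx _ (near_enorm x e0).
apply: HU; rewrite -/rho.
have := enormD (y - x) (x - x'); rewrite addrA subrK (enormB x); lra.
Qed.

Lemma exhaust_sub r : exhaust r `<=` U.
Proof. by move=> x [_]; apply; rewrite subrr enorm0 invr_gt0. Qed.

Lemma exhaust_near x : U x -> exists r : nat, \forall y \near x, exhaust r y.
Proof.
move=> Ux; have [e e0 eU] := open_enorm oU Ux.
have [r1 Hr1] : exists r : nat, enorm x + e <= r%:R.
  exists (Num.bound (enorm x + e)); apply/ltW/archi_boundP.
  by rewrite addr_ge0 ?enorm_ge0 // ltW.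
have [r2 Hr2] : exists r : nat, 2 / e <= r%:R.
  exists (Num.bound (2 / e)); apply/ltW/archi_boundP.
  by rewrite divr_ge0 // ltW.
exists (maxn r1 r2); have e2 : 0 < e / 2 by rewrite divr_gt0.
apply: filterS (near_enorm x e2) => y yx; split.
  apply: (@le_trans _ _ r1%:R); last by rewrite ler_nat leq_maxl.
  by have := enormD (y - x) x; rewrite subrK; lra.
move=> z; set w := _^-1 => zy; apply: eU.
have : w <= e / 2; rewrite /w.
  rewrite -[e / 2]invrK lef_pV2 ?posrE ?invr_gt0 //.
  rewrite invf_div; apply: le_trans Hr2 _.
  by rewrite ler_nat (leq_trans (leq_maxr r1 r2)).
rewrite -/w; by have := enormD (z - y) (y - x); rewrite addrA subrK; lra.
Qed.

(* [Q x L] says that the minorant g must have descending slope at most L at x. *)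
Definition smooth_minorant F Q g := [/\ C_infty_on U g, cvx U g,
  forall x, U x -> g x <= F x &
  forall x L, U x -> 0 <= L -> Q x L -> slope_le U g x L].

Lemma slope_leD h x L (c : R) : slope_le U h x L -> slope_le U (fun y => h y + c) x L.
Proof. by move=> Hh y Uy; have := Hh y Uy; lra. Qed.

Lemma cvxD_cst h (c : R) : cvx U h -> cvx U (fun y => h y + c).
Proof. by move=> ch x y t Ux Uy t01; have := ch x y t Ux Uy t01; rewrite /gap; lra. Qed.

Lemma smooth_minorantD F Q g (c : R) : c <= 0 -> smooth_minorant F Q g ->
  smooth_minorant F Q (fun y => g y + c).
Proof.
move=> c0 [Cg cg gF Qg]; split.
- exact: (C_inftyD oU Cg (C_infty_cst oU c)).
- exact: cvxD_cst.
- by move=> x Ux; have := gF x Ux; lra.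
- by move=> x L Ux L0 /(Qg x L Ux L0); exact: slope_leD.
Qed.

(** The pieces are the seed [k] and the g_r, each within e_r of [F] on the r-th compact set and
    lowered by alpha_r. On that set all later pieces are at most F - alpha_{r+1}, which does not
    exceed g_r - alpha_r - e_r: this is local finiteness. Every piece other than [k] is at most F -
    sigma/2, so [k] dominates where it exceeds F - sigma/4. *)
Lemma smooth_minorant_global F Q (sigma : R) k : 0 < sigma -> smooth_minorant F Q k ->
  (forall K s, compact K -> K `<=` U -> 0 < s ->
    exists2 g, smooth_minorant F Q g & forall x, K x -> F x - s <= g x) ->
  exists g, [/\ smooth_minorant F Q g, forall x, U x -> F x - sigma <= g x &
    forall p, U p -> (\forall y \near p, F y - sigma / 4 <= k y) ->
      \forall y \near p, g y = k y].
Proof.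
move=> s0 kP H.
pose e r : R := sigma * 2^-1 ^+ r.+3.
have e0 r : 0 < e r by rewrite mulr_gt0 // exprn_gt0 // invr_gt0.
have eS r : e r = 2 * e r.+1 by rewrite /e [in RHS]exprS; field.
have e1 : e 0%N = sigma / 8 by rewrite /e; field.
have Hg r : exists g, smooth_minorant F Q g /\
    forall x, exhaust r x -> F x - e r <= g x.
  have [g ? ?] := H _ _ (compact_exhaust (r := r)) (@exhaust_sub r) (e0 r).
  by exists g.
have [g gP] := choice Hg.
(* Increases from sigma/2 towards sigma, with increments 2 e_r: one e_r for the error of g_r and one
   for its tolerance. *)
pose alpha r := sigma - 4 * e r.
pose b i : Rn -> R := if i is r.+1 then fun y => g r y + - alpha r else k.
pose tau i := if i is r.+1 then e r else sigma.
have e_le r : 4 * e r <= sigma / 2.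
  elim: r => [|r IH]; first by rewrite e1; lra.
  by have := eS r; have := e0 r.+1; lra.
have alpha0 r : 0 <= alpha r by rewrite /alpha; have := e_le r; lra.
have alpha_mono r r' : (r <= r')%N -> alpha r <= alpha r'.
  move=> /subnK <-; elim: (_ - _)%N => [//|j IH]; apply: le_trans IH _.
  by rewrite addSn /alpha; have := eS (j + r)%N; have := e0 (j + r).+1; lra.
have bP i : smooth_minorant F Q (b i).
  by case: i => [//|r] /=; apply: smooth_minorantD; [rewrite oppr_le0|have [] := gP r].
have b_le i y : U y -> b i.+1 y <= F y - alpha i.
  by move=> Uy; have [[_ _ gF _] _] := gP i; rewrite /b lerD2r gF.
have tau_gt0 i : 0 < tau i by case: i.
have Cb i : C_infty_on U (b i) by have [] := bP i.
have cb i : cvx U (b i) by have [] := bP i.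
have lf x : U x -> exists N j : nat,
    (j < N)%N /\ \forall y \near x, forall i, (N <= i)%N -> b i y <= b j y - tau j.
  move=> Ux; have [r Hr] := exhaust_near Ux.
  exists r.+2, r.+1; split => //; apply: filterS Hr => y Hy [//|i] ri.
  apply: le_trans (b_le i y (exhaust_sub Hy)) _.
  have := alpha_mono r.+1 i ri; have [_ /(_ y Hy)] := gP r.
  by rewrite /b /tau /alpha; have := eS r; lra.
have [G [[CG cG G_ge G_le] [G_slope G_eq]]] := smooth_glue oU cU Cb cb tau_gt0 lf.
exists G; split.
- split=> // [x Ux|x L Ux L0 QL].
    have [i Hi] := G_le x Ux; apply: le_trans Hi _.
    by have [_ _ bF _] := bP i; exact: bF.
  by apply: G_slope => // i _; have [_ _ _] := bP i; apply.
- move=> x Ux; have [r /nbhs_singleton Hr] := exhaust_near Ux.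
  apply: le_trans (G_ge r.+1 x Ux); have [_ /(_ x Hr)] := gP r.
  by rewrite /b /tau /alpha; have := e0 r; lra.
- move=> p Up Hk; apply: filterS2 Hk (near_open oU Up) => y Hy Uy.
  apply: G_eq => // -[//|i]; apply: le_trans (b_le i y Uy) _.
  by apply: le_trans Hy; rewrite /alpha; have := e_le i; lra.
Qed.

End Exhaustion.

(** * Lipschitz pieces and levels of slopes *)

Section LipschitzApproximation.
Variables (R : realType) (n : nat) (U : set 'rV[R]_n).
Hypotheses (oU : open U) (cU : convex_set U).
Local Notation Rn := 'rV[R]_n.
Implicit Types (x y z xi : Rn) (f g h F : Rn -> R) (Q : Rn -> R -> Prop).

Lemma smax_lub (d u v c : R) : 0 < d -> u <= c -> v <= c -> smax d u v <= c.
Proof.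
move=> d0 uc vc; have [vu|/ltW uv] := leP v u; first by rewrite smax_eql.
exact: le_trans (smax_ler d0 uv) vc.
Qed.

Lemma smooth_minorant_smax F Q (d : R) g h : 0 < d ->
  smooth_minorant U F Q g -> smooth_minorant U F Q h ->
  smooth_minorant U F Q (fun x => smax d (g x) (h x)).
Proof.
move=> d0 [Cg cg gF Qg] [Ch ch hF Qh]; split.
- exact: C_infty_smax.
- exact: cvx_smax.
- by move=> x Ux; apply: smax_lub => //; [exact: gF|exact: hF].
- by move=> x L Ux L0 QL; apply: slope_le_smax => //; [exact: Qg|exact: Qh].
Qed.

Definition affine (c : R) xi z : Rn -> R := fun x => c + dot xi (x - z).

Lemma gap_affine c xi z x y t : gap (affine c xi z) x y t = 0.
Proof. by rewrite /gap /affine !dotBr dotDr !dotZr; ring. Qed.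

Lemma cvx_affine V c xi z : cvx V (affine c xi z).
Proof. by move=> x y t *; rewrite gap_affine. Qed.

Lemma slope_le_affine V c xi z x L : enorm xi <= L -> slope_le V (affine c xi z) x L.
Proof.
move=> xiL y _; have -> : affine c xi z x - affine c xi z y = dot xi (x - y).
  by rewrite /affine !dotBr; ring.
by apply: le_trans (dot_le_enorm _ _) _; rewrite ler_wpM2r ?enorm_ge0.
Qed.

(** Here [Q] asks only for the uniform bound [s], which tangents with gradient of norm at most [s]
    satisfy. Since [F] and its tangent at z are both s-Lipschitz, they differ by at most 2s|y - z|,
    which makes a finite cover sufficient. *)
Lemma smooth_lipschitz_minorant F s sigma z0 : U z0 -> 0 <= s -> cvx U F ->
  (forall x, U x -> slope_le U F x s) -> 0 < sigma ->
  exists H, [/\ C_infty_on U H, cvx U H,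
    forall x, U x -> F x - sigma <= H x <= F x &
    forall x, U x -> slope_le U H x s].
Proof.
move=> Uz0 s0 cF Fs sigma0; pose Q (_ : Rn) (L : R) := L = s.
have tangent z : U z -> exists2 g, smooth_minorant U F Q g &
    g z = F z /\ forall y, U y -> F y - g y <= 2 * s * enorm (y - z).
  move=> Uz; have [xi xis Hxi] := support_slope oU cU s0 cF Uz (Fs z Uz).
  exists (affine (F z) xi z); [split|split].
  - exact: C_infty_affine.
  - exact: cvx_affine.
  - by move=> x Ux; exact: Hxi.
  - by move=> x L Ux _ ->; exact: slope_le_affine.
  - by rewrite /affine subrr dot0r addr0.
  - move=> y Uy; rewrite /affine.
    have := Fs y Uy z Uz; have := dot_le_enorm xi (- (y - z)).
    rewrite dotNr enormN; have := ler_wpM2r (enorm_ge0 (y - z)) xis.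
    lra.
have [k kQ _] := tangent z0 Uz0.
have [|H [[CH cH HF HQ] H_ge _]] := smooth_minorant_global oU cU sigma0 kQ; last first.
  exists H; split=> // x Ux; first by rewrite H_ge ?HF.
  exact: HQ.
move=> K e cK KU e0.
suff [g [s' [s'e gQ Hg]]] : exists g s', [/\ s' < e, smooth_minorant U F Q g &
    forall y, K y -> F y - s' <= g y].
  by exists g => // y /Hg; lra.
apply: (compact_set_ind (P := fun K => exists g s', [/\ s' < e,
  smooth_minorant U F Q g & forall y, K y -> F y - s' <= g y]) cK).
- by exists k, 0.
- move=> A B [g [a [ae gQ gA]]] [h [b [be hQ hB]]].
  pose m := Num.max a b; have me : m < e by rewrite gt_max ae.
  (* Half of the remaining margin pays for the smoothing, so the error stays strictly below [e]
     however many pieces are joined. *)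
  pose d := (e - m) / 2; have d0 : 0 < d by rewrite divr_gt0 // subr_gt0.
  exists (fun x => smax d (g x) (h x)), (m + d); split.
  + by rewrite /d; lra.
  + exact: smooth_minorant_smax.
  + have am : a <= m by rewrite le_max lexx.
    have bm : b <= m by rewrite le_max lexx orbT.
    move=> y [/gA|/hB] H.
      by have := smax_gel d0 (g y) (h y); lra.
    by have := smax_ger d0 (g y) (h y); have := smax_drop_le d0; lra.
- by move=> A B AB [g [a [ae gQ gB]]]; exists g, a; split => // y /AB; exact: gB.
- move=> z Kz; have [g gQ [gz Hg]] := tangent z (KU z Kz).
  pose r := e / 2 / (2 * s + 1).
  have s1 : 0 < 2 * s + 1 by lra.
  have r0 : 0 < r by rewrite !divr_gt0.
  have rE : (2 * s + 1) * r = e / 2 by rewrite /r mulrC divfK ?gt_eqF.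
  exists ([set y | enorm (y - z) < r] `&` U).
    by apply: filterI; [exact: near_enorm|exact: near_open (KU z Kz)].
  exists g, (e / 2); split=> //; first by lra.
  move=> y [/= yr Uy]; have := Hg y Uy.
  have : 2 * s * enorm (y - z) <= (2 * s + 1) * r.
    by have := enorm_ge0 (y - z); nra.
  by rewrite rE; lra.
Qed.

End LipschitzApproximation.

(** * Gluing Lipschitz levels along a grid of slopes *)

Section SlopeLevels.
Variables (R : realType) (n : nat) (U : set 'rV[R]_n).
Hypotheses (oU : open U) (cU : convex_set U).
Local Notation Rn := 'rV[R]_n.
Implicit Types (x y z : Rn) (L : R).
Variables (h : Rn -> R) (v : nat -> R) (m eps : R) (z0 : Rn).
Hypotheses (Uz0 : U z0) (ch : cvx U h) (m0 : 0 <= m) (eps0 : 0 < eps).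
Hypotheses (mv : forall i, m <= v i) (v_decr : forall i, v i.+1 <= v i).
Hypothesis v_lim : forall L, m < L -> exists i, v i <= L.
Hypothesis hv : forall i, cone_minorized U h (v i).

Let F i := infconv U h (v i).
Let m1 : 0 < m + 1. Proof. by rewrite ltr_wpDl. Qed.
Let v0 i : 0 <= v i. Proof. exact: le_trans (mv i). Qed.

Let v_mono i j : (i <= j)%N -> v j <= v i.
Proof. by move=> /subnK <-; elim: (_ - _)%N => [//|k IH]; exact: le_trans (v_decr _) IH. Qed.

(** Since [v i] decreases to [m], the bound h z + v i |y - z| on [F i y] gets close to h z + m |x -
    z|, uniformly for y near x. This pushes the late levels out of play. *)
Let near_level x z (A : R) : U z -> h z + m * enorm (x - z) < A ->
  exists N, \forall y \near x, forall i, (N <= i)%N -> F i y <= A.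
Proof.
move=> Uz HA; pose c := A - (h z + m * enorm (x - z)); have c0 : 0 < c by rewrite subr_gt0.
pose r := c / 2 / (m + 1).
have r0 : 0 < r by rewrite !divr_gt0.
have rE : (m + 1) * r = c / 2 by rewrite /r mulrC divfK ?gt_eqF.
pose D := enorm (x - z) + r; have D0 : 0 < D by rewrite ltr_wpDl ?enorm_ge0.
pose k := c / 2 / D; have k0 : 0 < k by rewrite !divr_gt0.
have kE : k * D = c / 2 by rewrite /k divfK ?gt_eqF.
have [N HN] : exists i, v i <= m + k by apply: v_lim; lra.
exists N; apply: filterS (near_enorm x r0) => y yr i Ni.
apply: le_trans (infconv_le (v0 i) (hv i) y Uz) _.
have vi : v i <= m + k by exact: le_trans (v_mono Ni) HN.
have yD : enorm (y - z) <= D.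
  by have := enormD (y - x) (x - z); rewrite addrA subrK /D; lra.
have H1 : v i * enorm (y - z) <= (m + k) * D.
  by apply: ler_pM => //; rewrite enorm_ge0.
have H2 : (m + k) * D = m * enorm (x - z) + m * r + c / 2.
  by rewrite mulrDl kE /D; ring.
have : A = h z + m * enorm (x - z) + c by rewrite /c; ring.
have := m0; have := rE; nra.
Qed.

Let e i : R := eps * 2^-1 ^+ i.+1.+4.
Let e0 i : 0 < e i. Proof. by rewrite mulr_gt0 // exprn_gt0 // invr_gt0. Qed.
Let eS i : e i = 2 * e i.+1. Proof. by rewrite /e [in RHS]exprS; field. Qed.
Let e00 : 32 * e 0%N = eps. Proof. by rewrite /e; field. Qed.
Let e_mono i j : (i < j)%N -> 2 * e j <= e i.
Proof.
move=> /subnK <-; elim: (_ - _)%N => [|k IH]; first by rewrite add0n -eS.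
by rewrite addSn; have := eS (k + i.+1); have := e0 (k + i.+1).+1; lra.
Qed.
(** The lowering of level i decreases with i. The factor 8 makes the drop from [p i] to a later
    [p j] exceed the approximation errors and tolerances involved, so a flatter level wins wherever
    it is exact. *)
Let p i := eps / 2 + 8 * e i.

Let level_approx i : exists H, [/\ C_infty_on U H, cvx U H,
    forall x, U x -> F i x - e i <= H x <= F i x &
    forall x, U x -> slope_le U H x (v i)].
Proof.
apply: (smooth_lipschitz_minorant oU cU Uz0) => //.
- exact: infconv_cvx.
- by move=> x; exact: infconv_slope_ge.
Qed.

(** Where [h] has slope at most [v i], level i is [h] up to [e i] and its lowering, hence above all
    steeper levels: only levels of slope at most [v i] remain in play. The extra piece [B] provides
    local finiteness and handles the slope [m]. *)
Lemma smooth_levels : exists E,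
  [/\ C_infty_on U E, cvx U E & forall x, U x -> F 0%N x - eps <= E x <= h x] /\
  [/\ forall x i, U x -> slope_le U h x (v i) -> slope_le U E x (v i),
      forall x, U x -> slope_le U h x m -> slope_le U E x m &
      forall x, U x -> slope_le U E x (v 0%N)].
Proof.
have eps_gt0 := eps0; have m_ge0 := m0; have [H HP] := choice level_approx.
pose b' i y := H i y + - p i.
have Cb' i : C_infty_on U (b' i).
  by have [CH _ _ _] := HP i; exact: (C_inftyD oU CH (C_infty_cst oU _)).
have cb' i : cvx U (b' i) by have [_ cH _ _] := HP i; exact: cvxD_cst.
have b'_le i y : U y -> b' i y <= F i y - p i.
  by move=> Uy; have [_ _ /(_ y Uy) /andP[]] := HP i; rewrite /b'; lra.
have b'_leh i y : U y -> b' i y <= h y - p i.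
  by move=> Uy; have := b'_le i y Uy; have := infconv_le_fun (v0 i) (hv i) Uy; rewrite /F; lra.
have b'_ge i y : U y -> F i y - e i - p i <= b' i y.
  by move=> Uy; have [_ _ /(_ y Uy) /andP[]] := HP i; rewrite /b'; lra.
have b'_slope i y : U y -> slope_le U (b' i) y (v i).
  by move=> Uy; have [_ _ _ /(_ y Uy)] := HP i; exact: slope_leD.
have cover i x : U x -> slope_le U h x (v i) -> h x - e i - p i <= b' i x.
  by move=> Ux /(infconv_eq (v0 i) (hv i) Ux) <-; exact: b'_ge.
have gap_p i j : (i < j)%N -> p j + e j + e j < p i - e i.
  by move=> /e_mono; rewrite /p; have := e0 j; lra.
have [B [tB [[CB cB Bh tB0] [B_near Bv Bm B_v0]]]] : exists B tB,
  [/\ C_infty_on U B, cvx U B, forall x, U x -> B x <= h x & 0 < tB] /\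
  [/\ forall x, U x -> exists N, \forall y \near x, forall i, (N <= i)%N -> b' i y <= B y - tB,
     forall x i, U x -> slope_le U h x (v i) -> b' i x - e i <= B x + tB ->
       slope_le U B x (v i),
     forall x, U x -> slope_le U h x m -> slope_le U B x m /\
       forall j, b' j x + e j < B x - tB &
     forall x, U x -> slope_le U B x (v 0%N)].
  (* If the infimal convolution with slope [m] is finite, it is the limit of the [F i]; [B]
     approximates it, and the lowering by more than eps/2 puts the late levels below [B]. *)
  have [hm|nhm] := pselect (cone_minorized U h m).
  - have cFm := infconv_cvx cU m0 hm ch.
    have Fm_slope x : U x -> slope_le U (infconv U h m) x m.
      by move=> Ux; exact: infconv_slope_ge.
    have e8 : 0 < eps / 8 by lra.
    have [B [CB cB B_F B_slope]] := smooth_lipschitz_minorant oU cU Uz0 m0 cFm Fm_slope e8.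
    exists B, (eps / 8); split; split=> //.
    + move=> x Ux; have /andP[_ Bx] := B_F x Ux; apply: le_trans Bx _.
      exact: infconv_le_fun.
    + move=> x Ux.
      have [z Uz Hz] : exists2 z, U z & h z + m * enorm (x - z) < infconv U h m x + eps / 16.
        by apply: (infconv_lt Ux); rewrite ltrDl divr_gt0.
      have [N HN] := near_level Uz Hz; exists N.
      have r0 : 0 < eps / 16 / (m + 1) by rewrite !divr_gt0.
      apply: filterS3 HN (near_enorm x r0) (near_open oU Ux) => y HN yr Uy i Ni.
      have := b'_le i y Uy; have := HN i Ni; have /andP[+ _] := B_F y Uy.
      have := Fm_slope x Ux y Uy; rewrite (enormB x).
      have : m * enorm (y - x) <= eps / 16.
        apply: (@le_trans _ _ ((m + 1) * enorm (y - x))).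
          by rewrite ler_wpM2r ?enorm_ge0 //; lra.
        by rewrite mulrC -ler_pdivlMr ?ltW //; lra.
      by rewrite /p; have := e0 i; lra.
    + move=> x i Ux _ _; exact: slope_le_trans (mv i) (B_slope x Ux).
    + move=> x Ux hx; split=> [|j]; first exact: B_slope.
      have := b'_leh j x Ux; have /andP[+ _] := B_F x Ux.
      by rewrite infconv_eq // /p; have := e0 j; lra.
    + move=> x Ux; exact: slope_le_trans (mv 0%N) (B_slope x Ux).
  (* Otherwise [h] has no point of slope [m], and h + m|x| is unbounded below on [U], so the levels
     tend to minus infinity near every point; repeating level 0 as [B] is then enough. *)
  - exists (b' 0%N), (e 0%N); split; split=> //.
    + by move=> x Ux; have := b'_leh 0%N x Ux; rewrite /p; have := e0 0%N; lra.
    + move=> x Ux; pose A := F 0%N x - v 0%N - 2 * e 0%N.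
      have [z Uz Hz] : exists2 z, U z & h z + m * enorm z < A - p 0%N - m * enorm x.
        apply: contrapT => Hn; apply: nhm; exists (A - p 0%N - m * enorm x) => z Uz.
        by rewrite leNgt; apply/negP => Hz; apply: Hn; exists z.
      have Hz' : h z + m * enorm (x - z) < A - p 0%N.
        have : m * enorm (x - z) <= m * (enorm x + enorm z).
          by rewrite ler_wpM2l // -(enormN z) enormD.
        by lra.
      have [N HN] := near_level Uz Hz'; exists N.
      apply: filterS3 HN (near_enorm x ltr01) (near_open oU Ux) => y HN yr Uy i Ni.
      have := b'_le i y Uy; have := HN i Ni; have := b'_ge 0%N y Uy.
      have := infconv_slope_ge (v0 0%N) (hv 0%N) Ux Uy; rewrite (enormB x) -/(F 0%N).
      have : v 0%N * enorm (y - x) <= v 0%N by rewrite ler_piMr // ltW.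
      by rewrite /A /p; have := e0 i; lra.
    + move=> x [|i] Ux hx; first by move=> _; exact: b'_slope.
      have := cover i.+1 x Ux hx; have := b'_leh 0%N x Ux.
      have := gap_p 0%N i.+1 isT; lra.
    + move=> x Ux /(slope_le_cone_minorized m0 Ux) hm; exfalso; exact: nhm.
    + by move=> x; exact: b'_slope.
pose b i := if i is i'.+1 then b' i' else B.
pose tau i := if i is i'.+1 then e i' else tB.
have Cb i : C_infty_on U (b i) by case: i.
have cb i : cvx U (b i) by case: i.
have tau0 i : 0 < tau i by case: i.
have lf x : U x -> exists N j : nat,
    (j < N)%N /\ \forall y \near x, forall i, (N <= i)%N -> b i y <= b j y - tau j.
  move=> Ux; have [N HN] := B_near x Ux; exists N.+1, 0%N; split => //.
  by apply: filterS HN => y HN [//|i] Ni; exact: HN.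
have [E [[CE cE E_ge E_le] [E_slope _]]] := smooth_glue oU cU Cb cb tau0 lf.
exists E; split; split=> //.
- move=> x Ux; apply/andP; split.
    have := E_ge 1%N x Ux; have := b'_ge 0%N x Ux; rewrite /b /tau /p.
    have := e00; have := e0 0%N; lra.
  have [[|i] Hi] := E_le x Ux; apply: le_trans Hi _; first exact: Bh.
  by have := b'_leh i x Ux; rewrite /b /p; have := e0 i; lra.
- move=> x i Ux hx; have Eb := E_ge i.+1 x Ux; rewrite /b /tau in Eb.
  apply: E_slope => // -[|j] /= Hj; first by apply: Bv => //; lra.
  have [ij|ji] := leqP i j.
    exact: slope_le_trans (v_mono ij) (b'_slope j x Ux).
  have := cover i x Ux hx; have := b'_leh j x Ux; have := gap_p j i ji; lra.
- move=> x Ux hx; have [Bx Bj] := Bm x Ux hx; apply: E_slope => // -[//|j] /= Hj.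
  by have := E_ge 0%N x Ux; have := Bj j; rewrite /b /tau /= ; lra.
- move=> x Ux; apply: E_slope => // -[|j] _; first exact: B_v0.
  exact: slope_le_trans (v_mono (leq0n j)) (b'_slope j x Ux).
Qed.

End SlopeLevels.

(** * Infinite convex combinations *)

Section Mixtures.
Variable R : realType.
Implicit Types (w a b : nat -> R) (c l : R).

(** The missing weight stays on [a0], so each truncation is itself a convex combination as long as
    the partial sums of [w] are at most 1, whatever the total weight. *)
Definition mix_partial w (a0 : R) a (N : nat) : R :=
  a0 + \sum_(0 <= k < N) w k * (a k - a0).

(* l is the infinite convex combination of a0 and the a_k in which a_k has
   weight w_k and a0 has the remaining weight. *)
Definition is_mix w (a0 : R) a l := mix_partial w a0 a N @[N --> \oo] --> l.

Lemma geometric_sum N : \sum_(0 <= k < N) (2^-1 : R) ^+ k = 2 - 2 * 2^-1 ^+ N.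
Proof.
elim: N => [|N IH]; first by rewrite big_nil expr0 mulr1 subrr.
by rewrite big_nat_recr //= IH exprS; field.
Qed.

Lemma is_mix_exists w (a0 : R) a c :
  (forall k, `|w k * (a k - a0)| <= c * 2^-1 ^+ k) ->
  exists2 l, is_mix w a0 a l & `|l - a0| <= 2 * c.
Proof.
move=> H; have c0 : 0 <= c.
  by have := le_trans (normr_ge0 _) (H 0%N); rewrite expr0 mulr1.
have Sb N : `|\sum_(0 <= k < N) w k * (a k - a0)| <= 2 * c.
  apply: le_trans (ler_norm_sum _ _ _) _.
  apply: (@le_trans _ _ (\sum_(0 <= k < N) c * 2^-1 ^+ k)).
    by apply: ler_sum => k _; exact: H.
  rewrite -mulr_sumr geometric_sum mulrBr (mulrC 2 c) gerBl.
  by rewrite !mulr_ge0 // exprn_ge0 // invr_ge0.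
have cs : cvgn (series (fun k => w k * (a k - a0))).
  apply: normed_cvg; apply: (@series_le_cvg _ _ (fun k => c * 2^-1 ^+ k)) => //.
  - by move=> k /=; exact: normr_ge0.
  - by move=> k /=; rewrite mulr_ge0 // exprn_ge0 // invr_ge0.
  - apply: is_cvg_geometric_series.
    by rewrite ger0_norm ?invr_ge0 // invf_lt1 // ltr1n.
have /cvg_ex[s Hs] := cs.
exists (a0 + s); first exact: (cvgD (cvg_cst a0) Hs).
rewrite addrC addKr.
have Hn : `|series (fun k => w k * (a k - a0)) N| @[N --> \oo] --> `|s|.
  exact: cvg_norm.
rewrite -(cvg_lim _ Hn) //; apply: limr_le; first by apply/cvg_ex; exists `|s|.
by apply: nearW => N; exact: Sb.
Qed.

Lemma is_mixD w (a0 b0 : R) a b l l' : is_mix w a0 a l -> is_mix w b0 b l' ->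
  is_mix w (a0 + b0) (fun k => a k + b k) (l + l').
Proof.
move=> Ha Hb; rewrite /is_mix.
suff -> : mix_partial w (a0 + b0) (fun k => a k + b k) =
  (fun N => mix_partial w a0 a N + mix_partial w b0 b N) by exact: cvgD Ha Hb.
apply/funext => N; rewrite /mix_partial addrACA -big_split /=; congr (_ + _).
by apply: eq_bigr => k _; ring.
Qed.

Lemma is_mixZ w c (a0 : R) a l : is_mix w a0 a l ->
  is_mix w (c * a0) (fun k => c * a k) (c * l).
Proof.
move=> Ha; rewrite /is_mix.
suff -> : mix_partial w (c * a0) (fun k => c * a k) =
  (fun N => c * mix_partial w a0 a N) by exact: cvgM (cvg_cst c) Ha.
apply/funext => N; rewrite /mix_partial mulrDr mulr_sumr; congr (_ + _).
by apply: eq_bigr => k _; ring.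
Qed.

Lemma is_mixB w (a0 b0 : R) a b l l' : is_mix w a0 a l -> is_mix w b0 b l' ->
  is_mix w (a0 - b0) (fun k => a k - b k) (l - l').
Proof.
move=> Ha /(@is_mixZ _ (-1) _ _ _) /(is_mixD Ha); rewrite !mulN1r.
by under eq_fun do rewrite mulN1r.
Qed.

Lemma is_mix_cst w l : is_mix w l (fun=> l) l.
Proof.
apply: cvg_near_cst; apply: nearW => N; rewrite /mix_partial big1 ?addr0 // => k _.
by rewrite subrr mulr0.
Qed.

Lemma is_mix_le w (a0 b0 : R) a b l l' : (forall k, 0 <= w k) ->
  (forall N, \sum_(0 <= k < N) w k <= 1) -> a0 <= b0 -> (forall k, a k <= b k) ->
  is_mix w a0 a l -> is_mix w b0 b l' -> l <= l'.
Proof.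
move=> w0 w1 ab0 ab Ha Hb; apply: (ler_cvg_to Ha Hb); apply: nearW => N.
have E (s0 : R) s : mix_partial w s0 s N =
    (1 - \sum_(0 <= k < N) w k) * s0 + \sum_(0 <= k < N) w k * s k.
  rewrite /mix_partial mulrBl mul1r -addrA mulr_suml -sumrN -big_split /=.
  by congr (_ + _); apply: eq_bigr => k _; ring.
rewrite !E lerD //; first by rewrite ler_wpM2l // subr_ge0.
by apply: ler_sum => k _; rewrite ler_wpM2l.
Qed.

(** Comparison with a sequence that leaves [a0] only at index [j] isolates the contribution of a
    single term. *)
Lemma is_mix_delta w (a0 d : R) j :
  is_mix w a0 (fun k => a0 + (k == j)%:R * d) (a0 + w j * d).
Proof.
apply: cvg_near_cst; exists j.+1 => // N /= jN.
rewrite /mix_partial big_mkord (bigD1 (Ordinal jN)) //= eqxx mul1r (addrC a0 d) addrK.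
rewrite big1 ?addr0 // => k kj; rewrite (_ : (k : nat) == j = false).
  by rewrite mul0r addr0 subrr mulr0.
by apply/negbTE; apply: contraNneq kj => kj; apply/eqP/val_inj.
Qed.

Lemma is_mix_le_gain w (a0 : R) a l c d j : (forall k, 0 <= w k) ->
  (forall N, \sum_(0 <= k < N) w k <= 1) -> a0 <= c -> (forall k, a k <= c) ->
  a j <= c - d -> is_mix w a0 a l -> l <= c - w j * d.
Proof.
move=> w0 w1 ac0 ac aj Ha; rewrite -mulrN.
have ab k : a k <= c + (k == j)%:R * - d.
  by have [->|kj] := eqVneq k j; rewrite ?mul1r // mul0r addr0.
exact: is_mix_le w0 w1 ac0 ab Ha (@is_mix_delta w c (- d) j).
Qed.

(** At least half of the mass remains on [a0]. Applied to gaps, this keeps half of the convexity of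
    [f]. *)
Lemma is_mix_half w (a0 : R) a l : (forall k, 0 <= w k) ->
  (forall N, \sum_(0 <= k < N) w k <= 2^-1) -> 0 <= a0 -> (forall k, 0 <= a k) ->
  is_mix w a0 a l -> a0 / 2 <= l.
Proof.
move=> w0 w1 a00 ak Ha; apply: (ler_cvg_to (cvg_cst _) Ha); apply: nearW => N.
rewrite /mix_partial; have : 0 <= \sum_(0 <= k < N) w k * a k.
  by apply: sumr_ge0 => k _; rewrite mulr_ge0.
have -> : \sum_(0 <= k < N) w k * (a k - a0) =
    \sum_(0 <= k < N) w k * a k - (\sum_(0 <= k < N) w k) * a0.
  by rewrite mulr_suml -sumrN -big_split; apply: eq_bigr => k _ /=; ring.
have := ler_wpM2r a00 (w1 N); lra.
Qed.

End Mixtures.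

(** * Local bounds for convex functions and their slopes *)

Section LocalSlopeBound.
Variables (R : realType) (n : nat) (U : set 'rV[R]_n).
Hypotheses (oU : open U) (cU : convex_set U).
Local Notation Rn := 'rV[R]_n.
Implicit Types (x y z : Rn) (L : R).
Variable f : Rn -> R.
Hypothesis cf : cvx U f.

(** Induction on the number of free coordinates: [y] is the midpoint of [y1], which doubles the
    displacement in the earlier coordinates, and [y2], which doubles that in the new one. Along the
    new axis [f] is bounded by its values at two points. *)
Lemma cvx_locally_bounded x : U x -> exists B r, 0 < r /\
  forall y, enorm (y - x) < r -> U y /\ f y <= B.
Proof.
move=> Ux; have [r0 r00 rU] := open_enorm oU Ux.
suff H k : exists B r, [/\ 0 < r, r <= r0 & forall y, enorm (y - x) < r ->
    (forall i : 'I_n, (k <= i)%N -> y 0 i = x 0 i) -> f y <= B].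
  have [B [r [r_gt0 rr0 Hr]]] := H n; exists B, r; split => // y yr; split.
    by apply: rU; exact: lt_le_trans yr rr0.
  by apply: Hr => // i; rewrite leqNgt ltn_ord.
elim: k => [|k [B [r [r_gt0 rr0 IH]]]].
  exists (f x), r0; split => // y _ yx.
  by rewrite (_ : y = x) //; apply/rowP => i; exact: yx.
have [kn|nk] := ltnP k n; last first.
  exists B, r; split=> // y yr yx; apply: IH => // i ki.
  by move: (ltn_ord i); rewrite ltnNge (leq_trans nk ki).
pose k' := Ordinal kn; pose e : Rn := delta_mx 0 k'.
have e1 : enorm e = 1.
  rewrite enormE /dot (bigD1 k') //= big1 ?addr0 => [|i ik].
    by rewrite !mxE !eqxx mul1r sqrtr1.
  by rewrite !mxE eqxx /= (negbTE ik) mul0r.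
pose rho := r / 2; have rho0 : 0 < rho by rewrite divr_gt0.
have Ue d : `|d| <= rho -> U (x + d *: e).
  move=> dr; apply: rU; rewrite addrC addKr enormZ e1 mulr1.
  by apply: le_lt_trans dr _; rewrite /rho; lra.
pose B' := Num.max (f (x + (- rho) *: e)) (f (x + rho *: e)).
have fe d : `|d| <= rho -> f (x + d *: e) <= B'.
  rewrite ler_norml => /andP[d1 d2]; pose t := (d + rho) / (2 * rho).
  have r20 : 0 < 2 * rho by rewrite mulr_gt0.
  have tE : t * (2 * rho) = d + rho by rewrite /t divfK ?gt_eqF.
  have t01 : 0 <= t <= 1.
    by rewrite /t; apply/andP; split; [rewrite divr_ge0 //; lra|rewrite ler_pdivrMr //; lra].
  have -> : x + d *: e = (1 - t) *: (x + (- rho) *: e) + t *: (x + rho *: e).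
    apply/rowP => i; rewrite !mxE; set c := (_ && _)%:R.
    have : d = t * (2 * rho) - rho by lra.
    by move=> ->; ring.
  have Ur : U (x + (- rho) *: e) by apply: Ue; rewrite normrN gtr0_norm.
  have Ur' : U (x + rho *: e) by apply: Ue; rewrite gtr0_norm.
  apply: le_trans (cvx_le cf Ur Ur' t01) _.
  have H1 : f (x + (- rho) *: e) <= B' by rewrite le_max lexx.
  have H2 : f (x + rho *: e) <= B' by rewrite le_max lexx orbT.
  by move/andP: t01 => [t0 t1]; nra.
exists (Num.max B B'), (rho / 2); split; first by rewrite divr_gt0.
  by rewrite /rho; lra.
move=> y yr yx; set d := y 0 k' - x 0 k'.
have dN : `|d| <= enorm (y - x).
  by have := coord_le_enorm (y - x) k'; rewrite !mxE.
pose y1 := x + 2 *: (y - x - d *: e); pose y2 := x + (2 * d) *: e.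
have -> : y = (1 - 2^-1) *: y1 + 2^-1 *: y2.
  by apply/rowP => i; rewrite !mxE; field.
have Uy2 : U y2 by apply: Ue; rewrite normrM ger0_norm //; lra.
have y1r : enorm (y1 - x) < r.
  rewrite /y1 addrC addKr enormZ ger0_norm //.
  have := enormD (y - x) (- (d *: e)); rewrite enormN enormZ e1 mulr1.
  by rewrite /rho in yr; lra.
have fy1 : f y1 <= B.
  apply: IH => // i; rewrite leq_eqVlt => /predU1P[ki|ki].
    have -> : i = k' by apply: val_inj.
    by rewrite !mxE !eqxx /= /d; ring.
  rewrite !mxE yx // eqxx /= (_ : i == k' = false) ?mulr0; first by ring.
  by apply/negbTE; rewrite -val_eqE /= gtn_eqF.
have Uy1 : U y1 by apply: rU; exact: lt_le_trans y1r rr0.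
have fy2 : f y2 <= B' by apply: fe; rewrite normrM ger0_norm //; lra.
have h01 : 0 <= (2^-1 : R) <= 1 by lra.
apply: le_trans (cvx_le cf Uy1 Uy2 h01) _.
have H1 : B <= Num.max B B' by rewrite le_max lexx.
have H2 : B' <= Num.max B B' by rewrite le_max lexx orbT.
lra.
Qed.

(** An upper bound B and, by a subgradient, a lower bound b hold on a ball; convexity on a segment
    prolonged by half the radius bounds the descent rate by (B - b)/r2. *)
Lemma slope_bounded_near x : U x ->
  exists2 L, 0 <= L & \forall y \near x, slope_le U f y L.
Proof.
move=> Ux; have [B [r [r0 Hr]]] := cvx_locally_bounded Ux.
have [xi Hxi] := subgradient_exists oU cU cf Ux.
pose b := f x - enorm xi * r.
have fb y : U y -> enorm (y - x) < r -> b <= f y.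
  move=> Uy yr; apply: le_trans (Hxi y Uy); rewrite /b lerD2l.
  rewrite -(opprB x y) dotNr lerN2; apply: le_trans (dot_le_enorm _ _) _.
  by rewrite enormB ler_wpM2l ?enorm_ge0 // ltW.
have bB : b <= B.
  have xr : enorm (x - x) < r by rewrite subrr enorm0.
  by apply: le_trans (fb x Ux xr) _; have [] := Hr x xr.
pose r2 := r / 2; have r20 : 0 < r2 by rewrite divr_gt0.
exists ((B - b) / r2); first by rewrite divr_ge0 ?subr_ge0 // ltW.
apply: filterS (near_enorm x r20) => y yr z Uz.
have [d0|dn0] := eqVneq (enorm (y - z)) 0.
  move/eqP: (d0); rewrite enorm_eq0 subr_eq0 => /eqP ->.
  by rewrite !subrr enorm0 mulr0.
set d := enorm (y - z) in dn0 *.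
have d0 : 0 < d by rewrite lt_def dn0 enorm_ge0.
have yr' : enorm (y - x) < r by rewrite /r2 in yr; lra.
have [Uy fyB] := Hr y yr'.
(* The segment from [z] to [y] is prolonged beyond [y] by r2, so that [y] lies between [z] and a
   point where [f] is at most B. *)
pose w := y + (r2 / d) *: (y - z).
have [Uw fwB] : U w /\ f w <= B.
  apply: Hr; rewrite /w -addrA (addrC _ (- x)) addrA.
  apply: le_lt_trans (enormD _ _) _; rewrite enormZ -/d ger0_norm ?divr_ge0 ?ltW //.
  by rewrite divfK ?gt_eqF //; rewrite /r2 in yr *; lra.
have dr : 0 < d + r2 by rewrite addr_gt0.
pose t := d / (d + r2); have tE : t * (d + r2) = d by rewrite /t divfK ?gt_eqF.
have t01 : 0 <= t <= 1.
  by rewrite /t divr_ge0 ?(ltW d0) ?(ltW dr) //= ler_pdivrMr // mul1r lerDl (ltW r20).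
have yE : y = (1 - t) *: z + t *: w.
  apply/rowP => i; rewrite !mxE /t; field.
  by rewrite !gt_eqF.
have := cvx_le cf Uz Uw t01; rewrite -yE => H.
have := fb y Uy yr'; rewrite mulrAC ler_pdivlMr // => H2.
have : (d + r2) * f y <= (d + r2) * ((1 - t) * f z + t * f w).
  by rewrite ler_wpM2l // ltW.
have -> : (d + r2) * ((1 - t) * f z + t * f w) =
   (d + r2 - t * (d + r2)) * f z + t * (d + r2) * f w by ring.
rewrite tE; nra.
Qed.

Lemma slope_bounded_compact K : compact K -> K `<=` U ->
  exists2 L, 0 <= L & forall x, K x -> slope_le U f x L.
Proof.
move=> cK KU; apply: (compact_set_ind (P := fun K =>
  exists2 L, 0 <= L & forall x, K x -> slope_le U f x L) cK).
- by exists 0.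
- move=> A B [L L0 HA] [L' L'0 HB]; exists (L + L'); first exact: addr_ge0.
  by move=> x [/HA|/HB]; apply: slope_le_trans; rewrite ?lerDl ?lerDr.
- by move=> A B AB [L L0 HB]; exists L => // x /AB; exact: HB.
- move=> x Kx; have [L L0 HL] := slope_bounded_near (KU x Kx).
  by exists [set y | slope_le U f y L] => //; exists L.
Qed.

End LocalSlopeBound.

(** * Strict contraction of slopes by a mixture of infimal convolutions *)

Section Contraction.
Variables (R : realType) (n : nat) (U : set 'rV[R]_n).
Hypotheses (oU : open U) (cU : convex_set U).
Local Notation Rn := 'rV[R]_n.
Implicit Types (x y z : Rn) (L : R).
Variables (f : Rn -> R) (x0 : Rn).
Hypotheses (cf : cvx U f) (Ux0 : U x0).

(** The infimum need not be attained: for -log on the positive half-line it is 0, although -log is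
    unbounded below. *)
Definition min_slope : R := inf [set s | 0 <= s /\ cone_minorized U f s].

Lemma min_slope_nonempty : [set s | 0 <= s /\ cone_minorized U f s] !=set0.
Proof.
have [L L0 /nbhs_singleton HL] := slope_bounded_near oU cU cf Ux0.
by exists L; split => //; exact: slope_le_cone_minorized HL.
Qed.

Lemma min_slope_ge0 : 0 <= min_slope.
Proof. by apply: lb_le_inf min_slope_nonempty _ => s []. Qed.

Lemma min_slope_le s : 0 <= s -> cone_minorized U f s -> min_slope <= s.
Proof. by move=> s0 fs; apply: ge_inf; [exists 0 => t []|]. Qed.

Lemma min_slope_lt s : min_slope < s -> cone_minorized U f s.
Proof.
move=> /(inf_lt min_slope_nonempty)[t [t0 ft] ts].
exact: cone_minorizedW (ltW ts) ft.
Qed.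

Let m := min_slope.
Let m0 : 0 <= m := min_slope_ge0.

Section Weights.
Variables (s0 eta : R).
Hypotheses (ms0 : m < s0) (eta0 : 0 < eta) (eta1 : eta <= 1).

Let s k := m + (s0 - m) / k.+1%:R.
Let h0 := infconv U f s0.
Let h k := infconv U f (s k).
Let c k := h0 x0 - h k x0.
(** The factor 1 + c k compensates the possible divergence of h_k(x0) to minus infinity as s_k tends
    to m; at other points the Lipschitz bounds add at most [D x]. The exponent k+2 keeps the sum of
    the weights below 1/2, and [eta] controls the error. *)
Let w k := eta * 2^-1 ^+ k.+2 / (1 + c k).

Let s_gt k : m < s k.
Proof. by rewrite ltrDl divr_gt0 // subr_gt0. Qed.

Let s_ge0 k : 0 <= s k. Proof. exact: le_trans (ltW (s_gt k)). Qed.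

Let s0_ge0 : 0 <= s0. Proof. exact: le_trans (ltW ms0). Qed.

Let s_le k : s k <= s0.
Proof.
rewrite /s -lerBrDl ler_pdivrMr // ler_peMr ?ler1n // subr_ge0; exact: ltW.
Qed.

Let fs k : cone_minorized U f (s k). Proof. exact: min_slope_lt. Qed.
Let fs0 : cone_minorized U f s0. Proof. exact: min_slope_lt. Qed.

Let h_le k x : U x -> h k x <= h0 x.
Proof. by move=> Ux; apply: infconv_mono. Qed.

Let c_ge0 k : 0 <= c k. Proof. by rewrite subr_ge0 h_le. Qed.
Let c1 k : 0 < 1 + c k. Proof. by rewrite ltr_pwDl. Qed.

Let w_gt0 k : 0 < w k.
Proof. by rewrite divr_gt0 // mulr_gt0 // exprn_gt0 // invr_gt0. Qed.

Let w_le k : w k <= 2^-1 ^+ k / 4.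
Proof.
have q0 : 0 < (2^-1 : R) ^+ k by rewrite exprn_gt0 // invr_gt0.
have E : w k * (1 + c k) = eta * (2^-1 ^+ k / 4).
  by rewrite /w divfK ?gt_eqF // !exprS; field.
have := w_gt0 k; have := c_ge0 k; have := eta1; nra.
Qed.

Let w_sum N : \sum_(0 <= k < N) w k <= 2^-1.
Proof.
apply: (@le_trans _ _ (\sum_(0 <= k < N) 2^-1 ^+ k / 4)).
  by apply: ler_sum => k _; exact: w_le.
rewrite -mulr_suml geometric_sum.
have : 0 < (2^-1 : R) ^+ N by rewrite exprn_gt0 // invr_gt0.
lra.
Qed.

Let w_sum1 N : \sum_(0 <= k < N) w k <= 1.
Proof. by apply: le_trans (w_sum N) _; rewrite invf_le1 // ler1n. Qed.

Let w_le1 k : w k <= 1.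
Proof.
apply: le_trans (w_sum1 k.+1); rewrite big_nat_recr //= lerDr.
by apply: sumr_ge0 => i _; exact: ltW.
Qed.

Let w_c k d : 0 <= d -> w k * (c k + d) <= eta * (1 + d) / 4 * 2^-1 ^+ k.
Proof.
move=> d0; have q0 : 0 < (2^-1 : R) ^+ k by rewrite exprn_gt0 // invr_gt0.
have E : w k * (1 + c k) = eta * (2^-1 ^+ k / 4).
  by rewrite /w divfK ?gt_eqF // !exprS; field.
have -> : eta * (1 + d) / 4 * 2^-1 ^+ k = w k * (1 + c k) * (1 + d).
  by rewrite E; ring.
rewrite -mulrA ler_wpM2l //; first exact: ltW.
have := c_ge0 k; nra.
Qed.

Let D x := 2 * s0 * enorm (x - x0).
Let D_ge0 x : 0 <= D x. Proof. by rewrite !mulr_ge0 ?enorm_ge0. Qed.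

Let h_diff k x : U x -> `|w k * (h k x - h0 x)| <= eta * (1 + D x) / 4 * 2^-1 ^+ k.
Proof.
move=> Ux; apply: le_trans (w_c k (D_ge0 x)).
rewrite normrM gtr0_norm // ler_wpM2l ?(ltW (w_gt0 k)) //.
rewrite ler0_norm ?subr_le0 ?h_le // opprB.
have := infconv_slope_ge s0_ge0 fs0 Ux Ux0.
have := infconv_slope_ge (s_ge0 k) (fs k) Ux0 Ux.
rewrite (enormB x0) -/(h k) -/h0 /c /D.
have := ler_wpM2r (enorm_ge0 (x - x0)) (s_le k); lra.
Qed.

Let fh_ex x : exists l, U x -> is_mix w (h0 x) (h ^~ x) l /\
  `|l - h0 x| <= eta * (1 + D x) / 2.
Proof.
have [Ux|nUx] := pselect (U x); last by exists 0.
have [l Hl ll] := is_mix_exists (h_diff ^~ x ^~ Ux).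
by exists l => _; split => //; apply: le_trans ll _; lra.
Qed.

(** Where [f] has slope at most L > m, each h_k has slope at most min(L, s_k), so the k-th term
    lowers the slope of the mixture by w_k (L - min(L, s_k)). This is the gain [g k L], positive
    once s_k < L. The gap bound holds because h0 coincides with [f] where f has slope at most s0. *)
Lemma slope_contraction : exists (fh : Rn -> R) (g : nat -> R -> R),
  [/\ cvx U fh,
      forall x, U x -> fh x <= f x,
      forall x, U x -> slope_le U f x s0 -> 
        f x - eta * (1 + 2 * s0 * enorm (x - x0)) / 2 <= fh x,
      forall x, U x -> slope_le U fh x s0 &
      forall x L, U x -> 0 <= L -> slope_le U f x L -> slope_le U fh x L] /\
  [/\ forall x L k, U x -> m < L -> slope_le U f x L ->
        slope_le U fh x (L - g k L),
      forall u, m < u -> cone_minorized U fh u &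
      forall V x y t, (forall z, V z -> U z /\ slope_le U f z s0) ->
        V x -> V y -> V ((1 - t) *: x + t *: y) -> 0 <= t <= 1 ->
        gap f x y t / 2 <= gap fh x y t] /\
  [/\ forall k L, m < L -> 0 <= g k L <= L - m,
      forall k L L', L <= L' -> g k L <= g k L',
      forall k L L', L <= L' -> L - g k L <= L' - g k L' &
      forall L, m < L -> exists k, 0 < g k L].
Proof.
have [fh fhP] := choice fh_ex.
have mix x : U x -> is_mix w (h0 x) (h ^~ x) (fh x) by move=> /fhP [].
have w0 k : 0 <= w k by exact: ltW.
have ch0 : cvx U h0 by exact: infconv_cvx.
have chk k : cvx U (h k) by exact: infconv_cvx.
have mix_gap x y t : U x -> U y -> 0 <= t <= 1 ->
    is_mix w (gap h0 x y t) (fun k => gap (h k) x y t) (gap fh x y t).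
  move=> Ux Uy t01; have Uz := convex_set_comb cU Ux Uy t01.
  exact: is_mixB (is_mixD (@is_mixZ _ _ (1 - t) _ _ _ (mix x Ux))
    (@is_mixZ _ _ t _ _ _ (mix y Uy))) (mix _ Uz).
have mix_sub x y : U x -> U y ->
    is_mix w (h0 x - h0 y) (fun k => h k x - h k y) (fh x - fh y).
  by move=> Ux Uy; exact: is_mixB (mix x Ux) (mix y Uy).
have key x L L' k : U x -> slope_le U h0 x L -> (forall j, slope_le U (h j) x L) ->
    slope_le U (h k) x L' -> slope_le U fh x (L - w k * (L - L')).
  move=> Ux H0 H1 H2 y Uy; rewrite mulrBl -mulrA.
  apply: (is_mix_le_gain w0 w_sum1 _ _ _ (mix_sub x y Ux Uy)).
  - exact: H0.
  - by move=> j; exact: H1.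
  - by apply: le_trans (H2 y Uy) _; rewrite mulrBl; lra.
have h0_slope x : U x -> slope_le U h0 x s0 by exact: infconv_slope_ge.
have hk_slope k x : U x -> slope_le U (h k) x (s k) by exact: infconv_slope_ge.
have slope0 x L : U x -> slope_le U h0 x L -> (forall k, slope_le U (h k) x L) ->
    slope_le U fh x L.
  by move=> Ux H0 H1; have := key x L L 0%N Ux H0 H1 (H1 0%N); rewrite subrr mulr0 subr0.
exists fh, (fun k L => w k * (L - Num.min L (s k))).
split; [split | split; split].
- move=> x y t Ux Uy t01.
  apply: (is_mix_le w0 w_sum1 _ _ (@is_mix_cst _ w 0) (mix_gap x y t Ux Uy t01)).
    exact: ch0.
  by move=> k; exact: chk.
- move=> x Ux; apply: le_trans (infconv_le_fun s0_ge0 fs0 Ux).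
  apply: (is_mix_le w0 w_sum1 _ _ (mix x Ux) (@is_mix_cst _ w _)) => // k; exact: h_le.
- move=> x Ux fx; have [_] := fhP x Ux.
  by rewrite -/(D x) /h0 infconv_eq // ler_norml => /andP[]; lra.
- move=> x Ux; apply: slope0 => // [|k]; first exact: h0_slope.
  exact: slope_le_trans (s_le k) (hk_slope k x Ux).
- move=> x L Ux L0 fx; apply: slope0 => // [|k]; exact: infconv_slope.
- move=> x L k Ux mL fx; have L0 : 0 <= L by exact: le_trans (ltW mL).
  apply: key => // [|j|]; try exact: infconv_slope.
  by have [_|_] := leP L (s k); [exact: infconv_slope|exact: hk_slope].
- move=> u mu; have u0 : 0 <= u by exact: le_trans (ltW mu).
  have fu := min_slope_lt mu.
  (* If s_k <= u, h_k is u-Lipschitz; otherwise it lies above the infimal convolution with slope u.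
     Either way it is at least min(h_k x0, a) - u|z - x0|, and these minima have a mixture [l]. *)
  pose a := infconv U f u x0.
  pose b k := Num.min (h k x0) a; pose b0 := Num.min (h0 x0) a.
  have [l Hl _] : exists2 l, is_mix w b0 b l & `|l - b0| <= 2 * (eta * (1 + 0) / 4).
    apply: is_mix_exists => k; apply: le_trans (w_c k (lexx 0)).
    rewrite addr0 normrM gtr0_norm // ler_wpM2l ?(ltW (w_gt0 k)) //.
    have hk := h_le k Ux0; rewrite /b /b0 /c.
    by case: (leP (h k x0) a) => ?; case: (leP (h0 x0) a) => ?; rewrite ler_norml; apply/andP; split; lra.
  exists (l - u * enorm x0) => z Uz.
  have bound r : 0 <= r -> cone_minorized U f r ->
      Num.min (infconv U f r x0) a - u * enorm (z - x0) <= infconv U f r z.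
    move=> r0 fr; have [ru|/ltW ur] := leP r u.
      have := infconv_slope_ge r0 fr Ux0 Uz; rewrite (enormB x0).
      have := ler_wpM2r (enorm_ge0 (z - x0)) ru.
      have : Num.min (infconv U f r x0) a <= infconv U f r x0 by rewrite ge_min lexx.
      lra.
    have := infconv_slope_ge u0 fu Ux0 Uz; rewrite (enormB x0) -/a.
    have := infconv_mono Uz u0 ur fu.
    have : Num.min (infconv U f r x0) a <= a by rewrite ge_min lexx orbT.
    lra.
  have : l + - (u * enorm (z - x0)) <= fh z.
    apply: (is_mix_le w0 w_sum1 _ _ (is_mixD Hl (@is_mix_cst _ w _)) (mix z Uz)).
      exact: bound.
    by move=> k; exact: bound.
  have : u * enorm (z - x0) <= u * (enorm z + enorm x0).
    by rewrite ler_wpM2l // -(enormN x0) enormD.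
  lra.
- move=> V x y t VU Vx Vy Vz t01.
  have [Ux fx] := VU x Vx; have [Uy fy] := VU y Vy; have [Uz fz] := VU _ Vz.
  have <- : gap h0 x y t = gap f x y t by rewrite /gap /h0 !infconv_eq.
  apply: (is_mix_half w0 w_sum _ _ (mix_gap x y t Ux Uy t01)).
    exact: ch0.
  by move=> k; exact: chk.
- move=> k L mL; have := w_le1 k; have := w_gt0 k; have := s_gt k.
  by have [|] := leP L (s k) => ? ? ? ?; apply/andP; split; nra.
- move=> k L L' LL'; rewrite ler_wpM2l //.
  by have [|] := leP L (s k) => ?; have [|] := leP L' (s k) => ?; lra.
- move=> k L L' LL'; have := w_le1 k; have := w_gt0 k.
  by have [|] := leP L (s k) => ?; have [|] := leP L' (s k) => ? ? ?; nra.
- move=> L mL; have Lm0 : 0 < L - m by rewrite subr_gt0.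
  pose k := Num.bound ((s0 - m) / (L - m)).
  have Hk : (s0 - m) / (L - m) < k%:R.
    by apply: archi_boundP; rewrite divr_ge0 ?(ltW Lm0) // subr_ge0 ltW.
  exists k; rewrite mulr_gt0 // subr_gt0 gt_min; apply/orP; right.
  rewrite /s -ltrBrDl ltr_pdivrMr // mulrC -ltr_pdivrMr //.
  by apply: lt_trans Hk _; rewrite ltr_nat.
Qed.

End Weights.
End Contraction.

(** * Approximation on compact sets and globally *)

Section CompactApproximation.
Variables (R : realType) (n : nat) (U : set 'rV[R]_n).
Hypotheses (oU : open U) (cU : convex_set U).
Local Notation Rn := 'rV[R]_n.
Implicit Types (x y z : Rn) (L : R).
Variables (f : Rn -> R) (x0 : Rn).
Hypotheses (cf : cvx U f) (Ux0 : U x0).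
Let m := min_slope U f.

(* A grid v, decreasing to m, so fine that rounding up to the grid is
   compensated by the gain L - g_k(L) of the contraction. *)
Lemma slope_grid (s0 : R) (g : nat -> R -> R) : m < s0 ->
  (forall k L, m < L -> 0 <= g k L <= L - m) ->
  (forall k L L', L <= L' -> g k L <= g k L') ->
  (forall k L L', L <= L' -> L - g k L <= L' - g k L') ->
  (forall L, m < L -> exists k, 0 < g k L) ->
  exists v : nat -> R, [/\ v 0%N = s0, forall i, m < v i, forall i, v i.+1 <= v i,
    forall L, m < L -> exists i, v i <= L &
    forall L, m < L -> L < s0 -> exists i k, v i <= L /\ L - g k L <= v i].
Proof.
move=> ms0 g_bd g_mono g_lip g_pos.
(* The best gain at slope L: above m it is positive, nondecreasing and 1-Lipschitz. *)
pose mu L := sup [set g k L | k in [set: nat]].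
have ne L : [set g k L | k in [set: nat]] !=set0 by exists (g 0%N L), 0%N.
have ub L : m < L -> has_ubound [set g k L | k in [set: nat]].
  by move=> mL; exists (L - m) => _ [k _ <-]; have /andP[] := g_bd k L mL.
have g_le k L : m < L -> g k L <= mu L.
  by move=> mL; apply: ub_le_sup; [exact: ub|exists k].
have mu_le L : m < L -> mu L <= L - m.
  by move=> mL; apply: ge_sup => // _ [k _ <-]; have /andP[] := g_bd k L mL.
have mu_gt0 L : m < L -> 0 < mu L.
  by move=> mL; have [k gk] := g_pos L mL; exact: lt_le_trans gk (g_le k L mL).
have mu_mono L L' : m < L -> L <= L' -> mu L <= mu L'.
  move=> mL LL'; apply: ge_sup => // _ [k _ <-]; apply: le_trans (g_mono k _ _ LL') _.
  by apply: g_le; exact: lt_le_trans LL'.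
have mu_lip L L' : m < L -> L <= L' -> mu L' <= mu L + (L' - L).
  move=> mL LL'; apply: ge_sup => // _ [k _ <-].
  by have := g_lip k _ _ LL'; have := g_le k L mL; lra.
(* Each step uses half of the available gain. If v_{j+1} <= L < v_j, the Lipschitz bound gives L -
   mu L <= v_j - mu v_j < v_{j+1}; as the inequality is strict, a single g_k achieves it. *)
pose v := fix v i : R := if i is i'.+1 then v i' - mu (v i') / 2 else s0.
have vS i : v i.+1 = v i - mu (v i) / 2 by [].
have mv i : m < v i.
  by elim: i => [//|i IH]; rewrite vS; have := mu_le _ IH; lra.
have v_decr i : v i.+1 <= v i by rewrite vS; have := mu_gt0 _ (mv i); lra.
have v_lim L : m < L -> exists i, v i <= L.
  move=> mL; apply: contrapT => Hn.
  have Lv i : L < v i by rewrite ltNge; apply/negP => vL; apply: Hn; exists i.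
  have d0 : 0 < mu L / 2 by rewrite divr_gt0 // mu_gt0.
  have Hi i : v i <= s0 - (mu L / 2) * i%:R.
    elim: i => [|i IH]; first by rewrite mulr0 subr0.
    rewrite vS -[i.+1%:R]natr1 mulrDr mulr1; have := mu_mono L (v i) mL (ltW (Lv i)).
    by move: IH; lra.
  pose k := Num.bound ((s0 - m) / (mu L / 2)).
  have Hk : (s0 - m) / (mu L / 2) < k%:R.
    by apply: archi_boundP; rewrite divr_ge0 ?(ltW d0) // subr_ge0 ltW.
  rewrite ltr_pdivrMr // mulrC in Hk.
  have := Hi k; have := mv k; move: Hk; set c := mu L / 2 * _; lra.
exists v; split=> // L mL Ls0.
have [i vi] := v_lim L mL.
have [j [jL jL']] : exists j, v j.+1 <= L /\ L < v j.
  elim: i vi => [|i IH] vi; first by rewrite /= leNgt Ls0 in vi.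
  by have [/IH //|Lvi] := leP (v i) L; exists i.
have : L - mu L < v j.+1.
  by rewrite vS; have := mu_lip L (v j) mL (ltW jL'); have := mu_gt0 _ (mv j); lra.
rewrite ltrBlDl -ltrBlDr => /(sup_gt (ne L))[_ [k _ <-] gk].
by exists j.+1, k; split => //; lra.
Qed.

Lemma compact_enorm_bound K : compact K -> exists B : R, forall x, K x -> enorm (x - x0) <= B.
Proof.
move=> cK; apply: (compact_set_ind (P := fun K =>
  exists B : R, forall x, K x -> enorm (x - x0) <= B) cK).
- by exists 0.
- move=> A B [b HA] [b' HB]; exists (Num.max b b') => x [/HA|/HB] /le_trans; apply.
    by rewrite le_max lexx.
  by rewrite le_max lexx orbT.
- by move=> A B AB [b HB]; exists b => x /AB; exact: HB.
- move=> x Kx; exists [set y | enorm (y - x) < 1]; first exact: near_enorm.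
  exists (1 + enorm (x - x0)) => y /= yx.
  by have := enormD (y - x) (x - x0); rewrite addrA subrK; lra.
Qed.

(* fh is a convex minorant, close to f on K, whose minimal subgradients are
   everywhere strictly shorter than those of f, and which can therefore be
   smoothed without exceeding the slopes of f. *)
Lemma compact_approx K (eps : R) : compact K -> K `<=` U -> 0 < eps ->
  exists fh : Rn -> R,
  [/\ cvx U fh, forall x, U x -> fh x <= f x, forall x, K x -> f x - eps <= fh x &
      forall sigma : R, 0 < sigma -> exists E, smooth_minorant U fh (slope_le U f) E /\
        forall x, U x -> fh x - sigma <= E x] /\
  [/\ forall x L, U x -> 0 <= L -> slope_le U f x L -> slope_le U fh x L,
      forall x L, U x -> m < L -> slope_le U f x L ->
        exists L', 0 <= L' < L /\ slope_le U fh x L' &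
      forall x y t, K x -> K y -> K ((1 - t) *: x + t *: y) -> 0 <= t <= 1 ->
        gap f x y t / 2 <= gap fh x y t].
Proof.
move=> cK KU eps0.
have m0 : 0 <= m by exact: (min_slope_ge0 oU cU cf Ux0).
have [LK LK0 HLK] := slope_bounded_compact oU cU cf cK KU.
have [B HB] := compact_enorm_bound cK.
(* Large enough for the convolution with slope s0 to be [f] on [K], and strictly above [m]. *)
pose s0 := Num.max LK (m + 1).
have ms0 : m < s0 by rewrite lt_max ltrDl ltr01 orbT.
have s00 : 0 <= s0 by exact: le_trans (ltW ms0).
have fK x : K x -> slope_le U f x s0.
  by move=> /HLK; apply: slope_le_trans; rewrite le_max lexx.
pose X := 1 + 2 * s0 * Num.max B 0.
have X0 : 0 < X.
  by rewrite ltr_pwDl // !mulr_ge0 // le_max lexx orbT.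
pose eta := Num.min 1 (eps / X).
have eta0 : 0 < eta by rewrite lt_min ltr01 divr_gt0.
have eta1 : eta <= 1 by rewrite ge_min lexx.
have etaX : eta * X <= eps by rewrite -ler_pdivlMr // ge_min lexx orbT.
have [fh [g [[cfh fhf fh_ge fh_s0 fh_slope] [[fh_gain fh_cone fh_gap]]]]] :=
  slope_contraction oU cU cf Ux0 ms0 eta0 eta1.
move=> [g_bd g_mono g_lip g_pos].
have [v [v0 mv v_decr v_lim v_grid]] := slope_grid ms0 g_bd g_mono g_lip g_pos.
exists fh; split; split=> //.
- move=> x Kx; apply: le_trans (fh_ge x (KU x Kx) (fK x Kx)); rewrite lerB //.
  have : 1 + 2 * s0 * enorm (x - x0) <= X.
    rewrite lerD2l ler_wpM2l ?mulr_ge0 //.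
    by apply: le_trans (HB x Kx) _; rewrite le_max lexx.
  by move=> /(ler_wpM2l (ltW eta0)); lra.
- move=> sigma sigma0.
  have mv' i : m <= v i by exact: ltW.
  have fhv i : cone_minorized U fh (v i) by exact: fh_cone.
  have [E [[CE cE E_le] [E_v E_m E_v0]]] :=
    smooth_levels oU cU Ux0 cfh m0 sigma0 mv' v_decr v_lim fhv.
  exists E; split; last first.
    move=> x Ux; have /andP[+ _] := E_le x Ux; rewrite v0 infconv_eq //.
      by rewrite -v0; exact: fhv.
    exact: fh_s0.
  split=> // [x Ux|x L Ux L0 fxL]; first by have /andP[] := E_le x Ux.
  (* Above s0 the global Lipschitz bound suffices. Between m and s0 the contraction outweighs the
     rounding up to the grid. The remaining value L = m, where there is no gain, is covered by the
     separate clause on slope m. *)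
  have [sL|Ls] := leP s0 L.
    by apply: slope_le_trans (E_v0 x Ux); rewrite v0.
  have [mL|Lm] := ltP m L.
    have [i [k [viL gv]]] := v_grid L mL Ls.
    apply: slope_le_trans viL _; apply: E_v => //.
    exact: slope_le_trans gv (fh_gain x L k Ux mL fxL).
  have Lm' : m <= L.
    apply: (min_slope_le L0); exact: slope_le_cone_minorized fxL.
  have mL : L = m by apply/eqP; rewrite eq_le Lm.
  by rewrite mL; apply: E_m => //; rewrite -mL; exact: fh_slope.
- move=> x L Ux mL fxL; have [k gk] := g_pos L mL.
  exists (L - g k L); split; last exact: fh_gain.
  by have /andP[_ H] := g_bd k L mL; apply/andP; split; lra.
- by move=> x y t Kx Ky Kz t01; apply: (fh_gap K) => // z Kz'; split; [exact: KU|exact: fK].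
Qed.

(** The seed [k] makes it possible to prescribe the germ of the approximation at a point, and
    thereby its strong convexity there. *)
Lemma smooth_approx_with (sigma : R) k : 0 < sigma ->
  smooth_minorant U f (slope_le U f) k ->
  exists g, [/\ smooth_minorant U f (slope_le U f) g,
    forall x, U x -> f x - sigma <= g x &
    forall p, U p -> (\forall y \near p, f y - sigma / 4 <= k y) ->
      \forall y \near p, g y = k y].
Proof.
move=> s0 kP; apply: (smooth_minorant_global oU cU s0 kP) => K s cK KU s_gt0.
have s2 : 0 < s / 2 by rewrite divr_gt0.
have [fh [[_ fhf f_fh H] _]] := compact_approx cK KU s2.
have [E [[CE cE Efh EQ] HE]] := H _ s2.
exists E; first by split=> // x Ux; exact: le_trans (Efh x Ux) (fhf x Ux).
by move=> x Kx; have := f_fh x Kx; have := HE x (KU x Kx); lra.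
Qed.

Lemma smooth_approx (sigma : R) : 0 < sigma ->
  exists g, smooth_minorant U f (slope_le U f) g /\ forall x, U x -> f x - sigma <= g x.
Proof.
move=> s0.
(* Here any smooth minorant with controlled slopes can be the seed; the empty compact set provides
   one. *)
have [fh [[_ fhf _ H] _]] := compact_approx (@compact0 _) (@sub0set _ U) s0.
have [E [[CE cE Efh EQ] _]] := H _ s0.
have [|g [gP gf _]] := smooth_approx_with s0 (k := E); last by exists g.
by split=> // x Ux; exact: le_trans (Efh x Ux) (fhf x Ux).
Qed.

End CompactApproximation.

(** * Smooth series *)

Lemma continuous_atP (R : realType) n (f : 'rV[R]_n -> R) (x : 'rV[R]_n) :
  {for x, continuous f} <->
  forall e : R, 0 < e -> \forall y \near x, `|f x - f y| <= e.
Proof. exact: (@cvgrPdist_le R R _ (nbhs x) _ f (f x)). Qed.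

(** * Mean value and Taylor estimates on the line *)

Section MeanValue.
Variable R : realType.

Lemma mvt_seg (f f' : R -> R) (t : R) :
  (forall u : R, `|u| <= `|t| -> is_derive u 1 f (f' u)) ->
  exists2 c, `|c| <= `|t| & f t - f 0 = f' c * t.
Proof.
move=> df.
have cont a b : `|a| <= `|t| -> `|b| <= `|t| -> {within `[a, b], continuous f}.
  move=> ar br; apply: derivable_within_continuous => u.
  rewrite in_itv /= => /andP[au ub].
  have ur : `|u| <= `|t|.
    by move: ar br; rewrite !ler_norml => /andP[? ?] /andP[? ?]; apply/andP; split; lra.
  by have [] := df u ur.
have r0 : `|0 : R| <= `|t| by rewrite normr0.
have [t0|t0] := leP 0 t.
  have [||c] := @MVT_segment R f f' 0 t t0.
  - move=> u; rewrite in_itv /= => /andP[u0 ut]; apply: df.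
    by rewrite !ger0_norm // ltW.
  - exact: cont.
  - rewrite in_itv /= => /andP[c0 ct] E; exists c; last by rewrite E subr0.
    by rewrite !ger0_norm.
have [||c] := @MVT_segment R f f' t 0 (ltW t0).
- move=> u; rewrite in_itv /= => /andP[ut u0]; apply: df.
  by rewrite !ler0_norm ?(ltW t0) ?(ltW u0) // lerN2 ltW.
- exact: cont.
- rewrite in_itv /= => /andP[tc c0] E; exists c; last by rewrite sub0r in E; lra.
  by rewrite !ler0_norm ?(ltW t0) // lerN2.
Qed.

Lemma taylor_quadratic (f f' f'' : R -> R) (r t B : R) : `|t| < r ->
  (forall u : R, `|u| < r -> is_derive u 1 f (f' u)) ->
  (forall u : R, `|u| < r -> is_derive u 1 f' (f'' u)) ->
  (forall u : R, `|u| < r -> `|f'' u| <= B) ->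
  `|f t - f 0 - t * f' 0| <= B * t ^+ 2.
Proof.
move=> tr df df' f''B; have ball (w : R) : `|w| < r -> forall u : R, `|u| <= `|w| -> `|u| < r.
  by move=> wr u uw; exact: le_lt_trans wr.
have [c ct E] := mvt_seg (fun u ut => df u (ball t tr u ut)).
have cr : `|c| < r by exact: le_lt_trans tr.
have [d dc E'] := mvt_seg (fun u ut => df' u (ball c cr u ut)).
have dr : `|d| < r by exact: le_lt_trans cr.
have -> : f t - f 0 - t * f' 0 = f'' d * c * t by rewrite E -E'; ring.
rewrite -mulrA normrM -(real_normK (num_real t)) expr2 normrM.
apply: ler_pM => //; first exact: f''B.
by rewrite ler_wpM2r.
Qed.

End MeanValue.

Section SmoothSeries.
Variables (R : realType) (n : nat) (U : set 'rV[R]_n).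
Hypothesis oU : open U.
Local Notation Rn := 'rV[R]_n.
Implicit Types (x y z : Rn) (e : nat -> Rn -> R) (S : Rn -> R) (s : seq 'I_n).

(** The constant and the neighbourhood may depend on the derivative [s] but not on the index [k].
    The condition passes to partial derivatives, which closes the induction on the order of
    smoothness. *)
Definition geometrically_bounded e := forall s x, U x ->
  exists C : R, \forall y \near x, forall k, `|iter_partial s (e k) y| <= C * 2^-1 ^+ k.

Definition sums_to e S := forall x, U x -> (\sum_(0 <= k < N) e k x) @[N --> \oo] --> S x.

Lemma geometric_tail (a : nat -> R) (C : R) N M : (N <= M)%N -> (forall k, `|a k| <= C * 2^-1 ^+ k) ->
  `|\sum_(0 <= k < M) a k - \sum_(0 <= k < N) a k| <= 2 * C * 2^-1 ^+ N.
Proof.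
move=> NM Ha.
have split_sum (c : nat -> R) : \sum_(0 <= k < M) c k =
    \sum_(0 <= k < N) c k + \sum_(N <= k < M) c k by rewrite (big_cat_nat (n := N)).
have -> : \sum_(0 <= k < M) a k - \sum_(0 <= k < N) a k = \sum_(N <= k < M) a k.
  by rewrite split_sum; ring.
apply: le_trans (ler_norm_sum _ _ _) _.
apply: (@le_trans _ _ (\sum_(N <= k < M) C * 2^-1 ^+ k)).
  by apply: ler_sum => k _; exact: Ha.
have C0 : 0 <= C by have := le_trans (normr_ge0 _) (Ha 0%N); rewrite expr0 mulr1.
rewrite -mulr_sumr (mulrC 2) -mulrA ler_wpM2l //.
have := split_sum (fun k => 2^-1 ^+ k).
rewrite !geometric_sum; have : 0 <= (2^-1 : R) ^+ M by rewrite exprn_ge0 // invr_ge0.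
lra.
Qed.

Lemma sums_to_exists e : geometrically_bounded e -> exists S, sums_to e S.
Proof.
move=> He.
suff H x : exists l : R, U x -> (\sum_(0 <= k < N) e k x) @[N --> \oo] --> l.
  by have [S HS] := choice H; exists S.
have [Ux|nUx] := pselect (U x); last by exists 0.
have [C /nbhs_singleton HC] := He [::] x Ux.
have [|l Hl _] := @is_mix_exists R (fun=> 1) 0 (e ^~ x) C.
  by move=> k; rewrite subr0 mul1r; exact: HC.
exists l => _; move: Hl; rewrite /is_mix.
suff -> : mix_partial (fun=> 1) 0 (e ^~ x) = (fun N => \sum_(0 <= k < N) e k x) by [].
apply/funext => N; rewrite /mix_partial add0r; apply: eq_bigr => k _.
by rewrite subr0 mul1r.
Qed.

Lemma sums_to_tail e S x (C : R) N : U x -> sums_to e S -> (forall k, `|e k x| <= C * 2^-1 ^+ k) ->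
  `|S x - \sum_(0 <= k < N) e k x| <= 2 * C * 2^-1 ^+ N.
Proof.
move=> Ux HS HC; set P := \sum_(0 <= k < N) e k x.
have H : `|\sum_(0 <= k < M) e k x - P| @[M --> \oo] --> `|S x - P|.
  by apply: cvg_norm; apply: cvgB; [exact: HS|exact: cvg_cst].
apply: (ler_cvg_to H (cvg_cst _)); exists N => // M /= NM.
exact: geometric_tail.
Qed.

Lemma sums_to_continuous e S x : (forall k, C_infty_on U (e k)) ->
  geometrically_bounded e -> sums_to e S -> U x -> {for x, continuous S}.
Proof.
move=> Ce He HS Ux; apply/continuous_atP => eps eps0.
have [C HC] := He [::] x Ux.
have C0 : 0 <= C.
  by have := le_trans (normr_ge0 _) (nbhs_singleton HC 0%N); rewrite expr0 mulr1.
have [N HN] : exists N, 2 * C * 2^-1 ^+ N <= eps / 3.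
  have : geometric (2 * C) (2^-1 : R) N @[N --> \oo] --> 0.
    by apply: cvg_geometric; rewrite ger0_norm ?invr_ge0 // invf_lt1 // ltr1n.
  move=> /cvgrPdist_le /(_ (eps / 3)) [|N _ /(_ N (leqnn N))]; first by rewrite divr_gt0.
  rewrite /geometric /= sub0r normrN => H; exists N.
  exact: le_trans (ler_norm _) H.
have cP : {for x, continuous (fun y => \sum_(0 <= k < N) e k y)}.
  have : forall k, Ck U 0 (e k) by move=> k; exact: (C_inftyP U (e k)).1.
  move=> C0k; have : Ck U 0 (fun y => \sum_(j < N) e j y) by exact: Ck_sum.
  move=> /Ck_continuous /(_ Ux).
  suff -> : (fun y => \sum_(0 <= k < N) e k y) = (fun y => \sum_(j < N) e j y) by [].
  by apply/funext => y; rewrite big_mkord.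
have e3 : 0 < eps / 3 by rewrite divr_gt0.
have {}cP := (continuous_atP _ _).1 cP _ e3.
have T1 := sums_to_tail N Ux HS (nbhs_singleton HC).
apply: filterS3 cP HC (near_open oU Ux) => y cPy HCy Uy.
have T2 := sums_to_tail N Uy HS HCy.
move: T1 T2 cPy; set P := \sum_(0 <= k < N) e k x; set P' := \sum_(0 <= k < N) e k y.
rewrite !ler_norml => /andP[? ?] /andP[? ?] /andP[? ?]; apply/andP; split; lra.
Qed.

(** The second derivatives give each term a Taylor remainder at most C t^2 2^-k; the remainders add
    up to 2 C t^2, and a quadratic remainder yields the derivative of the sum. *)
Lemma sums_to_is_derive e S S' x i : (forall k, C_infty_on U (e k)) ->
  geometrically_bounded e -> sums_to e S -> sums_to (fun k => partial i (e k)) S' ->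
  U x -> is_derive x (delta_mx 0 i) S (S' x).
Proof.
move=> Ce He HS HS' Ux.
have [C HC] := He [:: i; i] x Ux.
have HCU : nbhs x [set y | (forall k, `|iter_partial [:: i; i] (e k) y| <= C * 2^-1 ^+ k) /\ U y].
  by apply: filterS2 HC (near_open oU Ux) => y.
have [r r0 HrC] := (nbhs_enormP x _).1 HCU.
pose v : Rn := delta_mx 0 i.
have v1 : enorm v = 1.
  rewrite enormE /dot (bigD1 i) //= big1 ?addr0 => [|j ij].
    by rewrite !mxE !eqxx mul1r sqrtr1.
  by rewrite !mxE eqxx /= (negbTE ij) mul0r.
have line u : `|u| < r -> U (x + u *: v).
  move=> ur; have [|_ //] := HrC (x + u *: v).
  by rewrite addrC addKr enormZ v1 mulr1.
have Cpartial j k : C_infty_on U (iter_partial (nseq j i) (e k)).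
  elim: j => [|j IH] /=; first exact: Ce.
  by apply/C_inftyP => l; have /C_inftyP/(_ l.+1) := IH; exact: Ck_partial.
have dline j k (u : R) : `|u| < r -> is_derive u 1
    (fun w => iter_partial (nseq j i) (e k) (x + w *: v))
    (iter_partial (nseq j.+1 i) (e k) (x + u *: v)).
  move=> /line Uu; apply: (is_derive_line (iter_partial (nseq j i) (e k)) x v u _).1.
  have /C_inftyP/(_ 1%N) C1 := Cpartial j k.
  exact: Ck_is_derive C1 Uu.
have Tk k t : `|t| < r ->
    `|e k (x + t *: v) - e k x - t * partial i (e k) x| <= C * t ^+ 2 * 2^-1 ^+ k.
  move=> tr; have := taylor_quadratic tr (dline 0%N k) (dline 1%N k) (B := C * 2^-1 ^+ k).
  rewrite /= scale0r addr0 mulrAC; apply.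
  move=> u ur; have [|HCu _] := HrC (x + u *: v); last exact: HCu.
  by rewrite addrC addKr enormZ v1 mulr1.
apply: (@is_derive_quadratic _ _ _ _ _ _ (2 * C) r r0) => t tr.
rewrite (addrC (t *: _) x).
have Ut := line t tr.
pose d k y := e k (x + t *: v) - e k x - t * partial i (e k) x.
have H1 : sums_to (fun k _ => d k x) (fun=> S (x + t *: v) - S x - t * S' x).
  move=> y _.
  suff : (fun N => \sum_(0 <= k < N) d k x) =
    (fun N => \sum_(0 <= k < N) e k (x + t *: v) - \sum_(0 <= k < N) e k x
              - t * \sum_(0 <= k < N) partial i (e k) x).
    by move=> ->; exact: cvgB (cvgB (HS _ Ut) (HS _ Ux)) (cvgM (cvg_cst t) (HS' _ Ux)).
  apply/funext => N; rewrite mulr_sumr -!sumrB; exact: eq_bigr.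
have := sums_to_tail 0 Ux H1 (fun k => Tk k t tr).
by rewrite big_nil subr0 expr0 mulr1 mulrA.
Qed.

Lemma sums_to_Ck k e S : (forall k, C_infty_on U (e k)) ->
  geometrically_bounded e -> sums_to e S -> Ck U k S.
Proof.
elim: k e S => [|k IH] e S Ce He HS.
  by split => // x; exact: sums_to_continuous HS.
have He' i : geometrically_bounded (fun k => partial i (e k)).
  move=> s x Ux; have [C HC] := He (rcons s i) x Ux; exists C.
  by apply: filterS HC => y HC j; rewrite -iter_partial_rcons.
have Ce' i j : C_infty_on U (partial i (e j)).
  by apply/C_inftyP => l; have /C_inftyP/(_ l.+1) := Ce j; exact: Ck_partial.
have [S' HS'] := choice (fun i => sums_to_exists (He' i)).
apply: (@CkP _ _ _ oU _ _ S') => [x Ux|x i Ux|i].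
- exact: sums_to_continuous HS Ux.
- exact: sums_to_is_derive HS (HS' i) Ux.
- exact: IH (Ce' i) (He' i) (HS' i).
Qed.

Lemma exhaust_mono r r' : (r <= r')%N -> @exhaust R n U r `<=` exhaust U r'.
Proof.
move=> rr' x [xr HU]; split; first by apply: le_trans xr _; rewrite ler_nat.
move=> y yx; apply: HU; apply: lt_le_trans yx _.
by rewrite lef_pV2 ?posrE // ler_nat.
Qed.

Lemma iter_partial_bound (d : Rn -> R) r k : C_infty_on U d ->
  exists2 M : R, 0 <= M & forall s y, (size s <= k)%N -> exhaust U r y -> `|iter_partial s d y| <= M.
Proof.
elim: k d => [|k IH] d Cd.
  have cd x : U x -> {for x, continuous d} by move=> Ux; have [] := Cd [::] x Ux.
  suff [M M0 HM] : exists2 M : R, 0 <= M & forall y, exhaust U r y -> `|d y| <= M.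
    by exists M => // -[|//] y _; exact: HM.
  apply: (compact_set_ind (P := fun K => exists2 M : R, 0 <= M & forall y, K y -> `|d y| <= M)
    (compact_exhaust (r := r))).
  - by exists 0.
  - move=> A B [M M0 HA] [M' M'0 HB]; exists (M + M'); first exact: addr_ge0.
    by move=> y [/HA|/HB] /le_trans; apply; rewrite ?lerDl ?lerDr.
  - by move=> A B AB [M M0 HB]; exists M => // y /AB; exact: HB.
  - move=> x /exhaust_sub /cd /continuous_atP /(_ 1 ltr01) H.
    exists [set y | `|d x - d y| <= 1] => //; exists (`|d x| + 1); first exact: addr_ge0.
    by move=> y /= H1; have := ler_normB (d x) (d x - d y); rewrite opprB addrC subrK; lra.
have Cd' i : C_infty_on U (partial i d).
  by apply/C_inftyP => l; have /C_inftyP/(_ l.+1) := Cd; exact: Ck_partial.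
have [M0 M00 HM0] := IH d Cd.
have HM i : exists M : R, 0 <= M /\ forall s y, (size s <= k)%N -> exhaust U r y ->
    `|iter_partial s (partial i d) y| <= M.
  by have [M ? ?] := IH _ (Cd' i); exists M.
have [M HMi] := choice HM.
exists (M0 + \sum_i M i); first by rewrite addr_ge0 // sumr_ge0 // => i _; have [] := HMi i.
have S0 : 0 <= \sum_i M i by apply: sumr_ge0 => i _; have [] := HMi i.
elim/last_ind => [|s i _] y sk Ky.
  by apply: le_trans (HM0 [::] y _ Ky) _; rewrite ?lerDl.
rewrite size_rcons ltnS in sk; rewrite iter_partial_rcons.
have [_ H] := HMi i; apply: le_trans (H s y sk Ky) _.
rewrite (bigD1 i) //= addrCA lerDl addr_ge0 // sumr_ge0 // => j _.
by have [] := HMi j.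
Qed.

(* On the k-th set of the exhaustion, the weight w_k compensates the derivatives of
   h_k - h_0 up to order k. *)
Lemma smooth_mixture (h0 : Rn -> R) (h : nat -> Rn -> R) : C_infty_on U h0 ->
  (forall k, C_infty_on U (h k)) ->
  exists w g, [/\ C_infty_on U g, forall k, 0 < w k,
    forall N, \sum_(0 <= k < N) w k <= 1 &
    forall x, U x -> is_mix w (h0 x) (h ^~ x) (g x)].
Proof.
move=> Ch0 Ch; pose d k x := h k x + (-1) * h0 x.
have Cd k : C_infty_on U (d k) by apply: (C_inftyD oU (Ch k)); exact: C_inftyZ.
have HM k : exists M : R, 0 <= M /\ forall s y, (size s <= k)%N -> exhaust U k y ->
    `|iter_partial s (d k) y| <= M.
  by have [M ? ?] := iter_partial_bound k k (Cd k); exists M.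
have [M MP] := choice HM.
pose w k := 2^-1 ^+ k.+1 / (1 + M k).
have M1 k : 0 < 1 + M k by have [? _] := MP k; rewrite ltr_pwDl.
have q0 k : 0 < (2^-1 : R) ^+ k by rewrite exprn_gt0 // invr_gt0.
have w0 k : 0 < w k by rewrite divr_gt0.
have wE k : w k * (1 + M k) = 2^-1 ^+ k / 2 by rewrite /w divfK ?gt_eqF // exprS mulrC.
have wM k : w k * M k <= 2^-1 ^+ k.
  by have := wE k; have := w0 k; have := q0 k; lra.
have w_sum N : \sum_(0 <= k < N) w k <= 1.
  apply: (@le_trans _ _ (\sum_(0 <= k < N) 2^-1 ^+ k / 2)).
    apply: ler_sum => k _; have [? _] := MP k.
    by have := wE k; have := w0 k; nra.
  by rewrite -mulr_suml geometric_sum; have := q0 N; lra.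
pose e k x := w k * d k x.
have Ce k : C_infty_on U (e k) by exact: C_inftyZ.
have eE s k y : U y -> iter_partial s (e k) y = w k * iter_partial s (d k) y.
  elim: s y => [//|i s IH] y Uy /=.
  have Hn : \forall z \near y, iter_partial s (e k) z = w k * iter_partial s (d k) z.
    by apply: filterS (near_open oU Uy) => z Uz; exact: IH.
  rewrite {1}/partial (near_eq_derive _ Hn).
  by have [_ D] := Cd k s y Uy; rewrite (deriveZ _ (D i)).
have He : geometrically_bounded e.
  move=> s x Ux; have [r Hr] := exhaust_near oU Ux.
  (* For k >= K the k-th compact set contains the r-th and the order k covers the length of [s]; the
     finitely many smaller k only enlarge the constant. *)
  pose K := maxn r (size s).
  have small k : (K <= k)%N -> forall y, exhaust U r y -> `|iter_partial s (e k) y| <= 2^-1 ^+ k.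
    rewrite geq_max => /andP[rk sk] y Hy.
    have Hy' := exhaust_mono rk Hy.
    have [_ /(_ s y sk Hy') H] := MP k.
    rewrite (eE s k y (exhaust_sub Hy)) normrM gtr0_norm //; apply: le_trans (wM k).
    by rewrite ler_wpM2l // ltW.
  have big k : exists C : R, 0 <= C /\ forall y, exhaust U r y -> `|iter_partial s (e k) y| <= C * 2^-1 ^+ k.
    have [C C0 HC] := iter_partial_bound r (size s) (Ce k).
    exists (C / 2^-1 ^+ k); split; first by rewrite divr_ge0 // ltW.
    by move=> y Hy; rewrite divfK ?gt_eqF //; exact: HC.
  have [C CP] := choice big.
  have SC0 : 0 <= \sum_(j < K) C j by apply: sumr_ge0 => j _; have [] := CP j.
  exists (1 + \sum_(j < K) C j); apply: filterS Hr => y Hy k.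
  have [Kk|kK] := leqP K k.
    apply: le_trans (small k Kk y Hy) _; rewrite mulrDl mul1r lerDl.
    by rewrite mulr_ge0 // ltW.
  have [_ H] := CP k; apply: le_trans (H y Hy) _.
  rewrite ler_wpM2r ?(ltW (q0 k)) //.
  rewrite (bigD1 (Ordinal kK)) //= addrCA lerDl addr_ge0 // sumr_ge0 // => j _.
  by have [] := CP j.
have [S HS] := sums_to_exists He.
exists w, (fun x => h0 x + S x); split => //.
  apply: (C_inftyD oU Ch0); apply/C_inftyP => k; exact: sums_to_Ck HS.
move=> x Ux; apply: (cvgD (cvg_cst (h0 x))).
have := HS x Ux; rewrite /e /d.
suff -> : (fun N => \sum_(0 <= k < N) w k * (h k x + -1 * h0 x)) =
  (fun N => \sum_(0 <= k < N) w k * (h k x - h0 x)) by [].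
by apply/funext => N; apply: eq_bigr => k _; rewrite mulN1r.
Qed.

End SmoothSeries.

(** * Second-order bounds *)

Section SecondOrder.
Variables (R : realType) (n : nat) (U : set 'rV[R]_n).
Hypothesis oU : open U.
Local Notation Rn := 'rV[R]_n.
Implicit Types (x y z v p : Rn) (h phi : Rn -> R).

Let e i : Rn := delta_mx 0 i.

Lemma enorm_delta i : enorm (e i) = 1.
Proof.
rewrite enormE /dot (bigD1 i) //= big1 ?addr0 => [|j ij].
  by rewrite !mxE !eqxx mul1r sqrtr1.
by rewrite !mxE eqxx /= (negbTE ij) mul0r.
Qed.

Let head v k : Rn := \row_(i < n) (if (i < k)%N then v 0 i else 0).

Let head_le v k : enorm (head v k) <= enorm v.
Proof.
apply: ler_wsqrtr; apply: ler_sum => i _; rewrite mxE.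
by case: ifP => // _; rewrite expr0n sqr_ge0.
Qed.

Let headS v k (kn : (k < n)%N) : head v k.+1 = head v k + v 0 (Ordinal kn) *: e (Ordinal kn).
Proof.
apply/rowP => i; rewrite !mxE eqxx /= ltnS leq_eqVlt.
have [->|ik] := eqVneq i (Ordinal kn); first by rewrite eqxx ltnn mulr1 add0r.
rewrite (_ : (i : nat) == k = false) ?mulr0 ?addr0 //.
by apply/negbTE; apply: contraNneq ik => ik; apply/eqP/val_inj.
Qed.

Let add3K x v z : x + v + z - x = v + z.
Proof. by apply/rowP => i; rewrite !mxE; ring. Qed.

(* Change the coordinates of v one at a time. *)
Lemma is_derive_dir h z v : Ck U 1 h -> U z ->
  is_derive z v h (\sum_(i < n) v 0 i * partial i h z).
Proof.
move=> Ch Uz; apply/is_derive_cvgP; apply/cvgrPdist_le => eps eps0.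
have [r r0 rU] := open_enorm oU Uz.
have N0 : 0 < enorm v + 1 by rewrite ltr_wpDl ?enorm_ge0.
have key k : (k <= n)%N -> forall eta : R, 0 < eta -> exists2 d, 0 < d & forall t : R, `|t| < d ->
    `|h (z + t *: head v k) - h z - t * \sum_(i < n | (i < k)%N) v 0 i * partial i h z|
      <= eta * `|t|.
  elim: k => [_ eta eta0|k IH kn eta eta0].
    exists 1 => // t _; rewrite big1 // mulr0 subr0.
    rewrite (_ : head v 0 = 0) ?scaler0 ?addr0 ?subrr ?normr0 ?mulr_ge0 ?(ltW eta0) //.
    by apply/rowP => i; rewrite !mxE.
  have eta2 : 0 < eta / 2 by rewrite divr_gt0.
  have [d1 d10 Hd1] := IH (ltnW kn) _ eta2.
  pose k' := Ordinal kn; pose a := v 0 k'.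
  have a1 : 0 < `|a| + 1 by rewrite ltr_wpDl.
  have cont : {for z, continuous (partial k' h)}.
    exact: Ck_continuous (Ck_partial k' Ch) Uz.
  have eta3 : 0 < eta / 2 / (`|a| + 1) by rewrite divr_gt0.
  have /nbhs_enormP[d2 d20 Hd2] := (continuous_atP _ _).1 cont _ eta3.
  pose d := Num.min d1 (Num.min r d2 / (2 * (enorm v + 1))).
  have m0 : 0 < Num.min r d2 by rewrite lt_min r0.
  exists d; first by rewrite lt_min d10 divr_gt0 // mulr_gt0.
  move=> t; rewrite lt_min => /andP[td1]; rewrite ltr_pdivlMr ?mulr_gt0 // => td2.
  have tv (w : Rn) : enorm w <= enorm v -> enorm (t *: w) * 2 < Num.min r d2.
    move=> wv; apply: le_lt_trans td2; rewrite enormZ -mulrA ler_wpM2l // mulrC.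
    by rewrite ler_wpM2l //; lra.
  have small c : `|c| <= `|t * a| -> enorm (t *: head v k + c *: e k') < Num.min r d2.
    move=> ca; apply: le_lt_trans (enormD _ _) _.
    have := tv _ (head_le v k); have := tv v (lexx _).
    have : enorm (c *: e k') <= enorm (t *: v).
      rewrite (enormZ c (e k')) enorm_delta mulr1; apply: le_trans ca _.
      by rewrite normrM enormZ ler_wpM2l // coord_le_enorm.
    lra.
  pose rho := `|t * a| + 1.
  pose z' := z + t *: head v k.
  have Uline c : `|c| <= `|t * a| -> U (z' + c *: e k').
    move=> ca; apply: rU; rewrite /z' add3K.
    by apply: lt_le_trans (small c ca) _; rewrite ge_min lexx.
  have [c ca E] : exists2 c, `|c| <= `|t * a| &
      h (z' + (t * a) *: e k') - h z' = partial k' h (z' + c *: e k') * (t * a).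
    have dline (u : R) : `|u| <= `|t * a| ->
        is_derive u 1 (fun w => h (z' + w *: e k')) (partial k' h (z' + u *: e k')).
      move=> /Uline Uu; apply: (is_derive_line h z' (e k') u _).1.
      exact: Ck_is_derive Ch Uu.
    have := @mvt_seg R (fun w => h (z' + w *: e k')) (fun w => partial k' h (z' + w *: e k')) (t * a) dline.
    by rewrite scale0r addr0.
  have -> : z + t *: head v k.+1 = z' + (t * a) *: e k'.
    by rewrite headS /z' scalerDr scalerA addrA.
  have -> : \sum_(i < n | (i < k.+1)%N) v 0 i * partial i h z =
      \sum_(i < n | (i < k)%N) v 0 i * partial i h z + a * partial k' h z.
    rewrite (bigD1 k') //= addrC; congr (_ + _); apply: eq_bigl => i.
    rewrite ltnS leq_eqVlt; have [->|ik] := eqVneq i k'; first by rewrite andbF ltnn.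
    rewrite andbT (_ : (i : nat) == k = false) //.
    by apply/negbTE; apply: contraNneq ik => ik; apply/eqP/val_inj.
  have H1 := Hd1 t td1.
  have H2 : `|partial k' h (z' + c *: e k') - partial k' h z| <= eta / 2 / (`|a| + 1).
    rewrite distrC; apply: Hd2; rewrite /z' add3K.
    by apply: lt_le_trans (small c ca) _; rewrite ge_min lexx orbT.
  have H3 : `|t * a * (partial k' h (z' + c *: e k') - partial k' h z)| <= eta / 2 * `|t|.
    rewrite normrM normrM -mulrA mulrC ler_wpM2r //.
    apply: (@le_trans _ _ ((`|a| + 1) * (eta / 2 / (`|a| + 1)))).
      by apply: ler_pM => //; rewrite lerDl.
    by rewrite mulrC divfK // gt_eqF.
  have -> : h (z' + (t * a) *: e k') - h z - t * (\sum_(i < n | (i < k)%N) v 0 i * partial i h z +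
     a * partial k' h z) = (h z' - h z - t * \sum_(i < n | (i < k)%N) v 0 i * partial i h z) +
     t * a * (partial k' h (z' + c *: e k') - partial k' h z).
    have -> : h (z' + (t * a) *: e k') = h z' + partial k' h (z' + c *: e k') * (t * a).
      by rewrite -E; ring.
    ring.
  apply: le_trans (ler_normD _ _) _.
  by move: H1 H3; rewrite -/z'; lra.
have [d d0 Hd] := key n (leqnn n) eps eps0.
have headn : head v n = v by apply/rowP => i; rewrite mxE ltn_ord.
near=> t.
have tn0 : t != 0 by near: t; exact: nbhs_dnbhs_neq.
have td : `|t| < d by near: t; apply: dnbhs0_lt.
have := Hd t td; rewrite headn (eq_bigl xpredT) => [|i]; last exact: ltn_ord.
set S := \sum_(i < n) _ => H.
have -> : S - t^-1 * (h (z + t *: v) - h z) = - (t^-1 * (h (z + t *: v) - h z - t * S)).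
  by field.
rewrite normrN normrM normfV ler_pdivrMl ?normr_gt0 //.
by move: H; lra.
Unshelve. all: by end_near. Qed.

Lemma gap_line h x y (t : R) : gap h x y t =
  (1 - t) * h x + t * h (x + 1 *: (y - x)) - h (x + t *: (y - x)).
Proof.
have xy : x + 1 *: (y - x) = y by rewrite scale1r addrC subrK.
by rewrite /gap combE xy.
Qed.

(** Two mean values, on either side of the intermediate point, write the gap as t(1-t) times a
    difference of directional derivatives; a third one bounds this difference by second
    derivatives. *)
Lemma gap_C_infty_le phi p : C_infty_on U phi -> U p ->
  exists M r : R, [/\ 0 <= M, 0 < r, forall x, enorm (x - p) < r -> U x &
    forall x y t, enorm (x - p) < r -> enorm (y - p) < r -> 0 <= t <= 1 ->
      gap phi x y t <= M * (t * (1 - t) * dot (x - y) (x - y))].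
Proof.
move=> Cphi Up.
have [k Hk] := exhaust_near oU Up.
have [M M0 HM] := iter_partial_bound k 2 Cphi.
have /nbhs_enormP[r r0 Hr] := Hk.
have n0 : 0 <= n%:R :> R by [].
have sum_le v (a : 'I_n -> R) (C : R) : 0 <= C -> (forall i, `|a i| <= C) ->
    `|\sum_(i < n) v 0 i * a i| <= n%:R * (enorm v * C).
  move=> C0 aC; apply: le_trans (ler_norm_sum _ _ _) _.
  apply: (@le_trans _ _ (\sum_(i < n) enorm v * C)).
    by apply: ler_sum => i _; rewrite normrM; apply: ler_pM => //; exact: coord_le_enorm.
  by rewrite sumr_const card_ord mulr_natl.
have Cp i : Ck U 1 (partial i phi) by have /C_inftyP/(_ 2%N) := Cphi; exact: Ck_partial.
have C1 : Ck U 1 phi by have /C_inftyP := Cphi.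
(* With |x - p| < r/7 and |v| < 2r/7, the points x + u v with |u| <= 3 stay within r of p. The range
   3 is ample for the intermediate parameters, at most 1 plus a displacement at most 2. *)
exists (2 * (n%:R * (n%:R * M))), (r / 7); split.
- by rewrite !mulr_ge0.
- by rewrite divr_gt0.
- by move=> x xr; apply: (exhaust_sub (r := k)); apply: Hr; lra.
move=> x y t xr yr /andP[t0 t1].
pose v := y - x.
have v7 : enorm v < 2 * (r / 7).
  have := enormD (y - p) (p - x); rewrite addrA subrK (enormB p) -/v; lra.
have inball (u : R) : `|u| <= 3 -> exhaust U k (x + u *: v).
  move=> u3; apply: Hr; rewrite addrAC; apply: le_lt_trans (enormD _ _) _.
  rewrite enormZ; have : `|u| * enorm v <= 3 * enorm v by rewrite ler_wpM2r ?enorm_ge0.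
  lra.
have Uline (u : R) : `|u| <= 3 -> U (x + u *: v) by move=> /inball /exhaust_sub.
have mvt h b d : Ck U 1 h -> `|b| + `|d| <= 3 -> exists2 c, `|c| <= `|d| &
    h (x + (b + d) *: v) - h (x + b *: v) =
    (\sum_(i < n) v 0 i * partial i h (x + (b + c) *: v)) * d.
  move=> Ch bd.
  have := @mvt_seg R (fun u => h (x + b *: v + u *: v))
    (fun u => \sum_(i < n) v 0 i * partial i h (x + b *: v + u *: v)) d.
  have E (u : R) : x + b *: v + u *: v = x + (b + u) *: v by rewrite -addrA scalerDl.
  case=> [u ud|c cd H].
    apply: (is_derive_line h (x + b *: v) v u _).1; apply: is_derive_dir => //.
    by rewrite E; apply: Uline; apply: le_trans (ler_normD _ _) _; lra.
  exists c => //; move: H; rewrite scale0r addr0 E => ->.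
  by congr (_ * _); apply: eq_bigr => i _; rewrite E.
have N1 (c d : R) : `|c| <= `|d| -> 0 <= d -> - d <= c <= d.
  by move=> + d0; rewrite (ger0_norm d0) ler_norml.
have [|c1 c1t E1] := mvt phi 0 t C1; first by rewrite normr0 ger0_norm //; lra.
have [|c2 c2t E2] := mvt phi t (1 - t) C1.
  by rewrite !ger0_norm //; lra.
have /andP[c1a c1b] := N1 _ _ c1t t0.
have t1' : 0 <= 1 - t by lra.
have /andP[c2a c2b] := N1 _ _ c2t t1'.
rewrite !add0r scale0r addr0 in E1.
have E3 : t + (1 - t) = 1 by ring.
rewrite E3 in E2.
set P1 := \sum_(i < n) _ in E1; set P2 := \sum_(i < n) _ in E2.
have -> : gap phi x y t = t * (1 - t) * (P2 - P1).
  rewrite gap_line -/v.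
  have -> : phi (x + 1 *: v) = phi (x + t *: v) + P2 * (1 - t) by rewrite -E2; ring.
  have -> : phi (x + t *: v) = phi x + P1 * t by rewrite -E1; ring.
  ring.
rewrite [leRHS]mulrCA ler_wpM2l ?mulr_ge0 //.
have vE : dot (x - y) (x - y) = enorm v * enorm v.
  by rewrite -expr2 enorm_sqr /v -(opprB x y) dotNr dotC dotNr opprK.
rewrite vE.
pose d := t + c2 - c1.
have d2 : `|d| <= 2 by rewrite /d ler_norml; apply/andP; split; lra.
have -> : P2 - P1 = \sum_(i < n) v 0 i *
    (partial i phi (x + (c1 + d) *: v) - partial i phi (x + c1 *: v)).
  rewrite /P1 /P2 -sumrB; apply: eq_bigr => i _.
  by rewrite /d (addrC c1) subrK mulrBr.
apply: le_trans (ler_norm _) _.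
apply: le_trans (sum_le v _ (2 * (n%:R * (enorm v * M))) _ _) _.
- by rewrite !mulr_ge0 ?enorm_ge0.
- move=> i; have [|c cd ->] := mvt _ c1 d (Cp i).
    have : `|c1| <= 1 by rewrite ler_norml; apply/andP; split; lra.
    by have := d2; lra.
  rewrite normrM mulrC; apply: ler_pM => //.
  apply: sum_le => // j; apply: (HM [:: j; i]) => //; apply: inball.
  apply: le_trans (ler_normD _ _) _.
  have : `|c1| <= 1 by rewrite ler_norml; apply/andP; split; lra.
  by have := d2; lra.
- have -> : n%:R * (enorm v * (2 * (n%:R * (enorm v * M)))) =
     2 * (n%:R * (n%:R * M)) * (enorm v * enorm v) by ring.
  by [].
Qed.

End SecondOrder.

(** * Strong convexity *)

Section Hyperbola.
Variable R : realType.
Implicit Types t u w : R.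

Definition hyp t : R := Num.sqrt (1 + t ^+ 2).

Lemma hyp_arg_gt0 t : 0 < 1 + t ^+ 2.
Proof. by rewrite ltr_pwDl // sqr_ge0. Qed.

Lemma hyp_gt0 t : 0 < hyp t.
Proof. by rewrite sqrtr_gt0 hyp_arg_gt0. Qed.

Lemma hyp_sqr t : hyp t ^+ 2 = 1 + t ^+ 2.
Proof. by rewrite sqr_sqrtr // ltW // hyp_arg_gt0. Qed.

Lemma hyp_ge1 t : 1 <= hyp t.
Proof. by have := hyp_sqr t; have := hyp_gt0 t; have := sqr_ge0 t; nra. Qed.

Lemma is_derive_hyp t : is_derive t 1 hyp (t / hyp t).
Proof.
have dq : is_derive t 1 (fun u => 1 + u ^+ 2) (2 * t).
  apply: (@is_derive_quadratic _ _ _ _ _ _ 1 1) => // u _.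
  rewrite /GRing.scale /= mulr1 mul1r -(ger0_norm (sqr_ge0 u)).
  have -> : 1 + (u + t) ^+ 2 - (1 + t ^+ 2) - u * (2 * t) = u ^+ 2 by ring.
  by [].
have ds := is_derive1_sqrt (hyp_arg_gt0 t).
apply: (is_derive_eq (@is_derive1_comp _ Num.sqrt (fun u => 1 + u ^+ 2) t _ _ ds dq)).
by rewrite -/(hyp t); field; rewrite gt_eqF // hyp_gt0.
Qed.

Lemma smooth1_hyp : smooth1 hyp.
Proof.
elim=> [//|k IH]; apply: (differentiable_uptoP is_derive_hyp).
apply: differentiable_uptoM; first exact: differentiable_upto_id.
by apply: differentiable_uptoV => // x; rewrite gt_eqF // hyp_gt0.
Qed.

Lemma hyp_le_sqr t : hyp t <= 1 + t ^+ 2 / 2.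
Proof.
have := hyp_sqr t; have := hyp_gt0 t; have := sqr_ge0 t.
set a := t ^+ 2; set b := hyp t; nra.
Qed.

Lemma hyp_le_norm t : hyp t <= 1 + `|t|.
Proof.
have := hyp_sqr t; have := hyp_gt0 t; rewrite -(real_normK (num_real t)).
have := normr_ge0 t; set a := `|t|; set b := hyp t; nra.
Qed.

Lemma hyp_tangentE w t : hyp t - hyp w - w / hyp w * (t - w) =
  (hyp w * hyp t - (1 + w * t)) / hyp w.
Proof.
have w0 := hyp_gt0 w; have := hyp_sqr w; set a := hyp w in w0 *; set b := hyp t => H.
have -> : (a * b - (1 + w * t)) / a = (a * b - (1 + w ^+ 2) - w * (t - w)) / a.
  by congr (_ / a); ring.
by rewrite -H; field; rewrite gt_eqF.
Qed.

(** Lagrange's identity for the vectors (1, w) and (1, t); the tangent inequality is then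
    Cauchy-Schwarz, with (t - w)^2 measuring its excess. *)
Lemma hyp_mulE w t : (hyp w * hyp t) ^+ 2 = (1 + w * t) ^+ 2 + (t - w) ^+ 2.
Proof. by rewrite exprMn !hyp_sqr; ring. Qed.

Lemma hyp_tangent w t : hyp w + w / hyp w * (t - w) <= hyp t.
Proof.
rewrite -subr_ge0 opprD addrA hyp_tangentE divr_ge0 ?(ltW (hyp_gt0 w)) //.
have := hyp_mulE w t; have := mulr_gt0 (hyp_gt0 w) (hyp_gt0 t); have := sqr_ge0 (t - w).
set a := hyp w * hyp t; set b := 1 + w * t; set c := _ ^+ 2 => c0 a0 E.
have [b0|b0] := leP b 0; first lra.
nra.
Qed.

(** On [-1, 1], [hyp] is at most 2, so a = hyp w hyp t is at most 4 and b = 1 + w t at most 2. Thus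
    (t - w)^2 = (a - b)(a + b) <= 6 (a - b), and dividing by [hyp w] costs another factor 2: hence
    12. *)
Lemma hyp_tangent_strong w t : `|w| <= 1 -> `|t| <= 1 ->
  hyp w + w / hyp w * (t - w) + (t - w) ^+ 2 / 12 <= hyp t.
Proof.
rewrite !ler_norml => /andP[w1 w2] /andP[t1 t2].
suff : (t - w) ^+ 2 / 12 <= hyp t - hyp w - w / hyp w * (t - w) by lra.
rewrite hyp_tangentE ler_pdivlMr ?hyp_gt0 //.
have hb u : -1 <= u -> u <= 1 -> hyp u <= 2.
  by move=> u1 u2; have := hyp_sqr u; have := hyp_gt0 u; nra.
have wb := hb w w1 w2; have tb := hb t t1 t2.
have w0 := hyp_gt0 w; have t0 := hyp_gt0 t.
have E := hyp_mulE w t.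
have P4 : hyp w * hyp t <= 4 by nra.
have P0 := mulr_gt0 w0 t0.
have B2 : 1 + w * t <= 2 by nra.
have B0 : 0 <= 1 + w * t by nra.
move: E P4 P0 B2 B0; have := sqr_ge0 (t - w).
set c := (t - w) ^+ 2; set b := 1 + w * t; set a := hyp w * hyp t => c0 E P4 P0 B2 B0.
have ab : 0 <= a - b by nra.
have cE : c = (a - b) * (a + b) by move: E; rewrite !expr2; lra.
have H6 : c <= 6 * (a - b) by rewrite cE; nra.
by apply: (@le_trans _ _ (c / 12 * 2)); [nra|lra].
Qed.

End Hyperbola.

(** * A strongly convex function of linear growth *)

Section Bowl.
Variables (R : realType) (n : nat).
Local Notation Rn := 'rV[R]_n.
Implicit Types (x y z p : Rn).

(** Quadratic near [p] but only linear far away, so that a small multiple stays below the growth of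
    a strongly convex function above its tangent, which may be no more than linear at infinity. *)
Definition bowl p x : R := \sum_(i < n) (hyp (x 0 i - p 0 i) - 1).

Lemma C_infty_bowl (U : set Rn) p : open U -> C_infty_on U (bowl p).
Proof.
move=> oU; apply/C_inftyP => k; apply: Ck_sum => // i.
apply: CkD => //; last exact: Ck_cst.
apply: (Ck_comp oU (h := fun x => x 0 i - p 0 i) (smooth1_hyp R)).
by apply: CkD => //; [exact: Ck_coord|exact: Ck_cst].
Qed.

Lemma bowl_ge0 p x : 0 <= bowl p x.
Proof. by apply: sumr_ge0 => i _; rewrite subr_ge0 hyp_ge1. Qed.

Lemma bowl_le_sqr p x : bowl p x <= enorm (x - p) ^+ 2 / 2.
Proof.
rewrite enorm_sqr /dot mulr_suml; apply: ler_sum => i _; rewrite !mxE -expr2.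
by have := hyp_le_sqr (x 0 i - p 0 i); lra.
Qed.

Lemma bowl_le p x : bowl p x <= n%:R * enorm (x - p).
Proof.
apply: (@le_trans _ _ (\sum_(i < n) enorm (x - p))).
  apply: ler_sum => i _; have := hyp_le_norm (x 0 i - p 0 i).
  by have := coord_le_enorm (x - p) i; rewrite !mxE; lra.
by rewrite sumr_const card_ord mulr_natl.
Qed.

Lemma gap_bowl p x y (t : R) : gap (bowl p) x y t =
  \sum_(i < n) ((1 - t) * hyp (x 0 i - p 0 i) + t * hyp (y 0 i - p 0 i) -
    hyp ((1 - t) * (x 0 i - p 0 i) + t * (y 0 i - p 0 i))).
Proof.
rewrite /gap /bowl !mulr_sumr -big_split -sumrB; apply: eq_bigr => i _ /=.
have -> : ((1 - t) *: x + t *: y) 0 i - p 0 i =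
    (1 - t) * (x 0 i - p 0 i) + t * (y 0 i - p 0 i) by rewrite !mxE; ring.
ring.
Qed.

Lemma cvx_bowl (V : set Rn) p : cvx V (bowl p).
Proof.
move=> x y t _ _ /andP[t0 t1]; rewrite gap_bowl; apply: sumr_ge0 => i _.
set a := x 0 i - _; set b := y 0 i - _; set w := _ + _ * b.
have t1' : 0 <= 1 - t by lra.
have := ler_wpM2l t1' (hyp_tangent w a); have := ler_wpM2l t0 (hyp_tangent w b).
have : (1 - t) * (w / hyp w * (a - w)) + t * (w / hyp w * (b - w)) = 0 by rewrite /w; ring.
lra.
Qed.

Lemma gap_bowl_ge p x y (t : R) : enorm (x - p) <= 1 -> enorm (y - p) <= 1 -> 0 <= t <= 1 ->
  t * (1 - t) * dot (x - y) (x - y) / 12 <= gap (bowl p) x y t.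
Proof.
move=> x1 y1 /andP[t0 t1]; rewrite gap_bowl /dot mulr_sumr mulr_suml.
apply: ler_sum => i _; rewrite !mxE.
have a1 : `|x 0 i - p 0 i| <= 1.
  by apply: le_trans x1; have := coord_le_enorm (x - p) i; rewrite !mxE.
have b1 : `|y 0 i - p 0 i| <= 1.
  by apply: le_trans y1; have := coord_le_enorm (y - p) i; rewrite !mxE.
have -> : x 0 i - y 0 i = (x 0 i - p 0 i) - (y 0 i - p 0 i) by ring.
move: a1 b1; set a := x 0 i - _; set b := y 0 i - _ => a1 b1.
set w := _ + _ * b.
have w1 : `|w| <= 1.
  move: a1 b1; rewrite !ler_norml => /andP[? ?] /andP[? ?]; apply/andP; split; rewrite /w; nra.
have t1' : 0 <= 1 - t by lra.
have := ler_wpM2l t1' (hyp_tangent_strong w1 a1); have := ler_wpM2l t0 (hyp_tangent_strong w1 b1).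
have : (1 - t) * (w / hyp w * (a - w)) + t * (w / hyp w * (b - w)) = 0 by rewrite /w; ring.
have : (1 - t) * ((a - w) ^+ 2 / 12) + t * ((b - w) ^+ 2 / 12) =
  t * (1 - t) * ((a - b) * (a - b)) / 12 by rewrite /w; field.
set q := w / hyp w; set A := (a - w) ^+ 2; set B := (b - w) ^+ 2.
set C := (a - b) * (a - b); lra.
Qed.

Lemma slope_le_bowl (V : set Rn) p x : slope_le V (bowl p) x (enorm (x - p)).
Proof.
move=> y _; pose xi : Rn := \row_i ((x 0 i - p 0 i) / hyp (x 0 i - p 0 i)).
apply: (@le_trans _ _ (dot xi (x - y))).
  rewrite /bowl -sumrB /dot; apply: ler_sum => i _; rewrite !mxE.
  have := hyp_tangent (x 0 i - p 0 i) (y 0 i - p 0 i).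
  have -> : y 0 i - p 0 i - (x 0 i - p 0 i) = - (x 0 i - y 0 i) by ring.
  by rewrite mulrN; lra.
apply: le_trans (dot_le_enorm _ _) _; rewrite ler_wpM2r ?enorm_ge0 //.
apply: ler_wsqrtr; apply: ler_sum => i _; rewrite !mxE.
set a := x 0 i - _; rewrite exprMn exprVn hyp_sqr.
rewrite ler_pdivrMr ?hyp_arg_gt0 //.
by have := sqr_ge0 a; nra.
Qed.

End Bowl.

(** * Quantitative strong convexity near a point *)

Section StrongPiece.
Variables (R : realType) (n : nat) (U : set 'rV[R]_n).
Hypotheses (oU : open U) (cU : convex_set U).
Local Notation Rn := 'rV[R]_n.
Implicit Types (x y z p : Rn) (h : Rn -> R) (L : R).

(** Convexity of h - c|x|^2 on the ball, in view of the gap of the squared norm. *)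
Definition strong_near h p (c r : R) := [/\ 0 < c, 0 < r &
  forall x y t, enorm (x - p) < r -> enorm (y - p) < r -> 0 <= t <= 1 ->
    c * (t * (1 - t) * dot (x - y) (x - y)) <= gap h x y t].

(** Inside the ball, evaluate the gap at the midpoint of [p] and [x], where [h] is above its
    tangent. Outside, convexity propagates the growth c/2 (r/2)^2 reached at distance r/2 at a
    linear rate, which is c r/4. *)
Lemma strong_growth h p xi (c r : R) : cvx U h -> U p -> strong_near h p c r ->
  (forall x, enorm (x - p) < r -> U x) ->
  (forall x, U x -> h p + dot xi (x - p) <= h x) ->
  (forall x, enorm (x - p) < r -> c / 2 * enorm (x - p) ^+ 2 <= h x - (h p + dot xi (x - p))) /\
  (forall x, U x -> r <= enorm (x - p) ->
    c * r / 4 * enorm (x - p) <= h x - (h p + dot xi (x - p))).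
Proof.
move=> ch Up [c0 r0 Hc] rU Hxi.
have near x : enorm (x - p) < r ->
    c / 2 * enorm (x - p) ^+ 2 <= h x - (h p + dot xi (x - p)).
  move=> xr; have pr : enorm (p - p) < r by rewrite subrr enorm0.
  have h01 : 0 <= (2^-1 : R) <= 1 by lra.
  have := Hc p x _ pr xr h01; rewrite /gap.
  have Um := convex_set_comb cU Up (rU x xr) h01.
  have := Hxi _ Um; rewrite comb_sub dotZr -enorm_sqr (enormB p).
  set a := h _; set b := h _; set d := h _; set N := enorm _ ^+ 2; set D := dot _ _.
  lra.
split=> // x Ux rx; set N := enorm (x - p) in rx *.
have N0 : 0 < N by exact: lt_le_trans rx.
pose t := r / 2 / N; have t0 : 0 < t by rewrite !divr_gt0.
have tN : t * N = r / 2 by rewrite /t divfK // gt_eqF.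
have t1 : t <= 1 by rewrite /t ler_pdivrMr // mul1r; lra.
have t01 : 0 <= t <= 1 by rewrite ltW.
pose z := (1 - t) *: p + t *: x.
have zp : z - p = t *: (x - p) by rewrite /z comb_sub.
have zN : enorm (z - p) = r / 2 by rewrite zp enormZ gtr0_norm.
have zr : enorm (z - p) < r by rewrite zN; lra.
have := near z zr; rewrite zN zp dotZr.
have := cvx_le ch Up Ux t01; rewrite -/z.
set a := h z; set b := h p; set d := h x; set D := dot _ _ => H1 H2.
have H3 : c / 2 * (r / 2) ^+ 2 <= t * (d - (b + D)) by lra.
have : c / 2 * (r / 2) ^+ 2 * N <= r / 2 * (d - (b + D)).
  by have := ler_wpM2r (ltW N0) H3; rewrite (mulrAC t) tN.
move=> H4; rewrite -(ler_pM2l (_ : 0 < r / 2)) ?divr_gt0 //.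
by apply: le_trans H4; rewrite le_eqVlt; apply/orP; left; apply/eqP; field.
Qed.

Lemma cvx_locally_upper h p : cvx U h -> U p -> exists2 L, 0 <= L &
  \forall x \near p, h x <= h p + L * enorm (x - p).
Proof.
move=> ch Up; have [L L0 HL] := slope_bounded_near oU cU ch Up.
by exists L => //; apply: filterS HL => x /(_ p Up); lra.
Qed.

End StrongPiece.

(** * Approximations that are strongly convex near a given point *)

Section StrongApproximation.
Variables (R : realType) (n : nat) (U : set 'rV[R]_n).
Hypotheses (oU : open U) (cU : convex_set U).
Local Notation Rn := 'rV[R]_n.
Implicit Types (x y z p xi : Rn) (h : Rn -> R) (L : R).
Variable f : Rn -> R.
Hypothesis cf : cvx U f.

Lemma smallest_slope p : U p -> exists s, [/\ 0 <= s, slope_le U f p s &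
  forall L, 0 <= L -> slope_le U f p L -> s <= L].
Proof.
move=> Up; pose S := [set L | 0 <= L /\ slope_le U f p L].
have S0 : S !=set0.
  have [L L0 /nbhs_singleton HL] := slope_bounded_near oU cU cf Up.
  by exists L.
have Slb : has_lbound S by exists 0 => L [].
exists (inf S); split.
- by apply: lb_le_inf => // L [].
- move=> y Uy; have [N0|Nn0] := eqVneq (enorm (p - y)) 0.
    by have [L [_ /(_ y Uy)]] := S0; rewrite N0 !mulr0.
  have N0 : 0 < enorm (p - y) by rewrite lt_def Nn0 enorm_ge0.
  rewrite -ler_pdivrMr //; apply: lb_le_inf => // L [_ /(_ y Uy)].
  by rewrite ler_pdivrMr.
- by move=> L L0 HL; apply: ge_inf.
Qed.

(* A strictly shorter subgradient would exist if a strongly convex f attained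
   its minimal slope m > 0 at p: tilt the tangent at p. *)
Lemma min_slope_strong p c r : U p -> strong_near f p c r ->
  (forall x, enorm (x - p) < r -> U x) ->
  slope_le U f p (min_slope U f) -> min_slope U f = 0.
Proof.
move=> Up Hs rU; set m := min_slope U f => fm.
have m0 : 0 <= m by exact: (min_slope_ge0 oU cU cf Up).
apply/eqP; rewrite eq_le m0 andbT leNgt; apply/negP => m_gt0.
have [c0 r0 _] := Hs.
have [xi xim Hxi] := support_slope oU cU m0 cf Up fm.
have [_ far] := strong_growth cU cf Up Hs rU Hxi.
pose m' := Num.max 0 (m - c * r / 4).
have cr : 0 < c * r / 4 by rewrite divr_gt0 // mulr_gt0.
have m'm : m' < m by rewrite gt_max m_gt0 /=; lra.
have m'0 : 0 <= m' by rewrite le_max lexx.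
have : m <= m'.
  apply: (min_slope_le m'0); exists (f p - m * r - m' * enorm p) => x Ux.
  have : m' * enorm (x - p) <= m' * (enorm x + enorm p).
    by rewrite ler_wpM2l // -(enormN p) enormD.
  have N0 := enorm_ge0 (x - p).
  have dxi : - (m * enorm (x - p)) <= dot xi (x - p).
    have := dot_le_enorm xi (- (x - p)); rewrite dotNr enormN.
    have := ler_wpM2r N0 xim; lra.
  have [rx|xr] := leP r (enorm (x - p)).
    have := far x Ux rx.
    have : (m - c * r / 4) * enorm (x - p) <= m' * enorm (x - p).
      by rewrite ler_wpM2r // le_max lexx orbT.
    have : 0 <= m * r by rewrite mulr_ge0 // ltW.
    lra.
  have := Hxi x Ux.
  have : m * enorm (x - p) <= m * r by rewrite ler_wpM2l // ltW.
  have : 0 <= m' * enorm (x - p) by rewrite mulr_ge0.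
  lra.
by rewrite leNgt m'm.
Qed.

(** The room for the bowl: near [p], |xi| + nu |x - p| does not exceed the slope of [f] at [x]. If
    the slope s of [f] at [p] is above m, [fh] has a strictly shorter subgradient at [p], and lower
    semicontinuity keeps the slopes of [f] near [p] close to s or larger. *)
Lemma short_tangent (fh : Rn -> R) p c r : U p -> strong_near f p c r ->
  (forall x, enorm (x - p) < r -> U x) -> cvx U fh ->
  (forall x L, U x -> 0 <= L -> slope_le U f x L -> slope_le U fh x L) ->
  (forall x L, U x -> min_slope U f < L -> slope_le U f x L ->
     exists L', 0 <= L' < L /\ slope_le U fh x L') ->
  exists xi (nu0 rho0 : R), [/\ 0 < nu0, 0 < rho0,
    forall x, U x -> fh p + dot xi (x - p) <= fh x &
    forall nu x L, 0 < nu <= nu0 -> enorm (x - p) < rho0 -> 0 <= L ->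
      slope_le U f x L -> enorm xi + nu * enorm (x - p) <= L].
Proof.
move=> Up Hs rU cfh fh0 fh1.
have [c0 r0 Hc] := Hs.
have [s [s0 fs s_min]] := smallest_slope Up.
have m0 : 0 <= min_slope U f by exact: (min_slope_ge0 oU cU cf Up).
have ms : min_slope U f <= s.
  by apply: (min_slope_le s0); exact: slope_le_cone_minorized fs.
have [ms'|sm] := ltP (min_slope U f) s.
- have [L' [/andP[L'0 L's] fhL']] := fh1 p s Up ms' fs.
  have [xi xiL' Hxi] := support_slope oU cU L'0 cfh Up fhL'.
  (* Thirds, as L' + k = s - 2k must still be below the rate s - k witnessed by the [y] chosen next;
     this witness persists for x close to [p]. *)
  pose k := (s - L') / 3; have k0 : 0 < k by rewrite divr_gt0 // subr_gt0.
  have [y Uy Hy] : exists2 y, U y & (s - k) * enorm (p - y) < f p - f y.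
    apply: contrapT => Hn; have : s <= s - k.
      apply: s_min; first by rewrite /k; lra.
      by move=> y Uy; rewrite leNgt; apply/negP => Hy; apply: Hn; exists y.
    lra.
  pose eta := f p - f y - (s - k) * enorm (p - y).
  have eta0 : 0 < eta by rewrite subr_gt0.
  have s1 : 0 < 2 * s + 1 by lra.
  pose rho := Num.min 1 (Num.min r (eta / (2 * s + 1))).
  have rho_gt0 : 0 < rho by rewrite !lt_min ltr01 r0 divr_gt0.
  exists xi, k, rho; split=> // nu x L /andP[nu0 nuk] xr L0 fxL.
  move: xr; rewrite !lt_min => /andP[x1 /andP[xr]]; rewrite ltr_pdivlMr // => xeta.
  have Ux := rU x xr.
  have : L' + k <= L.
    rewrite leNgt; apply/negP => LL.
    have H1 := fxL y Uy; have H2 := fs x Ux.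
    have H3 : L * enorm (x - y) <= (s - 2 * k) * (enorm (x - p) + enorm (p - y)).
      apply: ler_pM => //; rewrite ?enorm_ge0 //; first by rewrite /k in LL *; lra.
      by have := enormD (x - p) (p - y); rewrite addrA subrK.
    have N0 := enorm_ge0 (x - p); have D0 := enorm_ge0 (p - y).
    rewrite (enormB p x) in H2.
    have kD : 0 <= k * enorm (p - y) by rewrite mulr_ge0 // ltW.
    have kN : 0 <= k * enorm (x - p) by rewrite mulr_ge0 // ltW.
    rewrite /eta in xeta; lra.
  have : nu * enorm (x - p) <= k.
    by have := enorm_ge0 (x - p); nra.
  lra.
(* Here s = m = 0, so [f] is minimal at [p] and the tangent of [fh] is horizontal. Quadratic growth
   forces the slope of [f] at x to be at least c/2 |x - p|. *)
have {ms sm}sm : s = min_slope U f by apply/eqP; rewrite eq_le sm ms.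
have s00 : s = 0 by rewrite sm; apply: (min_slope_strong Up Hs rU); rewrite -sm.
rewrite s00 in fs.
have [xi xi0 Hxi] := support_slope oU cU (lexx 0) cfh Up (fh0 p 0 Up (lexx 0) fs).
exists xi, (c / 2), r; split=> //; first by rewrite divr_gt0.
move=> nu x L /andP[nu0 nuc] xr L0 fxL.
have Ux := rU x xr; have := fxL p Up.
have f0 z : U z -> f p + dot 0 (z - p) <= f z.
  by move=> /fs; rewrite dotC dot0r mul0r; lra.
have [near _] := strong_growth cU cf Up Hs rU f0.
have := near x xr; rewrite dotC dot0r addr0.
have N0 := enorm_ge0 (x - p).
have xiE : enorm xi = 0 by apply/eqP; rewrite eq_le xi0 enorm_ge0.
rewrite xiE add0r; set N := enorm (x - p) in N0 *.
have [->|Nn0] := eqVneq N 0; first by move=> *; rewrite mulr0.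
have {}N0 : 0 < N by rewrite lt_def Nn0.
move=> H1 H2; rewrite -(ler_pM2r N0).
apply: (@le_trans _ _ (c / 2 * N ^+ 2)); last by lra.
by rewrite expr2 mulrA !ler_wpM2r // ltW.
Qed.

Lemma strong_approx p c r (sigma : R) : U p -> strong_near f p c r -> 0 < sigma ->
  exists g c' r', [/\ smooth_minorant U f (slope_le U f) g,
    forall x, U x -> f x - sigma <= g x & strong_near g p c' r'].
Proof.
move=> Up Hs0 sigma0.
have [k Hk] := exhaust_near oU Up.
have /nbhs_enormP[r1 r10 Hr1] := Hk.
have [c0 r00 Hc0] := Hs0.
pose r' := Num.min r r1.
have r'0 : 0 < r' by rewrite lt_min r00.
have r'U x : enorm (x - p) < r' -> exhaust U k x.
  by rewrite lt_min => /andP[_]; exact: Hr1.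
have rU x : enorm (x - p) < r' -> U x by move=> /r'U /exhaust_sub.
have Hs : strong_near f p c r'.
  by split=> // x y t; rewrite !lt_min => /andP[xr _] /andP[yr _]; exact: Hc0.
have s8 : 0 < sigma / 8 by rewrite divr_gt0.
have [fh [[cfh fhf f_fh fh_smooth] [fh0 fh1 fh_gap]]] :=
  compact_approx oU cU cf Up (compact_exhaust (r := k)) (@exhaust_sub _ _ U k) s8.
pose d := c / 2; have d0 : 0 < d by rewrite divr_gt0.
have Hsh : strong_near fh p d r'.
  split=> // x y t xr yr t01; apply: le_trans (fh_gap x y t (r'U x xr) (r'U y yr) _ t01).
    rewrite lt_min in xr; rewrite lt_min in yr; move: xr yr => /andP[xr _] /andP[yr _].
    by have := Hc0 x y t xr yr t01; rewrite /d; lra.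
  by apply: r'U; exact: enorm_comb_lt.
have [xi [nu0 [rho0 [nu00 rho00 Hxi dom]]]] := short_tangent Up Hs rU cfh fh0 fh1.
have [near far] := strong_growth cU cfh Up Hsh rU Hxi.
pose rho := Num.min rho0 r'.
have rho_gt0 : 0 < rho by rewrite lt_min rho00.
have rhor : rho <= r' by rewrite ge_min lexx orbT.
have n1 : 0 < 1 + n%:R :> R by rewrite ltr_pwDl.
(* The bowl thus takes at most half of the growth of [fh] above its tangent: nu/2 <= d/4 serves
   within r' of [p], nu n <= d r'/8 beyond. The 1 + n avoids a zero divisor in dimension 0. *)
pose nu := Num.min nu0 (Num.min (d / 2) (d * r' / 8 / (1 + n%:R))).
have nu_gt0 : 0 < nu by rewrite !lt_min nu00 !divr_gt0 // mulr_gt0.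
have nu_nu0 : nu <= nu0 by rewrite ge_min lexx.
have nu_d : nu <= d / 2 by rewrite !ge_min lexx orbT.
have nu_n : nu * (1 + n%:R) <= d * r' / 8 by rewrite -ler_pdivlMr // !ge_min lexx !orbT.
pose b x := affine (fh p) xi p x + nu * bowl p x.
have gap_growth x : U x -> nu * bowl p x <= (fh x - affine (fh p) xi p x) / 2.
  move=> Ux; rewrite /affine; have N0 := enorm_ge0 (x - p).
  have [rx|xr] := leP r' (enorm (x - p)).
    have := far x Ux rx; have := bowl_le p x.
    move=> /(ler_wpM2l (ltW nu_gt0)).
    have : nu * (n%:R * enorm (x - p)) <= d * r' / 8 * enorm (x - p).
      rewrite mulrA ler_wpM2r //; apply: le_trans nu_n.
      by rewrite mulrDr mulr1 lerDr ltW.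
    lra.
  have := near x xr; have := bowl_le_sqr p x; move=> /(ler_wpM2l (ltW nu_gt0)).
  have := ler_wpM2r (sqr_ge0 (enorm (x - p))) nu_d.
  lra.
(* At distance rho or more the growth is at least d rho^2/4, so [b] is at most fh - d rho^2/8, below
   [E'], which is at least fh - 2 kap. The bound sigma/16 keeps the seed within sigma/4 of [f] near
   [p]. *)
pose kap := Num.min (d * rho ^+ 2 / 32) (sigma / 16).
have kap0 : 0 < kap by rewrite lt_min !divr_gt0 // mulr_gt0 // exprn_gt0.
have kap_d : kap <= d * rho ^+ 2 / 32 by rewrite ge_min lexx.
have kap_s : kap <= sigma / 16 by rewrite ge_min lexx orbT.
have [E [EP HE]] := fh_smooth kap kap0.
have E'P := smooth_minorantD oU (c := - kap) _ EP.
have {E'P}[CE' cE' E'fh E'Q] := E'P ltac:(by rewrite oppr_le0 ltW).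
pose E' x := E x + - kap.
have b_far x : U x -> rho <= enorm (x - p) -> b x <= E' x.
  move=> Ux rx; have := HE x Ux; have := gap_growth x Ux; rewrite /b /E'.
  have rho2 : 0 <= rho ^+ 2 by exact: sqr_ge0.
  suff : d * rho ^+ 2 / 4 <= fh x - affine (fh p) xi p x by lra.
  have [rx'|xr] := leP r' (enorm (x - p)).
    apply: le_trans (far x Ux rx').
    have : rho * rho <= r' * enorm (x - p) by apply: ler_pM => //; exact: ltW.
    by move=> /(ler_wpM2l (ltW d0)); rewrite expr2; lra.
  apply: le_trans (near x xr).
  have : rho ^+ 2 <= enorm (x - p) ^+ 2.
    by rewrite ler_pXn2r ?nnegrE ?enorm_ge0 // ltW.
  by move=> /(ler_wpM2l (ltW d0)); nra.
have kap2 : 0 < kap / 2 by rewrite divr_gt0.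
have cb : cvx U b.
  move=> x y t Ux Uy t01; have -> : gap b x y t = gap (affine (fh p) xi p) x y t +
    nu * gap (bowl p) x y t by rewrite /gap /b; ring.
  by rewrite gap_affine add0r mulr_ge0 ?(ltW nu_gt0) //; exact: (@cvx_bowl _ _ U).
have Cb : C_infty_on U b.
  apply: (C_inftyD oU (C_infty_affine oU _ _ _)).
  exact: (C_inftyZ oU nu (C_infty_bowl p oU)).
have b_fh x : U x -> b x <= fh x.
  move=> Ux; have := gap_growth x Ux; have := Hxi x Ux; rewrite /b /affine; lra.
have b_slope x L : enorm (x - p) < rho -> 0 <= L -> slope_le U f x L -> slope_le U b x L.
  rewrite lt_min => /andP[xr _] L0 fxL y Uy.
  have := slope_le_affine (V := U) (fh p) p x (lexx (enorm xi)) Uy.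
  have := slope_le_bowl p x Uy; move=> /(ler_wpM2l (ltW nu_gt0)).
  have nub : 0 < nu <= nu0 by rewrite nu_gt0.
  have := ler_wpM2r (enorm_ge0 (x - y)) (dom nu x L nub xr L0 fxL).
  by rewrite /b; lra.
(* With [E'] as first argument the maximum is exact where [E'] dominates, so [b] leaves no trace at
   distance rho or more from [p], where its slope is not controlled. *)
pose K x := smax (kap / 2) (E' x) (b x).
have KP : smooth_minorant U f (slope_le U f) K.
  split.
  - exact: (C_infty_smax oU _ CE' Cb).
  - exact: cvx_smax.
  - move=> x Ux; apply: le_trans (fhf x Ux); apply: smax_lub => //; last exact: b_fh.
    exact: E'fh.
  - move=> x L Ux L0 fxL; have [bE|Eb] := leP (b x) (E' x).
      by apply: slope_le_smaxl => //; exact: E'Q.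
    apply: slope_le_smax => //; first exact: E'Q.
    apply: b_slope => //; rewrite ltNge; apply/negP => /(b_far x Ux).
    by rewrite leNgt Eb.
have [L L0 HL] := cvx_locally_upper oU cU cfh Up.
have L1 : 0 < L + enorm xi + 1 by rewrite ltr_wpDl // addr_ge0 // enorm_ge0.
(* At [p], [b] equals [fh] while [E'] is at most fh - kap; on a small ball a difference of kap/2
   remains, and there K is [b] minus a constant. *)
have e0 : 0 < kap / 2 / (L + enorm xi + 1) by rewrite !divr_gt0.
have K_near : \forall x \near p, K x = b x + - smax_drop (kap / 2).
  apply: filterS3 HL (near_enorm p e0) (near_open oU Up) => x HLx.
  rewrite ltr_pdivlMr // => xe Ux.
  apply: smax_eqr => //; have := E'fh x Ux; rewrite -/(E' x) => E'x.
  have : E x <= fh x by have [_ _ EF _] := EP; exact: EF.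
  have := bowl_ge0 p x; move=> /(mulr_ge0 (ltW nu_gt0)).
  have := dot_le_enorm xi (- (x - p)); rewrite dotNr enormN.
  have := enorm_ge0 (x - p).
  by rewrite /b /affine /E'; lra.
have [g [gP g_ge g_near]] := smooth_approx_with oU cU cf Up sigma0 KP.
have K_ge : \forall x \near p, f x - sigma / 4 <= K x.
  apply: filterS Hk => x Kx; have Ux := exhaust_sub Kx.
  have := smax_gel kap2 (E' x) (b x); rewrite -/(K x).
  have := f_fh x Kx; have := HE x Ux; rewrite /E'; lra.
have gK := g_near p Up K_ge.
have [r2 r20 Hr2] : exists2 e, 0 < e & forall x, enorm (x - p) < e ->
    g x = b x + - smax_drop (kap / 2).
  by apply/nbhs_enormP; apply: filterS2 gK K_near => x -> ->.
exists g, (nu / 12), (Num.min r2 1); split=> //; split.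
- by rewrite divr_gt0.
- by rewrite lt_min r20 ltr01.
- move=> x y t xr yr t01; have zr := enorm_comb_lt xr yr t01.
  move: xr yr zr; rewrite !lt_min => /andP[xr x1] /andP[yr y1] /andP[zr _].
  have -> : gap g x y t = gap (affine (fh p) xi p) x y t + nu * gap (bowl p) x y t.
    by rewrite /gap !Hr2 // /b; ring.
  have := gap_bowl_ge (ltW x1) (ltW y1) t01.
  by move=> /(ler_wpM2l (ltW nu_gt0)); rewrite gap_affine; lra.
Qed.

End StrongApproximation.

(** * The squared norm as a test function, and rational centers *)

Section SquaredNorm.
Variables (R : realType) (n : nat).
Local Notation Rn := 'rV[R]_n.
Implicit Types (x y p v : Rn).

Lemma gap_sqr_norm x y (t : R) :
  gap (fun z => dot z z) x y t = t * (1 - t) * dot (x - y) (x - y).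
Proof.
rewrite /gap /dot !mulr_sumr -big_split -sumrB; apply: eq_bigr => i _ /=.
by rewrite !mxE; ring.
Qed.

Lemma C_infty_sqr_norm (V : set Rn) : open V -> C_infty_on V (fun x => dot x x).
Proof.
move=> oV; apply/C_inftyP => k; apply: Ck_sum => // i.
by apply: CkM => //; exact: Ck_coord.
Qed.

Lemma derive_sqr_norm v : 'D_v (fun x => dot x x) = (fun x : Rn => 2 * dot x v).
Proof.
apply/funext => x; apply: (@derive_val _ _ _ _ _ _ _ _).
apply: (@is_derive_quadratic _ _ _ _ _ _ (dot v v) 1) => // u _.
have -> : dot (u *: v + x) (u *: v + x) - dot x x - u * (2 * dot x v) = u ^+ 2 * dot v v.
  rewrite dotDl !dotDr !dotZl !dotZr (dotC x v); ring.
by rewrite mulrC ger0_norm // mulr_ge0 ?dot_ge0 ?sqr_ge0.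
Qed.

Lemma pos_second_derivative_sqr_norm (V : set Rn) :
  pos_second_derivative_on V (fun x => dot x x).
Proof.
move=> x v _ v0; rewrite derive_sqr_norm.
suff -> : 'D_v (fun x : Rn => 2 * dot x v) x = 2 * dot v v.
  rewrite mulr_gt0 // lt_def dot_ge0 andbT -enorm_sqr expf_eq0 /=.
  by rewrite enorm_eq0.
apply: (@derive_val _ _ _ _ _ _ _ _).
apply: (@is_derive_quadratic _ _ _ _ _ _ 0 1) => // u _.
have -> : 2 * dot (u *: v + x) v - 2 * dot x v - u * (2 * dot v v) = 0.
  by rewrite dotDl dotZl; ring.
by rewrite normr0 mul0r.
Qed.

Lemma rational_row_dense p (e : R) : 0 < e ->
  exists q : 'rV[rat]_n, enorm (p - map_mx ratr q) < e.
Proof.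
move=> e0; have /nbhs_ballP[d /= d0 Hd] := near_enorm p e0.
have H i : exists q : rat, `|p 0 i - ratr q| < d.
  have [q] := @rat_in_itvoo R (p 0 i - d) (p 0 i + d) ltac:(by lra).
  by rewrite in_itv /= => /andP[q1 q2]; exists q; rewrite ltr_norml; apply/andP; split; lra.
have [q Hq] := choice H; exists (\row_i q i); rewrite enormB; apply: Hd.
by split=> // i j; rewrite (ord1 i) /ball /= !mxE.
Qed.

End SquaredNorm.

Section StrongConvexity.
Variables (R : realType) (n : nat) (U : set 'rV[R]_n).
Hypothesis oU : open U.
Local Notation Rn := 'rV[R]_n.
Implicit Types (x y p : Rn) (h : Rn -> R).

Lemma strong_near_center h p q (c r r' : R) : 0 < r' -> enorm (p - q) + r' <= r ->
  strong_near h p c r -> strong_near h q c r'.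
Proof.
move=> r'0 pq [c0 r0 H]; split=> // x y t xr yr; apply: H.
  by have := enormD (x - q) (q - p); rewrite addrA subrK (enormB q); lra.
by have := enormD (y - q) (q - p); rewrite addrA subrK (enormB q); lra.
Qed.

Lemma strongly_convex_near h p : strongly_convex_on U h -> U p ->
  exists c r, strong_near h p c r.
Proof.
move=> sh Up; have [d [d0 [W [/nbhs_enormP[r r0 rW] WU _ /convex_functionP cW]]]] :=
  sh p Up U _ oU Up (C_infty_sqr_norm oU) (@pos_second_derivative_sqr_norm R n U).
exists d, r; split=> // x y t xr yr t01.
have := cW x y t (rW x xr) (rW y yr) t01.
by have := gap_sqr_norm x y t; rewrite /gap => <-; lra.
Qed.

(** The gap of any smooth phi is locally at most M times that of the squared norm, so one quadratic
    lower bound serves all test functions. Dividing by M + 1 covers M = 0. *)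
Lemma strongly_convex_onP h :
  (forall p, U p -> exists c r, strong_near h p c r) -> strongly_convex_on U h.
Proof.
move=> sh p Up V phi oV Vp Cphi _.
have [c [r1 [c0 r10 Hc]]] := sh p Up.
have [M [r2 [M0 r20 r2V HM]]] := gap_C_infty_le oV Cphi Vp.
have [r3 r30 r3U] := open_enorm oU Up.
have M1 : 0 < M + 1 by rewrite ltr_wpDl.
pose r := Num.min r1 (Num.min r2 r3).
have r0 : 0 < r by rewrite !lt_min r10 r20.
exists (c / (M + 1)); split; first by rewrite divr_gt0.
exists [set x | enorm (x - p) < r]; split.
- exact: near_enorm.
- move=> x /=; rewrite !lt_min => /and3P[_ x2 x3].
  by split; [exact: r3U|exact: r2V].
- by apply: convex_set_combP => x y t xr yr t01; exact: enorm_comb_lt.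
- apply/convex_functionP => x y t /= + + t01; rewrite !lt_min.
  move=> /and3P[x1 x2 _] /and3P[y1 y2 _].
  have := Hc x y t x1 y1 t01; have := HM x y t x2 y2 t01.
  set D := t * (1 - t) * _; have D0 : 0 <= D.
    by move: t01 => /andP[t0 t1]; rewrite !mulr_ge0 ?dot_ge0 // subr_ge0.
  set G := gap phi x y t => H1 H2.
  have -> : gap (fun z => h z - c / (M + 1) * phi z) x y t =
    gap h x y t - c / (M + 1) * G by rewrite /G /gap; ring.
  have cM : 0 <= c / (M + 1) by rewrite divr_ge0 // ltW.
  have : c / (M + 1) * (M + 1) = c by rewrite divfK // gt_eqF.
  by have := ler_wpM2l cM H1; nra.
Qed.

End StrongConvexity.

(** * Mixing approximants and comparing Lipschitz constants *)

Section Approximants.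
Variables (R : realType) (n : nat) (U : set 'rV[R]_n).
Hypotheses (oU : open U) (cU : convex_set U).
Local Notation Rn := 'rV[R]_n.
Implicit Types (x y p : Rn) (g h : Rn -> R) (L : R).
Variable f : Rn -> R.
Hypothesis cf : cvx U f.
Variable eps : R.
Hypothesis eps0 : 0 < eps.

Definition approximant g := smooth_minorant U f (slope_le U f) g /\
  forall x, U x -> f x - eps <= g x.

(** Bounds on values, differences and gaps are linear inequalities, stable under mixtures; and since
    all gaps are nonnegative, one term alone bounds the gap of the mixture from below. *)
Lemma approximant_mixture h0 (h : nat -> Rn -> R) : approximant h0 ->
  (forall k, approximant (h k)) ->
  exists w g, [/\ approximant g, forall k, 0 < w k &
    forall k x y t, U x -> U y -> 0 <= t <= 1 -> w k * gap (h k) x y t <= gap g x y t].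
Proof.
move=> [[C0 c0 h0f s0] fh0] Ah.
have [w [g [Cg w_gt0 w1 mix]]] : exists w g, [/\ C_infty_on U g, forall k, 0 < w k,
    forall N, \sum_(0 <= k < N) w k <= 1 &
    forall x, U x -> is_mix w (h0 x) (h ^~ x) (g x)].
  by apply: (smooth_mixture oU C0) => k; have [[]] := Ah k.
have w0 k : 0 <= w k by exact: ltW.
have gain k x y t : U x -> U y -> 0 <= t <= 1 -> w k * gap (h k) x y t <= gap g x y t.
  move=> Ux Uy t01; have Uz := convex_set_comb cU Ux Uy t01.
  have H := is_mixB (is_mixD (@is_mixZ _ _ (1 - t) _ _ _ (mix x Ux))
    (@is_mixZ _ _ t _ _ _ (mix y Uy))) (mix _ Uz).
  rewrite -[leLHS]add0r.
  apply: (is_mix_le w0 w1 _ _ (@is_mix_delta _ w 0 (gap (h k) x y t) k) H).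
    exact: c0.
  move=> j /=; rewrite add0r; have [->|_] := eqVneq j k; first by rewrite mul1r.
  by rewrite mul0r; have [[_ cj _ _] _] := Ah j; exact: cj.
exists w, g; split=> //; split; last first.
  move=> x Ux; apply: (is_mix_le w0 w1 _ _ (@is_mix_cst _ w (f x - eps)) (mix x Ux)).
    exact: fh0.
  by move=> k; have [_] := Ah k; apply.
split=> //.
- move=> x y t Ux Uy t01; apply: le_trans (gain 0%N x y t Ux Uy t01).
  by have [[_ c1 _ _] _] := Ah 0%N; rewrite mulr_ge0 //; exact: c1.
- move=> x Ux; apply: (is_mix_le w0 w1 _ _ (mix x Ux) (@is_mix_cst _ w (f x))).
    exact: h0f.
  by move=> k; have [[_ _ hf _] _] := Ah k; exact: hf.
- move=> x L Ux L0 fxL y Uy.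
  apply: (is_mix_le w0 w1 _ _ (is_mixB (mix x Ux) (mix y Uy))
    (@is_mix_cst _ w (L * enorm (x - y)))).
    exact: s0.
  by move=> k; have [[_ _ _ sk] _] := Ah k; exact: sk.
Qed.

(* One approximant serves all points at once: mix close approximants with, for
   each ball of rational center and radius 1/(j+1), an approximant which is
   strongly convex on that ball, whenever there is one. *)
Lemma convexity_preserving_approximant : U !=set0 ->
  exists g, [/\ approximant g, strictly_convex_on U f -> strictly_convex_on U g &
    strongly_convex_on U f -> strongly_convex_on U g].
Proof.
move=> [x0 Ux0].
have close i : exists g, approximant g /\ forall x, U x -> f x - eps / i.+1%:R <= g x.
  have e0 : 0 < eps / i.+1%:R by rewrite divr_gt0.
  have [g [gP fg]] := smooth_approx oU cU cf Ux0 e0; exists g; split=> //; split=> // x Ux.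
  apply: le_trans (fg x Ux); rewrite lerD2l lerN2 ler_pdivrMr //.
  by rewrite ler_peMr ?ler1n // ltW.
have [a aP] := choice close.
have strong (qj : 'rV[rat]_n * nat) : exists g, approximant g /\
    forall g' c, approximant g' -> strong_near g' (map_mx ratr qj.1) c qj.2.+1%:R^-1 ->
    exists c', strong_near g (map_mx ratr qj.1) c' qj.2.+1%:R^-1.
  have [[g [c [gP gs]]]|none] := pselect (exists g c, approximant g /\
      strong_near g (map_mx ratr qj.1) c qj.2.+1%:R^-1).
    by exists g; split=> // *; exists c.
  exists (a 0%N); split=> [|g' c gP gs]; first by have [] := aP 0%N.
  by exfalso; apply: none; exists g', c.
have [b bP] := choice strong.
(* A single enumeration of both countable families; numbers that encode nothing repeat [a 0]. *)
pose h k := match unpickle k : option (nat + 'rV[rat]_n * nat) with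
  | Some (inl i) => a i | Some (inr qj) => b qj | None => a 0%N end.
have ha i : h (pickle (inl i : nat + 'rV[rat]_n * nat)) = a i by rewrite /h pickleK.
have hb qj : h (pickle (inr qj : nat + 'rV[rat]_n * nat)) = b qj by rewrite /h pickleK.
have hP k : approximant (h k).
  rewrite /h; case: unpickle => [[i|qj]|]; first by have [] := aP i.
    by have [] := bP qj.
  by have [] := aP 0%N.
have [w [g [gP w0 gain]]] := approximant_mixture (hP 0%N) hP.
exists g; split=> //.
- move=> sf x y t Ux Uy xy /andP[t0 t1].
  have t01 : 0 <= t <= 1 by rewrite !ltW.
  have Uz := convex_set_comb cU Ux Uy t01.
  have gap0 : 0 < gap f x y t.
    by have := sf x y t Ux Uy xy; rewrite /gap t0 t1 => /(_ isT); lra.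
  (* Since [a N] is at most [f] at the intermediate point and at least f - eps/(N+1) at [x] and [y],
     its gap is at least that of [f] minus eps/(N+1), which is positive for this N. *)
  pose N := Num.bound (eps / gap f x y t).
  have Hi' : eps / N.+1%:R < gap f x y t.
    rewrite ltr_pdivrMr // mulrC -ltr_pdivrMr //.
    have := archi_boundP (ltW (divr_gt0 eps0 gap0)); rewrite -/N => /lt_trans; apply.
    by rewrite ltr_nat.
  have [[[_ _ af _] _] fa] := aP N.
  have := gain _ x y t Ux Uy t01; move=> /(_ (pickle (inl N : nat + 'rV[rat]_n * nat))).
  rewrite ha; set k := pickle _.
  suff G : 0 < gap (a N) x y t.
    by have := mulr_gt0 (w0 k) G; set G' := _ * _; rewrite /gap; lra.
  have t1' : 0 <= 1 - t by lra.
  have := ler_wpM2l t1' (fa x Ux); have := ler_wpM2l (ltW t0) (fa y Uy).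
  have := af _ Uz; move: Hi'; rewrite /gap; set e := eps / _; set z := _ + _ *: y; lra.
- move=> sf; apply: (strongly_convex_onP oU) => p Up.
  have [c [r Hs]] := strongly_convex_near oU sf Up.
  have [g' [c' [r' [g'P fg' Hs']]]] := strong_approx oU cU cf Up Hs eps0.
  have [c'0 r'0 _] := Hs'.
  (* The radius 1/(j+1) is below r'/2 and the rational center is within half that radius of [p]: the
     rational ball lies in the ball of radius r' and contains a neighbourhood of [p]. *)
  pose j := Num.bound (2 / r').
  have jr : j.+1%:R^-1 < r' / 2.
    rewrite invf_plt ?posrE ?divr_gt0 // invf_div.
    have r2 : 0 <= 2 / r' by rewrite divr_ge0 // ltW.
    apply: lt_trans (archi_boundP r2) _; rewrite -/j.
    by rewrite ltr_nat.
  have j0 : 0 < j.+1%:R^-1 :> R by rewrite invr_gt0.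
  have j2 : 0 < j.+1%:R^-1 / 2 :> R by rewrite divr_gt0.
  have [q Hq] := rational_row_dense p j2.
  have [_ HB] := bP (q, j).
  have [|c2 Hc2] := HB g' c' (conj g'P fg').
    apply: (strong_near_center j0 _ Hs'); move: Hq j0 jr; rewrite /=; set J := _^-1; set N := enorm _; lra.
  pose k := pickle (inr (q, j) : nat + 'rV[rat]_n * nat).
  have tri x : enorm (x - p) < j.+1%:R^-1 / 2 -> enorm (x - map_mx ratr q) < j.+1%:R^-1.
    have := enormD (x - p) (p - map_mx ratr q); rewrite addrA subrK; move: Hq.
    set J := _.+1%:R^-1; set A := enorm _; set B := enorm _; set D := enorm _; lra.
  have [c20 _ Hb] := Hc2; have [r0 r00 rU] := open_enorm oU Up.
  exists (w k * c2), (Num.min (j.+1%:R^-1 / 2) r0); split=> [||x y t].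
  - by rewrite mulr_gt0.
  - by rewrite lt_min j2 r00.
  rewrite !lt_min => /andP[xj x0r] /andP[yj y0r] t01.
  apply: le_trans (gain k x y t (rU x x0r) (rU y y0r) t01).
  rewrite -(mulrA (w k)) ler_wpM2l ?(ltW (w0 k)) // /k hb; apply: Hb => //=.
    exact: tri.
  exact: tri.
Qed.

(** A constant valid for [f] on the enlarged ball bounds its differences around each point of the
    small ball, hence its slope there, hence that of [g]. The slope bounds at two points together
    control |g x - g y|. *)
Lemma approximant_Lip g (c : Rn) (e r : R) : 0 <= e -> 0 < r -> approximant g ->
  eball c r `<=` U -> (Lip (eball c r) g <= Lip (eball c ((1 + e) * r) `&` U) f)%E.
Proof.
move=> e0 r0 [[_ _ _ gs] _] cU'; apply: le_ereal_inf => _ [L [L0 HL] <-].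
exists L => //; split=> //.
have slope x : eball c r x -> slope_le U g x L.
  move=> /= xr; have Ux := cU' x xr; apply: gs => //.
  have r'0 : 0 < r - enorm (x - c) by rewrite subr_gt0.
  apply: (slope_le_loc cU cf Ux r'0) => y Uy yx.
  have wide z : enorm (z - c) < r -> enorm (z - c) < (1 + e) * r.
    by move=> /lt_le_trans; apply; rewrite ler_peMl ?(ltW r0) // lerDl.
  apply: le_trans (ler_norm _) (HL x y _ _); split=> //; apply: wide => //.
  by have := enormD (y - x) (x - c); rewrite addrA subrK; lra.
move=> x y xr yr; rewrite ler_norml; apply/andP; split.
  by have := slope y yr x (cU' x xr); rewrite (enormB x); lra.
exact: slope (cU' y yr).
Qed.

End Approximants.

Theorem corollary1 (R : realType) (n : nat) (U : set 'rV[R]_n)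
    (openU : open U) (convexU : convex_set U)
    (f : 'rV[R]_n -> R) (convexf : convex_function U f)
    (eps : R) (eps_gt0 : 0 < eps) :
  exists g : 'rV[R]_n -> R,
    [/\ C_infty_on U g,
        convex_function U g &
        forall x, U x -> f x - eps <= g x <= f x] /\
    (forall (c : 'rV[R]_n) (r : R), 0 < r -> eball c r `<=` U ->
       (Lip (eball c r) g <= Lip (eball c ((1 + eps) * r) `&` U) f)%E) /\
    (strictly_convex_on U f -> strictly_convex_on U g) /\
    (strongly_convex_on U f -> strongly_convex_on U g).
Proof.
have cf : cvx U f by apply/convex_functionP.
(* On an empty [U] the function [f] itself will do: a ball of positive radius contains its center,
   so none is included in [U]. *)
have [U0|U0] := pselect (U !=set0); last first.
  have noU x : ~ U x by move=> Ux; apply: U0; exists x.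
  exists f; split; [split=> // x /noU //|split=> // c r r0 cU].
  by case: (noU c); apply: cU; rewrite /eball /= subrr enorm0.
have [g [gP gstrict gstrong]] := convexity_preserving_approximant openU convexU cf eps_gt0 U0.
have [[Cg cg gf _] fg] := gP.
exists g; split; first split=> //.
- exact/convex_functionP.
- by move=> x Ux; rewrite gf // fg.
split=> // c r r0 cU; apply: (approximant_Lip convexU cf (ltW eps_gt0) r0 gP cU).
Qed.
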